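(* Let $G$ be a right half-Lie group modeled on a sequentially complete locally convex space $E$ which admits a local addition, and let $1\le p<\infty$. Let $G$ be $L^p$-semiregular with continuous evolution map $$\mathrm{Evol}_C:L^p([0,1],T_eG)\to C([0,1],G),\quad\gamma\mapsto\mathrm{Evol}_C(\gamma).$$ If the map $$\tau:T_eG\times G\to TG,\quad(v,g)\mapsto v.g$$ is continuous, then the evolution map $$\mathrm{Evol}:L^p([0,1],T_eG)\to AC_{L^p}([0,1],G),\quad\gamma\mapsto\mathrm{Evol}(\gamma)$$ is continuous. Likewise, if $G$ is a right half-Lie group modeled on an integral complete locally convex space $E$ which admits a local addition, $G$ is $L^\infty_{rc}$-semiregular, $\mathrm{Evol}_C:L^\infty_{rc}([0,1],T_eG)\to C([0,1],G)$ is continuous and $\tau$ is continuous, then $\mathrm{Evol}:L^\infty_{rc}([0,1],T_eG)\to AC_{L^\infty_{rc}}([0,1],G)$ is continuous.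
   Context: Calculus. All locally convex spaces are Hausdorff and real. A map $f:U\to F$ from an open subset $U$ of a locally convex space $E$ to a locally convex space $F$ is $C^1$ if it is continuous, the directional derivatives $df(x,y)=\lim_{t\to 0}\frac1t(f(x+ty)-f(x))$ exist for all $(x,y)\in U\times E$ and $df:U\times E\to F$ is continuous; $C^k$ if it is $C^1$ and $df$ is $C^{k-1}$; smooth ($C^\infty$) if $C^k$ for all $k$. Manifolds modeled on locally convex spaces and tangent bundles $\pi_{TN}:TN\to N$ are defined with this calculus; a manifold structure on a mapping space may have charts in different modeling spaces. For a chart $\varphi:U\to V\subseteq E$, $d\varphi:TU\to E$ denotes the second component of $T\varphi:TU\to V\times E$. $E$ is integral complete if the weak integral $\int_0^1\gamma(s)\,ds$ exists in $E$ for every continuous $\gamma:[0,1]\to E$. Lebesgue spaces. A map $\gamma:[a,b]\to E$ is Lusin measurable if for each compact $K\subseteq[a,b]$ there are compact sets $K_n\subseteq K$ ($n\in\mathbb N$) with $\gamma|_{K_n}$ continuous and $K\setminus\bigcup_nK_n$ of Lebesgue measure $0$. For $1\le p<\infty$, $\mathcal L^p([a,b],E)$ is the space of Lusin measurable $\gamma$ with $q\circ\gamma\in\mathcal L^p([a,b],\mathbb R)$ for each continuous seminorm $q$ on $E$; $L^p([a,b],E)$ is its quotient modulo equality almost everywhere, with the topology given by the seminorms $[\gamma]\mapsto\|q\circ\gamma\|_{L^p}$. $\mathcal L^\infty_{rc}([a,b],E)$ is the space of Borel measurable $\gamma:[a,b]\to E$ whose image has compact and metrizable closure, and $L^\infty_{rc}([a,b],E)$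 is its quotient modulo equality almost everywhere, with the seminorms $[\gamma]\mapsto\operatorname{ess\,sup}_{t}q(\gamma(t))$. Absolute continuity. Let $\mathcal F$ stand for $L^p$ (with $E$ sequentially complete) or $L^\infty_{rc}$ (with $E$ integral complete). $AC_{\mathcal F}([a,b],E)$ is the space of functions $\eta:[a,b]\to E$ with $\eta(t)=\eta(t_0)+\int_{t_0}^t\gamma(s)\,ds$ (weak integral) for some $[\gamma]\in\mathcal F([a,b],E)$; then $\eta':=[\gamma]$ is unique, and the topology is the one making $\eta\mapsto(\eta(t_0),\eta')\in E\times\mathcal F([a,b],E)$ an isomorphism of topological vector spaces. For a manifold $N$ modeled on $E$, a continuous $\eta:[a,b]\to N$ is in $AC_{\mathcal F}([a,b],N)$ if there are a partition $a=t_0<\dots<t_n=b$ and charts $\varphi_i:U_i\to V_i$ with $\eta([t_{i-1},t_i])\subseteq U_i$ and $\varphi_i\circ\eta|_{[t_{i-1},t_i]}\in AC_{\mathcal F}([t_{i-1},t_i],E)$ for all $i$. For such $\eta$, $\Gamma_{AC}(\eta):=\{\sigma\in AC_{\mathcal F}([a,b],TN):\pi_{TN}\circ\sigma=\eta\}$ is a locally convex space with the initial topology with respect to the maps $\sigma\mapsto d\varphi_i\circ\sigma|_{[t_{i-1},t_i]}\in AC_{\mathcal F}([t_{i-1},t_i],E)$ (independent of choices). Manifold structure on $AC_{\mathcal F}([a,b],N)$. A local addition on $N$ is a map $\Sigma:\Omega\to N$ on an open set $\Omega\subseteq TN$ containing all zero vectors $0_x$, with $\Sigma(0_x)=x$,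 such that $(\pi_{TN},\Sigma):\Omega\to N\times N$ has open image $\Omega'$ and is a $C^\infty$-diffeomorphism onto $\Omega'$. If $N$ admits a local addition, $AC_{\mathcal F}([a,b],N)$ has the smooth manifold structure (independent of $\Sigma$) for which all sets $\mathcal U_\eta=\{\gamma:(\eta,\gamma)([a,b])\subseteq\Omega'\}$ are open and all maps $\{\tau\in\Gamma_{AC}(\eta):\tau([a,b])\subseteq\Omega\}\to\mathcal U_\eta$, $\tau\mapsto\Sigma\circ\tau$ are $C^\infty$-diffeomorphisms. Half-Lie groups. A right half-Lie group modeled on $E$ is a group $G$ with a smooth manifold structure modeled on $E$ which makes $G$ a topological group and all right translations $\rho_g:G\to G$, $x\mapsto xg$ smooth. Let $e$ be its neutral element and $v.g:=T_e\rho_g(v)\in T_gG$ for $v\in T_eG$, $g\in G$. Carathéodory solutions. For $[\gamma]\in\mathcal F([0,1],T_eG)$ and a nondegenerate interval $I\subseteq[0,1]$, a Carathéodory solution on $I$ of $\dot y(t)=\gamma(t).y(t)$ is a continuous $\eta:I\to G$ that solves the corresponding integral equation piecewise in charts: for each $[\alpha,\beta]\subseteq I$ and each chart $\varphi:U\to V\subseteq E$ of $G$ with $\eta([\alpha,\beta])\subseteq U$, the function $s\mapsto d\varphi(\gamma(s).\eta(s))$ is in $\mathcal L^1([\alpha,\beta],E)$ and $\varphi(\eta(t))=\varphi(\eta(\alpha))+\int_\alpha^t d\varphi(\gamma(s).\eta(s))\,ds$ for $t\in[\alpha,\beta]$. The equation satisfies local uniqueness if for any Carathéodory solutions $\eta_1:I_1\to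 G$, $\eta_2:I_2\to G$ and $t_0\in I_1\cap I_2$ with $\eta_1(t_0)=\eta_2(t_0)$, $\eta_1$ and $\eta_2$ coincide on a neighborhood of $t_0$ in $I_1\cap I_2$. Semiregularity. $G$ is $\mathcal F$-semiregular if for each $[\gamma]\in\mathcal F([0,1],T_eG)$ the equation $\dot y(t)=\gamma(t).y(t)$ satisfies local uniqueness of Carathéodory solutions and there is a Carathéodory solution $\eta=\eta_\gamma\in AC_{\mathcal F}([0,1],G)$ on $[0,1]$ with $\eta(0)=e$. Then $\mathrm{Evol}(\gamma):=\eta_\gamma\in AC_{\mathcal F}([0,1],G)$, and $\mathrm{Evol}_C(\gamma)$ is the same function regarded as an element of $C([0,1],G)$, which carries the compact-open topology. *)

(* Defs.v *)
From HB Require Import structures.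
From mathcomp Require Import all_boot all_order all_algebra.
From mathcomp Require Import all_classical all_reals all_analysis.
Import numFieldNormedType.Exports.
Import Order.TTheory GRing.Theory Num.Theory.

Set Implicit Arguments.
Unset Strict Implicit.
Unset Printing Implicit Defensive.

Local Open Scope classical_set_scope.
Local Open Scope ring_scope.

HB.mixin Record isHausdorff (T : Type) of Topological T := {
  lcs_hausdorff : hausdorff_space T }.

#[short(type="lcsType")]
HB.structure Definition Lcs (R : realType) := {E of Tvs R E & isHausdorff E}.

Lemma prod_hausdorff (S T : topologicalType) :
  hausdorff_space S -> hausdorff_space T -> hausdorff_space (S * T)%type.
Proof.
move=> hS hT -[x1 x2] [y1 y2] xy; congr pair.
- apply: hS => A B Ax By.
  have [] := xy (A `*` setT) (B `*` setT).
  + by exists (A, setT) => //; split => //; exact: filterT.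
  + by exists (B, setT) => //; split => //; exact: filterT.
  by move=> z [[? _] [? _]]; exists z.1.
- apply: hT => A B Ax By.
  have [] := xy (setT `*` A) (setT `*` B).
  + by exists (setT, A) => //; split => //; exact: filterT.
  + by exists (setT, B) => //; split => //; exact: filterT.
  by move=> z [[_ ?] [_ ?]]; exists z.2.
Qed.

HB.instance Definition _ (R : realType) (E F : lcsType R) :=
  isHausdorff.Build (E * F)%type
    (prod_hausdorff (@lcs_hausdorff R E) (@lcs_hausdorff R F)).

Section LocallyConvex.
Context {R : realType}.
Implicit Types E F : lcsType R.

(* The library does not require the uniformity of a [Tvs] to be the one
   induced by the vector space structure, so Cauchy sequences are defined
   through neighborhoods of 0. *)
Definition sequentially_complete E :=
  forall u : nat -> E,
    (forall U, nbhs (0 : E) U ->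
       exists N, forall m n, (N <= m)%N -> (N <= n)%N -> U (u m - u n)) ->
    exists l : E, u @ \oo --> l.

Definition continuous_seminorm E (q : E -> R) :=
  [/\ forall x y, q (x + y) <= q x + q y,
      forall a x, q (a *: x) = `|a| * q x & continuous q].

Definition has_dir_deriv E F (f : E -> F) (x y : E) (l : F) :=
  t^-1 *: (f (x + t *: y) - f x) @[t --> (0 : R)^'] --> l.

(* A map on a subset [U] of [E] is a total map whose values outside [U] are
   irrelevant; [U] is open wherever [Ck] and [smooth_on] are used, and so is
   the domain in [smooth_map_on] and [diffeo_on] below. *)
Fixpoint Ck (k : nat) E F (U : set E) (f : E -> F) : Prop :=
  {within U, continuous f} /\
  if k is k'.+1 then
    exists df : E * E -> F,
      (forall x y, U x -> has_dir_deriv f x y (df (x, y))) /\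
      Ck k' (U `*` setT) df
  else True.

Definition smooth_on E F (U : set E) (f : E -> F) := forall k, Ck k U f.

Definition dir_deriv E F (f : E -> F) (x y : E) : F :=
  xget 0 [set l | has_dir_deriv f x y l].

End LocallyConvex.

(* [cinv] is the inverse of [cmap] on the image [ctarget]; the values of [cmap]
   outside [cdom] and of [cinv] outside [ctarget] are irrelevant. *)
Record pchart (M E : Type) :=
  PChart { cdom : set M; cmap :> M -> E; cinv : E -> M }.

HB.instance Definition _ (M E : Type) := gen_eqMixin (pchart M E).
HB.instance Definition _ (M E : Type) := gen_choiceMixin (pchart M E).

Definition ctarget M E (c : pchart M E) : set E := c @` cdom c.

Definition is_pchart (M E : topologicalType) (c : pchart M E) :=
  [/\ open (cdom c), open (ctarget c),
      forall x, cdom c x -> cinv c (c x) = x,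
      {within cdom c, continuous c} & {within ctarget c, continuous (cinv c)}].

HB.mixin Record isCharted (R : realType) (E : lcsType R) (M : Type)
    of Topological M := { atlas : set (pchart M E) }.

#[short(type="chartedType")]
HB.structure Definition Charted (R : realType) (E : lcsType R) :=
  {M of Topological M & isCharted R E M}.

Section Manifolds.
Context {R : realType}.

Definition compatible (E : lcsType R) (M : Type) (c d : pchart M E) :=
  smooth_on (c @` (cdom c `&` cdom d)) (d \o cinv c) /\
  smooth_on (d @` (cdom c `&` cdom d)) (c \o cinv d).

(* the maximal atlas containing [atlas], when [is_manifold M] holds *)
Definition charts (E : lcsType R) (M : chartedType E) : set (pchart M E) :=
  [set c | is_pchart c /\ forall d, atlas d -> compatible c d].

Definition is_manifold (E : lcsType R) (M : chartedType E) :=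
  [/\ hausdorff_space M,
      forall c : pchart M E, atlas c -> is_pchart c,
      forall x : M, exists2 c : pchart M E, atlas c & cdom c x &
      forall c d : pchart M E, atlas c -> atlas d -> compatible c d].

Definition smooth_map_on (E F : lcsType R) (M : chartedType E)
    (N : chartedType F) (W : set M) (f : M -> N) :=
  {within W, continuous f} /\
  forall (c : pchart M E) (d : pchart N F), charts c -> charts d ->
    smooth_on (c @` (cdom c `&` W `&` f @^-1` cdom d)) (d \o f \o cinv c).

Definition diffeo_on (E F : lcsType R) (M : chartedType E) (N : chartedType F)
    (U : set M) (V : set N) (f : M -> N) :=
  f @` U = V /\ smooth_map_on U f /\
  exists g : N -> M, smooth_map_on V g /\ forall x, U x -> g (f x) = x.

Definition prod_chart (M N E F : Type) (c : pchart M E) (d : pchart N F) :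
    pchart (M * N) (E * F) :=
  PChart (cdom c `*` cdom d) (fun x => (c x.1, d x.2))
    (fun y => (cinv c y.1, cinv d y.2)).

HB.instance Definition _ (E F : lcsType R) (M : chartedType E)
    (N : chartedType F) :=
  @isCharted.Build R (E * F)%type (M * N)%type
    [set e | exists (c : pchart M E) (d : pchart N F),
       [/\ charts c, charts d & e = prod_chart c d]].

End Manifolds.

Arguments charts {R E} M _.

Section TangentBundle.
Context {R : realType} {E : lcsType R} (M : chartedType E).

Definition chart_at (x : M) : pchart M E :=
  xget (PChart set0 (fun=> 0 : E) (fun=> x)) [set c | charts M c /\ cdom c x].

(* The tangent space at [x] is [E], a vector [v] standing for the tangent
   vector whose coordinate in the chart [chart_at x] is [v]; its coordinates
   in other charts are given by [dchart] below. *)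
Definition tangent_space (x : M) : lcsType R := E.

Record tangent_bundle := TVec { tbase : M; tvec : tangent_space tbase }.

HB.instance Definition _ := gen_eqMixin tangent_bundle.
HB.instance Definition _ := gen_choiceMixin tangent_bundle.

Definition zero_vec (x : M) : tangent_bundle := @TVec x 0.

(* the second component of the tangent map of [c] *)
Definition dchart (c : pchart M E) (v : tangent_bundle) : E :=
  let d := chart_at (tbase v) in
  dir_deriv (c \o cinv d) (d (tbase v)) (tvec v).

Definition tangent_chart (c : pchart M E) : pchart tangent_bundle (E * E) :=
  PChart [set v | cdom c (tbase v)]
    (fun v => (c (tbase v), dchart c v))
    (fun p => let x := cinv c p.1 in
       @TVec x (dir_deriv (chart_at x \o cinv c) p.1 p.2)).

(* the final topology for the parametrizations inverse to [tangent_chart c] *)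
Definition tangent_open (W : set tangent_bundle) :=
  forall c, charts M c ->
    open [set p : E * E | ctarget c p.1 /\ W (cinv (tangent_chart c) p)].

Lemma tangent_openT : tangent_open setT.
Proof.
move=> c [[_ oc _ _ _] _].
rewrite (_ : mkset _ = fst @^-1` ctarget c); last first.
  by rewrite predeqE => p; split => [[]|].
by apply: open_comp oc => p _; exact: cvg_fst.
Qed.

Lemma tangent_openI : setI_closed tangent_open.
Proof.
move=> A B oA oB c cc.
rewrite (_ : mkset _ = [set p : E * E | ctarget c p.1 /\
    A (cinv (tangent_chart c) p)] `&` [set p : E * E | ctarget c p.1 /\
    B (cinv (tangent_chart c) p)]); last first.
  by rewrite predeqE => p; split => [[? []]|[[? ?] []]].
by apply: openI; [exact: oA|exact: oB].
Qed.

Lemma tangent_open_bigcup (I : Type) (f : I -> set tangent_bundle) :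
  (forall i, tangent_open (f i)) -> tangent_open (\bigcup_i f i).
Proof.
move=> of_ c cc.
rewrite (_ : mkset _ = \bigcup_i [set p : E * E | ctarget c p.1 /\
    f i (cinv (tangent_chart c) p)]); last first.
  by apply/seteqP; split=> p [] => [? [i _ ?]|i _ [? ?]];
    [exists i|split => //; exists i].
by apply: bigcup_open => i _; exact: of_.
Qed.

HB.instance Definition _ := isOpenTopological.Build tangent_bundle
  tangent_openT tangent_openI tangent_open_bigcup.

HB.instance Definition _ := @isCharted.Build R (E * E)%type tangent_bundle
  [set tangent_chart c | c in charts M].

End TangentBundle.

Arguments TVec {R E M} tbase tvec.
Arguments dchart {R E M} c v.

Definition tangent_map (R : realType) (E F : lcsType R) (M : chartedType E)
    (N : chartedType F) (f : M -> N) (v : tangent_bundle M) :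
    tangent_bundle N :=
  let x := tbase v in
  TVec (f x) (dir_deriv (chart_at (f x) \o f \o cinv (chart_at x))
                (chart_at x x) (tvec v)).

Record local_addition (R : realType) (E : lcsType R) (N : chartedType E) := {
  la_dom : set (tangent_bundle N);
  la_map :> tangent_bundle N -> N;
  la_open : open la_dom;
  la_dom_zero : forall x, la_dom (zero_vec x);
  la_map_zero : forall x, la_map (zero_vec x) = x;
  la_img := [set (tbase v, la_map v) | v in la_dom];
  la_img_open : open la_img;
  la_diffeo : diffeo_on la_dom la_img (fun v => (tbase v, la_map v)) }.

(* [Linfrc] stands for the functor L^oo_rc. *)
Inductive Lkind (R : realType) :=
  Lp (p : R) of 1 <= p | Linfrc.
Arguments Linfrc {R}.

Notation leb := completed_lebesgue_measure.

(* A map on [[a, b]] is a total map on [R] whose values outside [[a, b]] are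
   irrelevant. *)
Section LebesgueSpaces.
Context {R : realType}.
Implicit Types (E : lcsType R) (a b : R) (k : Lkind R).

Definition lusin_measurable E a b (f : R -> E) :=
  forall K : set R, compact K -> K `<=` `[a, b] ->
    exists Kn : nat -> set R,
      [/\ forall n, compact (Kn n) /\ Kn n `<=` K,
          forall n, {within Kn n, continuous f} &
          leb (K `\` \bigcup_n Kn n) = 0%E].

Definition metrizable_set (T : topologicalType) (K : set T) :=
  exists d : T -> T -> R,
    [/\ forall x y, K x -> K y -> d x y = 0 <-> x = y,
        forall x y, K x -> K y -> d x y = d y x,
        forall x y z, K x -> K y -> K z -> d x z <= d x y + d y z &
        forall x (A : set T), K x ->
          (within K (nbhs x) A <->
           exists2 e : R, 0 < e & forall y, K y -> d x y < e -> A y)].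

Definition Lfunctions k a b E (f : R -> E) : Prop :=
  match k with
  | Lp p _ =>
      lusin_measurable a b f /\
      forall q : E -> R, continuous_seminorm q ->
        leb.-integrable `[a, b] (fun t => (q (f t) `^ p)%:E)
  | Linfrc =>
      [/\ forall B : set E, <<s open>> B ->
            @measurable _ (measurableTypeR R) (`[a, b] `&` f @^-1` B),
          compact (closure (f @` `[a, b])) &
          metrizable_set (closure (f @` `[a, b]))]
  end.

Definition Lexponent k : \bar R :=
  match k with Lp p _ => p%:E | Linfrc => +oo%E end.

Definition Lseminorm k a b E (q : E -> R) (f : R -> E) : \bar R :=
  Lnorm leb (Lexponent k) ((fun t => (q (f t))%:E) \_ `[a, b]).

Lemma Lfunctions0 k a b E : Lfunctions k a b (fun=> 0 : E).
Proof.
case: k => [p p1|] /=; first split.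
- move=> K cK _; exists (fun=> K); split=> [n|n|]; first by split.
  + by apply: continuous_subspaceT => x; exact: cvg_cst.
  + rewrite (_ : _ `\` _ = set0) ?measure0//.
    by rewrite -subset0 => x [Kx]; apply; exists 0%N.
- move=> q [_ qZ _].
  have -> : (fun=> (q (0 : E) `^ p)%:E) = (cst 0%E : R -> \bar R).
    apply/funext => t; have := qZ 0 0; rewrite scale0r normr0 mul0r => ->.
    by rewrite powR0// gt_eqF// (lt_le_trans ltr01 p1).
  exact: integrable0.
have img0 : closure ((fun=> 0 : E) @` (`[a, b]%classic : set R)) `<=` [set 0].
  have c0 : closed [set (0 : E)].
    exact/accessible_closed_set1/hausdorff_accessible/lcs_hausdorff.
  rewrite [X in _ `<=` X](closure_id _).1//.
  by apply: closure_subset => _ [? _ <-].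
split.
- move=> B _; rewrite preimage_cst; case: ifPn => _.
    by rewrite setIT; exact: measurable_itv.
  by rewrite setI0.
- by have [->|->] := subset_set1 img0; [exact: compact0|exact: compact_set1].
- exists (fun _ _ => 0); split=> //.
  + by move=> x y /img0 -> /img0 ->.
  + move=> x A Kx; have x0 := img0 _ Kx; split=> [wA|[e e0 eA]].
    * exists 1 => // y Ky _; rewrite (img0 _ Ky) -x0.
      exact: (@nbhs_singleton E _ _ wA).
    * by apply: (@nearW E) => y Ky; exact: eA.
Qed.

End LebesgueSpaces.

Section LebesgueQuotient.
Context {R : realType} (k : Lkind R) (a b : R) (E : lcsType R).

Record Lfunction := MkLfunction {
  Lfunction_fun :> R -> E;
  LfunctionP : Lfunctions k a b Lfunction_fun }.

HB.instance Definition _ := gen_eqMixin Lfunction.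
HB.instance Definition _ := gen_choiceMixin Lfunction.

Definition ae_eq_itv (f g : Lfunction) : bool :=
  `[< f = g %[ae leb in `[a, b]%classic] >].

Lemma ae_eq_itv_refl : reflexive ae_eq_itv.
Proof. by move=> f; exact/asboolP/ae_eq_refl. Qed.

Lemma ae_eq_itv_sym : symmetric ae_eq_itv.
Proof.
by move=> f g; apply/idP/idP => /asboolP h; apply/asboolP/ae_eq_sym.
Qed.

Lemma ae_eq_itv_trans : transitive ae_eq_itv.
Proof.
by move=> g f h /asboolP fg /asboolP gh; apply/asboolP/(ae_eq_trans fg gh).
Qed.

Canonical ae_eq_itv_equiv :=
  EquivRel ae_eq_itv ae_eq_itv_refl ae_eq_itv_sym ae_eq_itv_trans.

Local Open Scope quotient_scope.

Definition vLspace : Type := {eq_quot ae_eq_itv}.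
HB.instance Definition _ := Choice.on vLspace.
HB.instance Definition _ := EqQuotient.on vLspace.

Definition Lrepr (f : vLspace) : Lfunction := repr f.
Coercion Lrepr : vLspace >-> Lfunction.

Definition vLspace0 : vLspace :=
  \pi_vLspace (MkLfunction (Lfunctions0 k a b E)).

Definition vLspace_open (W : set vLspace) :=
  forall f, W f -> exists n (q : 'I_n -> E -> R) (e : R),
    [/\ forall i, continuous_seminorm (q i), 0 < e &
        forall g : vLspace,
          (forall i, (Lseminorm k a b (q i) (fun t => (g t - f t)%R) < e%:E)%E) ->
          W g].

Lemma vLspace_openT : vLspace_open setT.
Proof.
by move=> f _; exists 0%N, (fun=> fun=> 0), 1; split=> // -[].
Qed.

Lemma vLspace_openI : setI_closed vLspace_open.
Proof.
move=> A B oA oB f [/oA[m [q [e [qs e0 qA]]]] /oB[n [r [d [rs d0 rB]]]]].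
exists (m + n)%N, (fun i => match fintype.split i with inl j => q j | inr j => r j end).
exists (Num.min e d); split=> [i||g gqr].
- by case: fintype.splitP => j _.
- by rewrite lt_min e0.
- split; [apply: qA => i|apply: rB => i].
  + have := gqr (lshift n i); rewrite (unsplitK (inl i)) => /lt_le_trans; apply.
    by rewrite lee_fin ge_min lexx.
  + have := gqr (rshift m i); rewrite (unsplitK (inr i)) => /lt_le_trans; apply.
    by rewrite lee_fin ge_min lexx orbT.
Qed.

Lemma vLspace_open_bigcup (I : Type) (f : I -> set vLspace) :
  (forall i, vLspace_open (f i)) -> vLspace_open (\bigcup_i f i).
Proof.
move=> of_ g [i _ /of_[n [q [e [qs e0 qf]]]]].
by exists n, q, e; split=> // h /qf; exists i.
Qed.

HB.instance Definition _ := isOpenTopological.Build vLspace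
  vLspace_openT vLspace_openI vLspace_open_bigcup.

End LebesgueQuotient.

Section Integrals.
Context {R : realType}.
Implicit Types (E : lcsType R) (a b : R) (k : Lkind R).

Definition is_weak_integral E a b (f : R -> E) (v : E) :=
  forall l : {linear E -> R^o}, continuous (l : E -> R) ->
    leb.-integrable `[a, b] (fun t => (l (f t) : R)%:E) /\
    (l v : R)%:E = (\int[leb]_(t in `[a, b]) (l (f t) : R)%:E)%E.

Definition integral_complete E :=
  forall f : R -> E, {within `[0, 1], continuous f} ->
    exists v, is_weak_integral 0 1 f v.

Definition is_primitive k a b E (h : R -> E) (f : vLspace k a b E) :=
  forall t, t \in `[a, b] -> exists2 v, is_weak_integral a t f v & h t = h a + v.

Definition AC_vec k a b E (h : R -> E) :=
  exists f : vLspace k a b E, is_primitive h f.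

Definition AC_deriv k a b E (h : R -> E) : vLspace k a b E :=
  xget (vLspace0 k a b E) [set f | is_primitive h f].

(* The topology of AC([a, b], E) is the initial topology of this map. *)
Definition AC_coord k a b E (h : R -> E) : E * vLspace k a b E :=
  (h a, AC_deriv k a b h).

End Integrals.

Section ACManifold.
Context {R : realType}.

(* [n] intervals [[ac_pt i, ac_pt i.+1]] and a chart for each of them *)
Record AC_data (E : lcsType R) (N : chartedType E) := ACData {
  ac_size : nat; ac_pt : nat -> R; ac_chart : nat -> pchart N E }.

Definition adapted (k : Lkind R) (a b : R) (E : lcsType R)
    (N : chartedType E) (h : R -> N) (D : AC_data N) :=
  [/\ ac_pt D 0 = a, ac_pt D (ac_size D) = b &
      forall i, (i < ac_size D)%N ->
        [/\ ac_pt D i < ac_pt D i.+1, charts N (ac_chart D i),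
            h @` `[ac_pt D i, ac_pt D i.+1] `<=` cdom (ac_chart D i) &
            AC_vec k (ac_pt D i) (ac_pt D i.+1) (ac_chart D i \o h)]].

Definition clamp (a b t : R) : R := Num.max a (Num.min b t).

(* A map on [[a, b]] is represented by its extension to [R] that is constant
   on both sides of [[a, b]], so equality is equality on [[a, b]]. *)
Record ACmap (k : Lkind R) (a b : R) (E : lcsType R) (N : chartedType E) :=
  MkACmap {
    AC_fun :> R -> N;
    AC_continuous : {within `[a, b], continuous AC_fun};
    AC_adapted : exists D, adapted k a b AC_fun D;
    AC_clamp : forall t, AC_fun (clamp a b t) = AC_fun t }.

HB.instance Definition _ k a b (E : lcsType R) (N : chartedType E) :=
  gen_eqMixin (ACmap k a b N).
HB.instance Definition _ k a b (E : lcsType R) (N : chartedType E) :=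
  gen_choiceMixin (ACmap k a b N).

Section Fixed.
Context (k : Lkind R) (a b : R) (E : lcsType R) (N : chartedType E).

(* the sections of the tangent bundle along [h] *)
Record Gamma (h : ACmap k a b N) := MkGamma {
  Gamma_map :> ACmap k a b (tangent_bundle N);
  Gamma_over : forall t, t \in `[a, b] -> tbase (Gamma_map t) = h t }.

HB.instance Definition _ h := gen_eqMixin (Gamma h).
HB.instance Definition _ h := gen_choiceMixin (Gamma h).

Definition AC_choice (h : ACmap k a b N) : AC_data N :=
  projT1 (cid (AC_adapted h)).

Definition Gamma_coord (h : ACmap k a b N) (s : Gamma h) :
    prod_topology (fun i : 'I_(ac_size (AC_choice h)) =>
      (E * vLspace k (ac_pt (AC_choice h) i) (ac_pt (AC_choice h) i.+1) E)%type)
  := fun i => AC_coord k (ac_pt (AC_choice h) i) (ac_pt (AC_choice h) i.+1)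
                (dchart (ac_chart (AC_choice h) i) \o s).

HB.instance Definition _ h :=
  Topological.copy (Gamma h) (initial_topology (@Gamma_coord h)).

(* The manifold AC([a, b], N), whose charts are the inverses of the maps
   [s |-> la_map S \o s], each defined on the set of those [s] in [Gamma h]
   with values in [la_dom S].  The topology underlying the manifold structure
   is hence the final one for these maps: [W] is open iff its preimage under
   each of them is relatively open in the domain. *)
Definition ACmfd (S : local_addition N) : Type := ACmap k a b N.

Definition ACmfd_open S (W : set (ACmfd S)) :=
  forall h : ACmap k a b N, exists2 O : set (Gamma h), open O &
    forall (s : Gamma h) (g : ACmap k a b N),
      (forall t, t \in `[a, b] -> la_dom S (s t) /\ g t = S (s t)) ->
      W g <-> O s.

Lemma ACmfd_openT S : ACmfd_open (setT : set (ACmfd S)).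
Proof. by move=> h; exists setT => //; exact: openT. Qed.

Lemma ACmfd_openI S : setI_closed (@ACmfd_open S).
Proof.
move=> A B oA oB h; have [P oP PA] := oA h; have [Q oQ QB] := oB h.
exists (P `&` Q); first exact: openI.
by move=> s g sg; split=> -[/(PA _ _ sg) ? /(QB _ _ sg) ?].
Qed.

Lemma ACmfd_open_bigcup S (I : Type) (f : I -> set (ACmfd S)) :
  (forall i, ACmfd_open (f i)) -> ACmfd_open (\bigcup_i f i).
Proof.
move=> of_ h.
have /choice [P PP] : forall i, exists O : set (Gamma h), open O /\
    forall (s : Gamma h) (g : ACmap k a b N),
      (forall t, t \in `[a, b] -> la_dom S (s t) /\ g t = S (s t)) ->
      f i g <-> O s.
  by move=> i; have [P oP Pf] := of_ i h; exists P.
exists (\bigcup_i P i); first by apply: bigcup_open => i _; exact: (PP i).1.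
by move=> s g sg; split=> -[i _ /((PP i).2 _ _ sg) ?]; exists i.
Qed.

HB.instance Definition _ S := Choice.on (ACmfd S).
HB.instance Definition _ S := isOpenTopological.Build (ACmfd S)
  (@ACmfd_openT S) (@ACmfd_openI S) (@ACmfd_open_bigcup S).

End Fixed.

End ACManifold.

#[short(type="chartedGroupType")]
HB.structure Definition ChartedGroup (R : realType) (E : lcsType R) :=
  {G of Charted R E G & Group G}.

Section HalfLie.
Context {R : realType} {E : lcsType R} (G : chartedGroupType E).

Definition right_half_lie :=
  [/\ is_manifold G,
      continuous (fun x : G * G => (x.1 * x.2)%g),
      continuous (fun x : G => (x^-1)%g) &
      forall g : G, smooth_map_on setT (fun x : G => (x * g)%g)].

Definition lie_alg : lcsType R := @tangent_space R E G (1%g : G).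

(* [v.g]; its base point [1 * g] is [g] *)
Definition raction (v : lie_alg) (g : G) : tangent_bundle G :=
  tangent_map (fun x : G => (x * g)%g) (TVec (1%g : G) v).

Variable k : Lkind R.

Definition is_solution_on (f : vLspace k 0 1 lie_alg) (I : set R)
    (y : R -> G) :=
  {within I, continuous y} /\
  forall (al be : R) (c : pchart G E), al < be -> `[al, be] `<=` I ->
    charts G c -> y @` `[al, be] `<=` cdom c ->
    let F s := dchart c (raction (f s) (y s)) in
    Lfunctions (Lp (lexx 1)) al be F /\
    forall t, t \in `[al, be] ->
      exists2 v, is_weak_integral al t F v & c (y t) = c (y al) + v.

Definition nondegenerate_subitv (I : set R) :=
  [/\ is_interval I, I `<=` `[0, 1] & exists s t, [/\ I s, I t & s < t]].

Definition local_uniqueness (f : vLspace k 0 1 lie_alg) :=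
  forall (I1 I2 : set R) (y1 y2 : R -> G) (t0 : R),
    nondegenerate_subitv I1 -> nondegenerate_subitv I2 ->
    is_solution_on f I1 y1 -> is_solution_on f I2 y2 ->
    I1 t0 -> I2 t0 -> y1 t0 = y2 t0 ->
    \forall t \near t0, I1 t -> I2 t -> y1 t = y2 t.

Definition semiregular :=
  forall f : vLspace k 0 1 lie_alg, local_uniqueness f /\
    exists y : ACmap k 0 1 G, is_solution_on f `[0, 1] y /\ y 0 = 1%g.

(* By local uniqueness, the solution picked here is the only one. *)
Definition Evol (sr : semiregular) (S : local_addition G)
    (f : vLspace k 0 1 lie_alg) : ACmfd k 0 1 S :=
  projT1 (cid (sr f).2).

(* C([0, 1], G) is a subspace of the space of all maps from [0, 1] to [G],
   with the compact-open topology. *)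
Definition EvolC (sr : semiregular) (f : vLspace k 0 1 lie_alg) :
    {compact-open, set_type (`[0, 1]%classic : set R) -> G} :=
  fun t => projT1 (cid (sr f).2) (set_val t).

End HalfLie.

(* Main.v *)
Require Import Defs.
From HB Require Import structures.
From mathcomp Require Import all_boot all_order all_algebra.
From mathcomp Require Import all_classical all_reals all_analysis.
From mathcomp Require Import measurable_realfun ess_sup_inf.
From mathcomp Require Import ring lra.
Import numFieldNormedType.Exports.
Import Order.TTheory GRing.Theory Num.Theory.

Set Implicit Arguments.
Unset Strict Implicit.
Unset Printing Implicit Defensive.

Local Open Scope classical_set_scope.
Local Open Scope ring_scope.

(** The idea of the proof.

    Fix a control [f0], its solution [h = Evol f0], and the charts [phi] used to
    describe sections along [h] on the intervals of a partition of [0, 1].  A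
    curve near [h] is represented in the manifold AC([0, 1], G) by a section of
    TG along [h], its image under the inverse of (pi, Sigma).  So the sections
    representing [Evol f] have to converge to the one representing [h].  On one
    interval of the partition, the coordinate of such a section is
    [Phi (x0, x_f)], where [Phi] is smooth, [x0 = phi \o h] and
    [x_f = phi \o Evol f].

    Let [H (x, v)] be the coordinate of [v.g] at the point [g] with coordinate
    [x].  It is continuous since tau is, and linear in [v] since right
    translations are smooth.  The differential equation says that [x_f] is a
    primitive of [H (x_f, f)].  By a chain rule for primitives
    ([chain_rule_weak_integral]), the coordinate [Phi (x0, x_f)] is a primitive
    of [B_f (f0, f)], where the operators

      [B_f t (v, w) = dPhi ((x0 t, x_f t), (H (x0 t, v), H (x_f t, w)))]

    are linear in [(v, w)].  Continuity of Evol_C makes [Evol f t] jointly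
    continuous in [(t, f)] ([evol_jointly_continuous]), whence [B_f t (v, w)] is
    continuous in [(t, f, v, w)] at [f = f0].  Densities being unique almost
    everywhere ([density_unique]), it remains to estimate

      [B_f (f0, f) - B_f0 (f0, f0) = B_f (0, f - f0) + (B_f - B_f0) (f0, f0)]

    in the Lebesgue space ([superposition_cvg]).  By compactness of the time
    interval, every continuous seminorm [q] has a continuous seminorm [Q] with
    [q (B_f t (v, w)) <= Q (v, w)] for all [t] and all [f] near [f0]
    ([uniform_seminorm_bound]); this settles the first term.  For the second
    one, [B_f] tends to [B_f0] uniformly on compact sets ([uniform_small]), and
    [(f0, f0)] takes values in a compact set except on a set of times over which
    the integral of the dominating function [Q] is small ([Lreal_small]).
    For L^oo_rc the whole range is relatively compact.

    The same two estimates prove the chain rule: applied to the differential of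
    [Phi], they compare its values at the points of a short segment from [h s] to
    [h t] with those at [h r] for [r] between [s] and [t].

    Both kinds of Lebesgue functions are handled through the notion of a piece,
    a measurable set on which the function is measurable with values in a
    countably based compact set.  This gives the stability of the spaces under
    pairs and superpositions, and the uniqueness of densities: countably many
    functionals suffice on each piece. *)

(** * Limits, seminorms and the Hahn-Banach theorem *)

Lemma cvg_near_eq (T : Type) (S : topologicalType) (F : set_system T)
    (f g : T -> S) (a : S) : Filter F ->
  (\forall t \near F, f t = g t) -> f @ F --> a -> g @ F --> a.
Proof.
by move=> FF fg fa A /fa Af; apply: filterS2 fg Af => t /= ->.
Qed.

Section TvsLimits.
Context {R : realType} {E : tvsType R} {T : Type} {F : set_system T}.
Context {FF : Filter F}.

Lemma tvs_cvgD (f g : T -> E) (a b : E) :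
  f @ F --> a -> g @ F --> b -> (fun t => f t + g t) @ F --> a + b.
Proof.
move=> fa gb.
apply: (@cvg_comp _ _ _ (fun t => (f t, g t)) (fun p : E * E => p.1 + p.2) _
  (nbhs (a, b))); first exact: cvg_pair.
exact: (@tvs.add_continuous E (a, b)).
Qed.

Lemma tvs_cvgB (f g : T -> E) (a b : E) :
  f @ F --> a -> g @ F --> b -> (fun t => f t - g t) @ F --> a - b.
Proof.
move=> fa gb.
apply: (@cvg_comp _ _ _ (fun t => (f t, g t)) (fun p : E * E => p.1 - p.2) _
  (nbhs (a, b))); first exact: cvg_pair.
exact: (@tvs.sub_continuous E (a, b)).
Qed.

Lemma tvs_cvgZ (f : T -> R) (g : T -> E) (a : R) (b : E) :
  f @ F --> a -> g @ F --> b -> (fun t => f t *: g t) @ F --> a *: b.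
Proof.
move=> fa gb.
apply: (@cvg_comp _ _ _ (fun t => (f t : R^o, g t))
  (fun p : R^o * E => p.1 *: p.2) _ (nbhs ((a : R^o), b))).
  exact: (@cvg_pair _ _ _ _ (nbhs (a : R^o))).
exact: (@tvs.scale_continuous R E (a : R^o, b)).
Qed.

End TvsLimits.

Section Seminorms.
Context {R : realType} {E : lcsType R}.
Implicit Types (q : E -> R) (x y z : E).

Lemma seminorm0 q : continuous_seminorm q -> q 0 = 0.
Proof. by case=> _ qZ _; have := qZ 0 0; rewrite scale0r normr0 mul0r. Qed.

Lemma seminormN q x : continuous_seminorm q -> q (- x) = q x.
Proof. by case=> _ qZ _; rewrite -scaleN1r qZ normrN1 mul1r. Qed.

Lemma seminorm_ge0 q x : continuous_seminorm q -> 0 <= q x.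
Proof.
move=> qs; have [qD _ _] := qs.
have := qD x (- x); rewrite subrr seminorm0// seminormN// -mulr2n.
by rewrite pmulrn_lge0.
Qed.

Lemma seminorm_lt_nbhs q x e : continuous_seminorm q -> 0 < e ->
  \forall y \near x, q (y - x) < e.
Proof.
move=> qs e0; have [_ _ qc] := qs.
have : (q \o (fun y => y - x)) @ x --> (q 0 : R).
  apply: (@cvg_comp _ _ _ (fun y => y - x) q _ (nbhs (0 : E))); last exact: qc.
  by rewrite -(subrr x); apply: tvs_cvgB; [exact: cvg_id|exact: cvg_cst].
by rewrite seminorm0// => /cvgr_lt /(_ _ e0).
Qed.

(** The gauge of a symmetric convex neighbourhood. *)
Lemma nbhs0_seminorm (U : set E) : nbhs (0 : E) U ->
  exists2 q, continuous_seminorm q & forall x, q x < 1 -> U x.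
Proof.
move=> U0.
have [B0 convB0 [openB0 basisB0]] := @locally_convex R E.
have [/= V [B0V V0 VU]] := basisB0 _ _ U0.
have nV : nbhs (0 : E) V by apply: open_nbhs_nbhs; split => //; exact: openB0.
have cV x y t : V x -> V y -> 0 <= t -> t <= 1 -> V (t *: x + (1 - t) *: y).
  move=> Vx Vy t0 t1.
  have := convB0 V (mem_set B0V) x y (Itv01 t0 t1) (mem_set Vx) (mem_set Vy).
  by move=> /set_mem.
pose B : set E := V `&` [set x | V (- x)].
have nB : nbhs (0 : E) B.
  apply: filterI => //.
  have h : (fun x : E => 0 - x) @ (0 : E) --> (0 - 0 : E).
    by apply: tvs_cvgB; [exact: cvg_cst|exact: cvg_id].
  rewrite subrr in h; have : \forall x \near (0 : E), V (0 - x) by exact: h.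
  by apply: filterS => x; rewrite sub0r.
have B00 : B 0 by exact: nbhs_singleton.
have BN x : B x -> B (- x) by move=> [? ?]; split => //=; rewrite opprK.
have cB x y t : B x -> B y -> 0 <= t -> t <= 1 -> B (t *: x + (1 - t) *: y).
  move=> [Vx Vx'] [Vy Vy'] t0 t1; split; first exact: cV.
  by rewrite /= opprD -!scalerN; exact: cV.
have Bs x t : B x -> 0 <= t -> t <= 1 -> B (t *: x).
  by move=> Bx t0 t1; have := cB x 0 t Bx B00 t0 t1; rewrite scaler0 addr0.
pose A x := [set t : R | 0 < t /\ B (t^-1 *: x)].
have Aup x s t : A x s -> s <= t -> A x t.
  move=> [s0 Bs'] st; have t0 := lt_le_trans s0 st; split => //.
  have -> : t^-1 *: x = (s / t) *: (s^-1 *: x).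
    by rewrite scalerA mulrAC divff ?gt_eqF// mul1r.
  apply: Bs => //; first by rewrite divr_ge0 ?ltW.
  by rewrite ler_pdivrMr// mul1r.
have A0 x : A x !=set0.
  have : (fun t : R => t *: x) @ (0 : R) --> (0 : E).
    by rewrite -(scale0r x); apply: tvs_cvgZ; [exact: cvg_id|exact: cvg_cst].
  move=> /(_ _ nB) /= /nbhs_ballP[e e0 eB].
  have /= := eB (e / 2); rewrite /ball/= sub0r normrN gtr0_norm ?divr_gt0//.
  move=> /(_ _)/wrap[]; first by move: (e0 : 0 < e); lra.
  move=> Be; exists (e / 2)^-1; split; last by rewrite invrK.
  by rewrite invr_gt0 divr_gt0.
have Albd x : has_lbound (A x) by exists 0 => t [/ltW].
have Ainf x : has_inf (A x) by split.
pose q x := inf (A x).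
have q0 x : 0 <= q x by apply: lb_le_inf => // t [/ltW].
have qlt x t : q x < t -> A x t.
  move=> qt; have e0 : 0 < t - q x by rewrite subr_gt0.
  have [s As] := inf_adherent e0 (Ainf x).
  by rewrite addrC subrK => /ltW; exact: Aup.
have qle x t : A x t -> q x <= t by move=> At; exact: ge_inf.
have qD x y : q (x + y) <= q x + q y.
  apply/ler_addgt0Pr => e e0.
  have e2 : 0 < e / 2 by rewrite divr_gt0.
  have [s0 Bsx] : A x (q x + e / 2) by apply: qlt; rewrite ltrDl.
  have [t0 Bty] : A y (q y + e / 2) by apply: qlt; rewrite ltrDl.
  set s := q x + e / 2 in s0 Bsx; set t := q y + e / 2 in t0 Bty.
  have -> : q x + q y + e = s + t by rewrite /s /t; lra.
  have st0 : 0 < s + t by rewrite addr_gt0.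
  apply: qle; split => //.
  have -> : (s + t)^-1 *: (x + y) =
      (s / (s + t)) *: (s^-1 *: x) + (1 - s / (s + t)) *: (t^-1 *: y).
    rewrite !scalerA scalerDr; congr (_ *: _ + _ *: _).
      by field; rewrite ?gt_eqF.
    by field; rewrite ?gt_eqF.
  apply: cB => //; first by rewrite divr_ge0 ?ltW.
  by rewrite ler_pdivrMr// mul1r lerDl ltW.
have qN x : q (- x) = q x.
  by congr inf; apply/seteqP; split=> t [t0] /BN; rewrite -scalerN ?opprK.
have qZ' a x : 0 < a -> q (a *: x) <= a * q x.
  move=> a0; apply/ler_addgt0Pr => e e0.
  have : A x (q x + e / a) by apply: qlt; rewrite ltrDl divr_gt0.
  move=> [s0 Bsx].
  have -> : a * q x + e = a * (q x + e / a) by field; rewrite gt_eqF.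
  apply: qle; split; first exact: mulr_gt0.
  by rewrite scalerA invfM mulrAC mulVf ?gt_eqF// mul1r.
have qZ a x : q (a *: x) = `|a| * q x.
  have pos b y : 0 < b -> q (b *: y) = b * q y.
    move=> b0; apply/eqP; rewrite eq_le qZ'//=.
    have := qZ' b^-1 (b *: y); rewrite invr_gt0 => /(_ b0).
    by rewrite scalerA mulVf ?gt_eqF// scale1r ler_pdivlMl.
  have [a0|a0|->] := ltrgtP a 0; last 1 first.
  - rewrite scale0r normr0 mul0r; apply/eqP; rewrite eq_le q0 andbT.
    apply/ler_addgt0Pr => e e0; rewrite add0r; apply: qle; split => //.
    by rewrite scaler0.
  - by rewrite -qN -scaleNr pos ?oppr_gt0// ltr0_norm.
  - by rewrite pos// gtr0_norm.
exists q; last first.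
  move=> x /qlt[_]; rewrite invr1 scale1r => -[Vx _].
  exact: VU.
split=> // x; apply/cvgrPdist_le => e e0.
have : \forall y \near x, B (e^-1 *: (y - x)).
  have : (fun y => e^-1 *: (y - x)) @ x --> (0 : E).
    have -> : (0 : E) = e^-1 *: (x - x) by rewrite subrr scaler0.
    apply: tvs_cvgZ; first exact: cvg_cst.
    by apply: tvs_cvgB; [exact: cvg_id|exact: cvg_cst].
  by move=> /(_ _ nB).
apply: filterS => y Bxy.
have qxy : q (y - x) <= e by apply: qle.
have h1 := qD (y - x) x; rewrite subrK in h1.
have h2 := qD (x - y) y; rewrite subrK -[x - y]opprB qN in h2.
by rewrite ler_norml; apply/andP; split; lra.
Qed.

Lemma seminorm_separated x : x != 0 ->
  exists2 q, continuous_seminorm q & 0 < q x.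
Proof.
move=> /eqP x0.
have [|q qs qx] := @nbhs0_seminorm (~` [set x]).
  apply: open_nbhs_nbhs; split; last by move=> /= /esym.
  apply: closed_openC.
  exact/accessible_closed_set1/hausdorff_accessible/lcs_hausdorff.
exists q => //; rewrite ltNge; apply/negP => qx0.
by apply: (qx x) => //; rewrite (le_lt_trans qx0).
Qed.

(** Hahn-Banach: linear graphs dominated by [q] are extended by Zorn. *)
Lemma hahn_banach q z : continuous_seminorm q ->
  exists l : {linear E -> R^o},
    [/\ forall x, (l x : R) <= q x, (l z : R) = q z & continuous (l : E -> R)].
Proof.
move=> qs; have [qD qZ qc] := qs.
(* The members of [P] are graphs of partial functionals with value [q z] at
   [z]; the empty set is allowed for the sake of the empty chain. *)
pose lin (A : set (E * R)) := forall c x r y s, A (x, r) -> A (y, s) ->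
  A (c *: x + y, c * r + s).
pose P (A : set (E * R)) := [/\ (A = set0 \/ A (z, q z)), lin A &
  forall x r, A (x, r) -> r <= q x].
have base : P [set p | exists c : R, p = (c *: z, c * q z)].
  split; first by right; exists 1; rewrite scale1r mul1r.
    move=> c _ _ _ _ [d [-> ->]] [e [-> ->]]; exists (c * d + e).
    by rewrite !scalerDl !scalerA mulrDl mulrA.
  move=> _ _ [c [-> ->]]; rewrite qZ ler_wpM2r ?ler_norm//.
  exact: seminorm_ge0.
have [|A [[A0 linA leA] maxA]] := @Zorn_bigcup _ P.
  move=> F FP totF; split.
  - have [[X [FX Xz]]|nF] := pselect (exists X, F X /\ X (z, q z)).
      by right; exists X.
    left; rewrite -subset0 => p [X FX Xp]; apply: nF; exists X.
    by have [[X0|Xz] _ _] := FP _ FX; split=> //; move: Xp; rewrite X0.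
  - move=> c x r y s [X FX Xx] [Y FY Yy].
    have [_ lX _] := FP _ FX; have [_ lY _] := FP _ FY.
    have [XY|YX] := totF _ _ FX FY; [exists Y => //|exists X => //].
      by apply: lY => //; exact: XY.
    by apply: lX => //; exact: YX.
  - by move=> x r [X FX]; have [_ _] := FP _ FX; exact.
have Az : A (z, q z).
  have [A00|//] := A0; exfalso; apply: (maxA _ _ base).
  split; first by rewrite A00.
  by rewrite A00 => /(_ (z, q z))[]; exists 1; rewrite scale1r mul1r.
have A00 : A (0, 0).
  have := linA (-1) _ _ _ _ Az Az.
  by rewrite scaleN1r mulN1r addNr addNr.
have funA x r s : A (x, r) -> A (x, s) -> r = s.
  have le0 u : A (0, u) -> u <= 0 by move=> /leA; rewrite seminorm0.
  move=> xr xs.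
  have h1 := le0 (-1 * r + s); have h2 := le0 (-1 * s + r).
  have := linA (-1) _ _ _ _ xr xs; rewrite scaleN1r addNr => /h1.
  have := linA (-1) _ _ _ _ xs xr; rewrite scaleN1r addNr => /h2.
  by lra.
have totA y : exists r, A (y, r).
  apply: contrapT => /forallNP nAy.
  (* [sup S] is the least value at [y] compatible with the bound by [q]. *)
  pose S := [set s | exists x r, A (x, r) /\ s = r - q (x - y)].
  have Sub x' r' : A (x', r') -> ubound S (q (x' + y) - r').
    move=> A' _ [x [r [Axr ->]]].
    have := linA 1 _ _ _ _ Axr A'; rewrite scale1r mul1r => /leA.
    have := qD (x - y) (x' + y); rewrite addrACA addNr addr0.
    by lra.
  have hS : has_sup S.
    split; first by exists (0 - q (0 - y)), 0, 0.
    by exists (q (0 + y) - 0); exact: Sub.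
  pose a := sup S.
  have ale x r : A (x, r) -> r + a <= q (x + y).
    by move=> Axr; have := ge_sup hS.1 (Sub _ _ Axr); rewrite -/a; lra.
  have age x r : A (x, r) -> r - a <= q (x - y).
    move=> Axr; have : S (r - q (x - y)) by exists x, r.
    by move/(ub_le_sup hS.2); rewrite -/a; lra.
  pose A' := [set p | exists x r c, A (x, r) /\ p = (x + c *: y, r + c * a)].
  apply: (maxA A').
    split=> [[x r] Axr|]; first by exists x, r, 0; rewrite scale0r mul0r !addr0.
    move=> /(_ (y, a)) A'A; apply: (nAy a); apply: A'A.
    by exists 0, 0, 1; rewrite scale1r mul1r !add0r.
  split.
  - by right; exists z, (q z), 0; rewrite scale0r mul0r !addr0.
  - move=> c _ _ _ _ [x [r [d [Ax [-> ->]]]]] [x' [r' [d' [Ax' [-> ->]]]]].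
    exists (c *: x + x'), (c * r + r'), (c * d + d'); split; first exact: linA.
    by rewrite !scalerDr !scalerDl !scalerA addrACA; congr pair; ring.
  - move=> _ _ [x [r [c [Axr [-> ->]]]]].
    have Asc d : A (d *: x, d * r).
      by have := linA d _ _ _ _ Axr A00; rewrite !addr0.
    have [c0|c0|->] := ltrgtP c 0; last 1 first.
    + by rewrite scale0r mul0r !addr0; exact: leA.
    + have c0' : 0 < - c by rewrite oppr_gt0.
      have h := age _ _ (Asc (- c)^-1); rewrite -(ler_pM2l c0') in h.
      have -> : q (x + c *: y) = - c * q ((- c)^-1 *: x - y).
        rewrite -[X in X * _](gtr0_norm c0') -qZ scalerBr scalerA.
        by rewrite mulfV ?gt_eqF// scale1r scaleNr opprK.
      move: h; rewrite mulrBr mulrA mulfV ?gt_eqF// mul1r; lra.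
    + have h := ale _ _ (Asc c^-1); rewrite -(ler_pM2l c0) in h.
      have -> : q (x + c *: y) = c * q (c^-1 *: x + y).
        rewrite -[X in X * _](gtr0_norm c0) -qZ scalerDr scalerA.
        by rewrite mulfV ?gt_eqF// scale1r.
      by move: h; rewrite mulrDr mulrA mulfV ?gt_eqF// mul1r.
have [f Af] := choice totA.
have linf : linear (f : E -> R^o).
  move=> c x y; apply: (funA (c *: x + y)) => //.
  exact: linA.
pose isL := GRing.isLinear.Build R E R^o *:%R f linf.
pose l : {linear E -> R^o} := HB.pack f isL.
exists l.
have lle x : (l x : R) <= q x by apply: leA; exact: Af.
split => //; first exact: (funA z).
move=> x; apply/cvgrPdist_lt => e e0.
have := @seminorm_lt_nbhs q x e qs e0; apply: filterS => y.
rewrite /= => qe.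
have labs w : `|(l w : R)| <= q w.
  rewrite ler_norml lle andbT lerNl -(seminormN w qs).
  by have := lle (- w); rewrite linearN.
rewrite distrC; apply: le_lt_trans qe.
by have := labs (y - x); rewrite linearB.
Qed.

Lemma separating_functional x : x != 0 ->
  exists l : {linear E -> R^o}, continuous (l : E -> R) /\ (l x : R) != 0.
Proof.
move=> /seminorm_separated[q qs qx].
have [l [_ lx lc]] := hahn_banach x qs.
by exists l; split=> //; rewrite lx gt_eqF.
Qed.

End Seminorms.

(** * Directional derivatives and the chain rule *)

Definition continuous_on (S T : topologicalType) (U : set S) (f : S -> T) :=
  forall x, U x -> f @ x --> f x.

Lemma within_continuous_open (S T : topologicalType) (U : set S) (f : S -> T) :
  open U -> {within U, continuous f} <-> continuous_on U f.
Proof.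
move=> oU; rewrite continuous_open_subspace//; split=> h x.
  by move=> Ux; apply: h; rewrite inE.
by rewrite inE; exact: h.
Qed.

Lemma setXT_open (S T : topologicalType) (U : set S) :
  open U -> open (U `*` [set: T]).
Proof.
move=> oU; have -> : U `*` [set: T] = fst @^-1` U.
  by apply/seteqP; split => [[x y] []//|[x y] ?]; split.
by apply: open_comp oU => p _; exact: cvg_fst.
Qed.

Lemma open_mem_nbhs (S : topologicalType) (U : set S) x : open U -> U x ->
  nbhs x U.
Proof. by move=> oU Ux; apply: open_nbhs_nbhs. Qed.

Section DirectionalDerivatives.
Context {R : realType}.
Implicit Types E F H : lcsType R.

Lemma cvg_seminormP F (T : Type) (A : set_system T) (u : T -> F) (c : F) :
  Filter A ->
  (forall q : F -> R, continuous_seminorm q -> forall e, 0 < e ->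
     \forall t \near A, q (u t - c) < e) -> u @ A --> c.
Proof.
move=> FA h U Uc.
have U0 : nbhs (0 : F) [set z | U (z + c)].
  have : (fun z => z + c) @ (0 : F) --> 0 + c.
    by apply: tvs_cvgD; [exact: cvg_id|exact: cvg_cst].
  by rewrite add0r => /(_ _ Uc).
have [q qs qU] := nbhs0_seminorm U0.
have := h _ qs 1 ltr01; apply: filterS => t /qU /=.
by rewrite subrK.
Qed.

Lemma has_dir_deriv_unique E F (f : E -> F) x y (l m : F) :
  has_dir_deriv f x y l -> has_dir_deriv f x y m -> l = m.
Proof. by move=> fl fm; apply: (cvg_unique _ fl fm); exact: lcs_hausdorff. Qed.

Lemma dir_derivE E F (f : E -> F) x y (l : F) :
  has_dir_deriv f x y l -> dir_deriv f x y = l.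
Proof.
move=> fl; rewrite /dir_deriv; case: xgetP => [m _ fm|/(_ l)//].
exact: has_dir_deriv_unique fm fl.
Qed.

Lemma line_cvg E (x y : E) : (fun t : R => x + t *: y) @ 0 --> x.
Proof.
rewrite -[X in _ --> X]addr0 -(scale0r y).
by apply: tvs_cvgD; [exact: cvg_cst|apply: tvs_cvgZ; [exact: cvg_id|exact: cvg_cst]].
Qed.

Lemma has_dir_deriv_near E F (f g : E -> F) x y (l : F) :
  (\forall z \near x, f z = g z) ->
  has_dir_deriv f x y l -> has_dir_deriv g x y l.
Proof.
move=> fg; rewrite /has_dir_deriv => h.
have fgx : f x = g x by exact: nbhs_singleton fg.
have fgt : \forall t \near (0 : R)^', f (x + t *: y) = g (x + t *: y).
  by apply: (@nbhs_dnbhs _ (0 : R)); exact: (@line_cvg E x y _ fg).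
apply: cvg_trans h; apply: near_eq_cvg.
by apply: filterS fgt => t ->; rewrite fgx.
Qed.

Lemma has_dir_derivZ E F (f : E -> F) x y (l : F) (a : R) :
  has_dir_deriv f x y l -> has_dir_deriv f x (a *: y) (a *: l).
Proof.
have [->|a0] := eqVneq a 0.
  rewrite !scale0r => _; rewrite /has_dir_deriv.
  under eq_fun do rewrite scaler0 addr0 subrr scaler0.
  exact: cvg_cst.
move=> h; rewrite /has_dir_deriv.
have -> : (fun t : R => t^-1 *: (f (x + t *: (a *: y)) - f x)) =
    (fun t => a *: ((t * a)^-1 *: (f (x + (t * a) *: y) - f x))).
  by apply/funext => t; rewrite !scalerA invfM mulrCA mulfV// mulr1.
apply: tvs_cvgZ; first exact: cvg_cst.
apply: (@cvg_comp _ _ _ (fun t => t * a)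
  (fun s => s^-1 *: (f (x + s *: y) - f x)) _ ((0 : R)^')); last exact: h.
have ta : (fun t : R => t * a) @ (0 : R) --> (0 : R).
  rewrite -[X in _ --> X](mul0r a).
  by apply: cvgM; [exact: cvg_id|exact: cvg_cst].
move=> U hU; have : \forall t \near (0 : R), t * a != 0 -> U (t * a).
  exact: (ta _ hU).
by apply: filterS => t h' t0; apply: h'; rewrite mulf_neq0.
Qed.

Lemma mean_value_functional E F (f : E -> F) x y (d : R -> F)
    (l : {linear F -> R^o}) : continuous (l : F -> R) ->
  (forall s : R, 0 <= s <= 1 -> has_dir_deriv f (x + s *: y) y (d s)) ->
  exists2 s : R, 0 <= s <= 1 & (l (f (x + y) - f x) : R) = l (d s).
Proof.
move=> lc hd.
pose phi (t : R) : R := l (f (x + t *: y)).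
have dphi (t : R) : 0 <= t <= 1 -> is_derive t (1 : R) phi (l (d t) : R).
  move=> t01; have ct : (fun h : R => h^-1 *: ((phi \o shift t) (h *: 1) - phi t)) @ 0^'
      --> (l (d t) : R).
    have -> : (fun h : R => h^-1 *: ((phi \o shift t) (h *: 1) - phi t)) =
      (l : F -> R) \o (fun h : R => h^-1 *: (f (x + t *: y + h *: y) - f (x + t *: y))).
      apply/funext => h; rewrite /phi /= linearZ /=.
      have -> : h *: (1 : R) + t = t + h by rewrite [h *: _]mulr1 addrC.
      rewrite [in RHS]linearB scalerDl addrA.
      exact: erefl.
    apply: (@cvg_comp _ _ _ (fun h : R => h^-1 *: (f (x + t *: y + h *: y) -
      f (x + t *: y))) (l : F -> R) _ (nbhs (d t))); first exact: hd.
    exact: lc.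
  split; first by apply/cvg_ex; exists (l (d t)).
  exact: cvg_lim ct.
have dphi' (t : R) : t \in `]0, 1[%R -> is_derive t (1 : R) phi (l (d t) : R).
  by rewrite in_itv/= => /andP[s0 s1]; apply: dphi; rewrite !ltW.
have cphi : {within `[0, 1], continuous phi}.
  apply: derivable_within_continuous => t; rewrite in_itv/= => /dphi h.
  exact: ex_derive.
have [c c01] := MVT_segment (@ler01 R) dphi' cphi.
rewrite subr0 mulr1 /phi scale1r scale0r addr0 => h.
exists c; first by rewrite in_itv in c01.
by rewrite linearB/= h.
Qed.

(** A functional that norms the vector on the left for [q] reduces the estimate
    to the mean value theorem for real functions. *)
Lemma mean_value_seminorm E F (f : E -> F) x y (d : R -> F) (c : F)
    (q : F -> R) : continuous_seminorm q ->
  (forall s : R, 0 <= s <= 1 -> has_dir_deriv f (x + s *: y) y (d s)) ->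
  exists2 s : R, 0 <= s <= 1 & q (f (x + y) - f x - c) <= q (d s - c).
Proof.
move=> qs hd.
have [l [lq lz lc]] := hahn_banach (f (x + y) - f x - c) qs.
have [s s01 ls] := mean_value_functional lc hd.
by exists s => //; rewrite -lz linearB/= ls -linearB lq.
Qed.

Definition C1_on E F (U : set E) (f : E -> F) (df : E * E -> F) :=
  (forall x y, U x -> has_dir_deriv f x y (df (x, y))) /\
  continuous_on (U `*` [set: E]) df.

(** The base point [b t] and the direction [w t] may move with [t]: by joint
    continuity of [df], the mean value estimate on the segment from [b t] in
    direction [w t] is uniform.  A moving base point gives additivity of the
    derivative, a moving direction the chain rule. *)
Lemma difference_quotient_cvg E F (U : set E) (f : E -> F) df x
    (b w : R -> E) w0 :
  open U -> U x -> C1_on U f df -> b @ (0 : R)^' --> x -> w @ (0 : R)^' --> w0 ->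
  t^-1 *: (f (b t + t *: w t) - f (b t)) @[t --> (0 : R)^'] --> df (x, w0).
Proof.
move=> oU Ux [fd dfc] bx ww0; apply: cvg_seminormP => q qs e e0.
have [qD qZ qc] := qs.
have nU : \forall p \near (x, w0), (U `*` [set: E]) p.
  by apply: open_mem_nbhs; [exact: setXT_open|split].
have nq : \forall p \near (x, w0), q (df p - df (x, w0)) < e.
  have h := seminorm_lt_nbhs (df (x, w0)) qs e0.
  by apply: dfc h; split.
have near1 : \forall p \near (x, w0), U p.1 /\ q (df p - df (x, w0)) < e.
  by apply: filterS2 nU nq => p [].
have near2 : \forall r \near (0 : R) & v \near (x, w0),
    U (v.1 + r *: v.2) /\ q (df (v.1 + r *: v.2, v.2) - df (x, w0)) < e.
  have h : (fun p : R * (E * E) => (p.2.1 + p.1 *: p.2.2, p.2.2)) @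
      (0 : R, (x, w0)) --> (x, w0).
    have s1 : (fun p : R * (E * E) => p.2.1) @ (0 : R, (x, w0)) --> x.
      by apply: (@cvg_comp _ _ _ snd fst _ (nbhs (x, w0))); [exact: cvg_snd|exact: cvg_fst].
    have s2 : (fun p : R * (E * E) => p.2.2) @ (0 : R, (x, w0)) --> w0.
      by apply: (@cvg_comp _ _ _ snd snd _ (nbhs (x, w0))); exact: cvg_snd.
    apply: cvg_pair => //=.
    have {2}-> : x = x + 0 *: w0 by rewrite scale0r addr0.
    by apply: tvs_cvgD => //; apply: tvs_cvgZ => //; exact: cvg_fst.
  exact: (h _ near1).
case: near2 => -[/= A B] [/nbhs_ballP[r r0 rA] wB] AB.
have nt : \forall t \near (0 : R)^', `|t| < r.
  apply: (@nbhs_dnbhs _ (0 : R)); apply/nbhs_ballP; exists r => // t.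
  by rewrite /ball/= sub0r normrN.
have nw : \forall t \near (0 : R)^', B (b t, w t) by exact: (cvg_pair bx ww0 wB).
have n0 : \forall t \near (0 : R)^', t != 0.
  by apply: (@filterE _ (nbhs (0 : R))) => t.
apply: filterS3 nt nw n0 => t tr Bwt t0.
have UB s : 0 <= s <= 1 -> U (b t + s *: (t *: w t)) /\
    q (df (b t + s *: (t *: w t), w t) - df (x, w0)) < e.
  move=> /andP[s0 s1]; rewrite scalerA; apply: (AB (s * t, (b t, w t))).
  split => //=; apply: rA; rewrite /ball/= sub0r normrN normrM ger0_norm//.
  by rewrite (le_lt_trans _ tr)// ler_piMl.
have [s s01 hs] := @mean_value_seminorm _ _ f (b t) (t *: w t)
  (fun s => t *: df (b t + s *: (t *: w t), w t)) (t *: df (x, w0)) q qs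
  (fun s hs => has_dir_derivZ (fd _ _ (UB s hs).1)).
have -> : t^-1 *: (f (b t + t *: w t) - f (b t)) - df (x, w0) =
    t^-1 *: (f (b t + t *: w t) - f (b t) - t *: df (x, w0)).
  by rewrite scalerBr [in RHS]scalerBr scalerA mulVf// scale1r scalerBr.
rewrite qZ -ltr_pdivlMl ?normr_gt0 ?invr_eq0// normfV invrK.
apply: le_lt_trans hs _; rewrite -scalerBr qZ ltr_pM2l ?normr_gt0//.
exact: (UB s s01).2.
Qed.

(** The increment along [y + z] is the increment along [y] from [x], followed by
    the one along [z] from the moving base point [x + t *: y]. *)
Lemma C1_additive E F (U : set E) (f : E -> F) df x y z :
  open U -> U x -> C1_on U f df -> df (x, y + z) = df (x, y) + df (x, z).
Proof.
move=> oU Ux fC; have [fd _] := fC.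
have h1 : (fun t : R => x + t *: y) @ 0^' --> x.
  by move=> A xA; apply: (@nbhs_dnbhs _ (0 : R)); exact: (@line_cvg E x y _ xA).
have cz : (fun=> z) @ (0 : R)^' --> z by exact: cvg_cst.
have h2 := difference_quotient_cvg oU Ux fC h1 cz.
apply: (has_dir_deriv_unique (fd _ _ Ux)).
apply: cvg_near_eq (tvs_cvgD (fd x y Ux) h2).
near=> t; rewrite -scalerDr; congr (_ *: _).
by rewrite [LHS]addrC scalerDr [x + (_ + _)]addrA [LHS]addrA subrK.
Unshelve. all: by end_near. Qed.

Lemma C1_scale E F (U : set E) (f : E -> F) df x y (a : R) :
  U x -> C1_on U f df -> df (x, a *: y) = a *: df (x, y).
Proof.
move=> Ux [fd _]; apply: (has_dir_deriv_unique (fd _ _ Ux)).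
by apply: has_dir_derivZ; exact: fd.
Qed.

Lemma C1_linear E F (U : set E) (f : E -> F) df x (a : R) y z :
  open U -> U x -> C1_on U f df ->
  df (x, a *: y + z) = a *: df (x, y) + df (x, z).
Proof. by move=> oU Ux fC; rewrite (C1_additive _ _ oU Ux fC) (C1_scale _ _ Ux fC). Qed.

Lemma chain_rule E F H (V : set F) (f : E -> F) (g : F -> H) dg x y (l : F) :
  open V -> V (f x) -> C1_on V g dg -> has_dir_deriv f x y l ->
  has_dir_deriv (g \o f) x y (dg (f x, l)).
Proof.
move=> oV Vfx gC fl.
have cb : (fun=> f x) @ (0 : R)^' --> f x by exact: cvg_cst.
apply: cvg_near_eq (difference_quotient_cvg oV Vfx gC cb fl).
have n0 : \forall t \near (0 : R)^', t != 0.
  by apply: (@filterE _ (nbhs (0 : R))) => t.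
apply: filterS n0 => t t0 /=.
by rewrite scalerA mulfV// scale1r [f x + _]addrC subrK.
Qed.

End DirectionalDerivatives.

(** * Maps of class C^k *)

Section ContinuousOn.
Implicit Types S T Z : topologicalType.

Lemma continuous_onS S T (U V : set S) (f : S -> T) :
  V `<=` U -> continuous_on U f -> continuous_on V f.
Proof. by move=> VU fU x /VU; exact: fU. Qed.

Lemma continuous_on_eq S T (U : set S) (f g : S -> T) : open U ->
  (forall x, U x -> f x = g x) -> continuous_on U f -> continuous_on U g.
Proof.
move=> oU fg fU x Ux; rewrite -(fg x Ux).
apply: cvg_near_eq (fU x Ux).
by apply: filterS (open_mem_nbhs oU Ux) => z /fg.
Qed.

Lemma continuous_on_comp S T Z (U : set S) (V : set T) (f : S -> T) (g : T -> Z) :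
  (forall x, U x -> V (f x)) -> continuous_on U f -> continuous_on V g ->
  continuous_on U (g \o f).
Proof.
by move=> UV fU gV x Ux; apply: cvg_comp; [exact: fU|exact/gV/UV].
Qed.

Lemma continuous_on_pair S T Z (U : set S) (f : S -> T) (g : S -> Z) :
  continuous_on U f -> continuous_on U g ->
  continuous_on U (fun x => (f x, g x)).
Proof. by move=> fU gU x Ux; apply: cvg_pair; [exact: fU|exact: gU]. Qed.

Lemma continuous_on_local S T (U : set S) (f : S -> T) :
  (forall x, U x -> exists V, [/\ open V, V x & continuous_on V f]) ->
  continuous_on U f.
Proof. by move=> h x /h[V [_ Vx]]; exact. Qed.

End ContinuousOn.

Section Ck_calculus.
Context {R : realType}.
Implicit Types E F H : lcsType R.

Lemma Ck_eq k E F (U : set E) (f g : E -> F) : open U ->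
  (forall x, U x -> f x = g x) -> Ck k U f -> Ck k U g.
Proof.
move=> oU fg; have eqc : {within U, continuous f} -> {within U, continuous g}.
  rewrite !within_continuous_open//; exact: continuous_on_eq.
case: k => [|k] [/eqc gc]; first by split.
move=> [df [fd dfk]]; split => //; exists df; split=> // x y Ux.
apply: has_dir_deriv_near (fd x y Ux).
by apply: filterS (open_mem_nbhs oU Ux) => z /fg.
Qed.

(** Limits being unique, the derivative quantified existentially in [Ck] is
    [dir_deriv]. *)
Lemma CkS k E F (U : set E) (f : E -> F) : open U ->
  Ck k.+1 U f <-> [/\ continuous_on U f,
    forall x y, U x -> has_dir_deriv f x y (dir_deriv f x y) &
    Ck k (U `*` setT) (fun p => dir_deriv f p.1 p.2)].
Proof.
move=> oU; split=> [[fc [df [fd dfk]]]|[fc fd fk]].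
  split; first by move: fc; rewrite within_continuous_open.
    by move=> x y Ux; rewrite (dir_derivE (fd x y Ux)); exact: fd.
  apply: Ck_eq dfk; first exact: setXT_open.
  by move=> [x y] [Ux _] /=; rewrite (dir_derivE (fd x y Ux)).
split; first by rewrite within_continuous_open.
by exists (fun p => dir_deriv f p.1 p.2).
Qed.

Lemma Ck_continuous k E F (U : set E) (f : E -> F) : open U ->
  Ck k U f -> continuous_on U f.
Proof. by move=> oU; case: k => [|k] [fc _]; move: fc; rewrite within_continuous_open. Qed.

Lemma Ck0 E F (U : set E) (f : E -> F) : open U ->
  Ck 0 U f <-> continuous_on U f.
Proof. by move=> oU /=; rewrite within_continuous_open//; split=> [[]|]. Qed.

Lemma Ck_C1 k E F (U : set E) (f : E -> F) : open U -> Ck k.+1 U f ->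
  C1_on U f (fun p => dir_deriv f p.1 p.2).
Proof.
move=> oU /(CkS _ _ oU)[fc fd fk]; split => //.
by apply: Ck_continuous fk; exact: setXT_open.
Qed.

Lemma CkW k E F (U : set E) (f : E -> F) : open U -> Ck k.+1 U f -> Ck k U f.
Proof.
elim: k E F U f => [|k IH] E F U f oU.
  by move=> /(CkS _ _ oU)[? _ _]; rewrite Ck0.
move=> /(CkS _ _ oU)[fc fd fk]; apply/CkS => //; split => //.
by apply: IH => //; exact: setXT_open.
Qed.

Lemma Ck_local k E F (U : set E) (f : E -> F) : open U ->
  (forall x, U x -> exists V, [/\ open V, V x & Ck k V f]) -> Ck k U f.
Proof.
elim: k E F U f => [|k IH] E F U f oU h.
  apply/Ck0 => //; apply: continuous_on_local => x /h[V [oV Vx /(Ck0 _ oV) fV]].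
  by exists V.
apply/CkS => //; split.
- apply: continuous_on_local => x /h[V [oV Vx /(CkS _ _ oV)[fV _ _]]].
  by exists V.
- by move=> x y /h[V [oV Vx /(CkS _ _ oV)[_ fV _]]]; exact: fV.
- apply: IH; first exact: setXT_open.
  move=> [x y] [/h[V [oV Vx /(CkS _ _ oV)[_ _ fV]]] _].
  by exists (V `*` setT); split => //; exact: setXT_open.
Qed.

Lemma Ck_subset k E F (U V : set E) (f : E -> F) : open U -> open V ->
  V `<=` U -> Ck k U f -> Ck k V f.
Proof.
move=> oU oV VU; elim: k E F U V oU oV VU f => [|k IH] E F U V oU oV VU f.
  by rewrite !Ck0//; exact: continuous_onS.
rewrite !CkS// => -[fc fd fk]; split.
- exact: continuous_onS fc.
- by move=> x y /VU; exact: fd.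
- apply: IH fk; [exact: setXT_open|exact: setXT_open|].
  by move=> [x y] [/VU].
Qed.

Definition cont_linear E F (L : E -> F) :=
  continuous L /\ forall (a : R) x y, L (a *: x + y) = a *: L x + L y.

Lemma cont_linear_pair E F E' F' (L : E -> F) (L' : E' -> F') :
  cont_linear L -> cont_linear L' ->
  cont_linear (fun p : E * E' => (L p.1, L' p.2)).
Proof.
move=> [Lc Ll] [Lc' Ll']; split=> [p|a x y]; last by rewrite Ll Ll'.
apply: cvg_pair; apply: cvg_comp; [exact: cvg_fst|exact: Lc|exact: cvg_snd|exact: Lc'].
Qed.

Lemma cont_linear_fst E F : cont_linear (fst : E * F -> E).
Proof. by split=> [p|a x y]; [exact: cvg_fst|]. Qed.

Lemma cont_linear_snd E F : cont_linear (snd : E * F -> F).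
Proof. by split=> [p|a x y]; [exact: cvg_snd|]. Qed.

Lemma cont_linear_comp E F H (L : E -> F) (M : F -> H) :
  cont_linear L -> cont_linear M -> cont_linear (M \o L).
Proof.
move=> [Lc Ll] [Mc Ml]; split=> [x|a x y] /=; last by rewrite Ll Ml.
by apply: cvg_comp; [exact: Lc|exact: Mc].
Qed.

(** The derivative [(x, y) |-> dg (L x, L y)] is again a composite with a linear
    map. *)
Lemma Ck_comp_linear k E F H (L : E -> F) (U : set E) (V : set F) (g : F -> H) :
  open U -> open V -> (forall x, U x -> V (L x)) ->
  cont_linear L -> Ck k V g -> Ck k U (g \o L).
Proof.
elim: k E F H L U V g => [|k IH] E F H L U V g oU oV UV cL.
  rewrite !Ck0// => gV; apply: continuous_on_comp gV => //.
  by move=> x _; exact: cL.1.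
move=> /[dup]/(Ck_continuous oV) gc /(CkS _ _ oV)[_ gd gk]; split.
  rewrite within_continuous_open//; apply: continuous_on_comp gc => //.
  by move=> x _; exact: cL.1.
exists ((fun p => dir_deriv g p.1 p.2) \o (fun p : E * E => (L p.1, L p.2))).
split=> [x y Ux /=|].
  rewrite /has_dir_deriv /=.
  have -> : (fun t : R => t^-1 *: (g (L (x + t *: y)) - g (L x))) =
      (fun t => t^-1 *: (g (L x + t *: L y) - g (L x))).
    by apply/funext => t; rewrite [x + _]addrC cL.2 [_ + L x]addrC.
  exact/gd/UV.
apply: IH gk; [exact: setXT_open|exact: setXT_open| |exact: cont_linear_pair].
by move=> [x y] [/UV].
Qed.

Lemma Ck_linear k E F (L : E -> F) : cont_linear L -> Ck k setT L.
Proof.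
elim: k E F L => [|k IH] E F L cL.
  by apply/Ck0; [exact: openT|move=> x _; exact: cL.1].
split; first by rewrite within_continuous_open; [move=> x _; exact: cL.1|exact: openT].
exists (L \o snd); split=> [x y _ /=|].
  have cL0 : (fun=> L y) @ (0 : R)^' --> L y by exact: cvg_cst.
  apply: cvg_near_eq cL0.
  have n0 : \forall t \near (0 : R)^', t != 0.
    by apply: (@filterE _ (nbhs (0 : R))) => t.
  apply: filterS n0 => t t0.
  by rewrite [x + _]addrC cL.2 addrK scalerA mulVf// scale1r.
rewrite setXTT; apply: IH; apply: cont_linear_comp cL; exact: cont_linear_snd.
Qed.

Lemma has_dir_deriv_pair E F H (f : E -> F) (g : E -> H) x y l m :
  has_dir_deriv f x y l -> has_dir_deriv g x y m ->
  has_dir_deriv (fun z => (f z, g z)) x y (l, m).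
Proof. by move=> fl gm; exact: cvg_pair. Qed.

Lemma Ck_pair k E F H (U : set E) (f : E -> F) (g : E -> H) : open U ->
  Ck k U f -> Ck k U g -> Ck k U (fun x => (f x, g x)).
Proof.
elim: k E F H U f g => [|k IH] E F H U f g oU.
  by rewrite !Ck0//; exact: continuous_on_pair.
rewrite !(CkS _ _ oU) => -[fc fd fk] [gc gd gk]; rewrite -(CkS _ _ oU); split.
  by rewrite within_continuous_open//; exact: continuous_on_pair.
exists (fun p => (dir_deriv f p.1 p.2, dir_deriv g p.1 p.2)); split=> [x y Ux|].
  by apply: has_dir_deriv_pair; [exact: fd|exact: gd].
by apply: IH => //; exact: setXT_open.
Qed.

Lemma Ck_comp k E F H (U : set E) (V : set F) (f : E -> F) (g : F -> H) :
  open U -> open V -> (forall x, U x -> V (f x)) ->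
  Ck k U f -> Ck k V g -> Ck k U (g \o f).
Proof.
elim: k E F H U V f g => [|k IH] E F H U V f g oU oV UV.
  by rewrite !Ck0//; exact: continuous_on_comp.
move=> fk gk; have fC := Ck_C1 oU fk; have gC := Ck_C1 oV gk.
have fk' := CkW oU fk.
move: fk gk; rewrite !CkS// => -[fc fd fk] [gc gd gk]; rewrite -(CkS _ _ oU).
split; first by rewrite within_continuous_open//; exact: continuous_on_comp gc.
exists ((fun p => dir_deriv g p.1 p.2) \o
  (fun p => (f p.1, dir_deriv f p.1 p.2))); split=> [x y Ux|].
  exact: (chain_rule oV (UV _ Ux) gC (fd _ _ Ux)).
have oUT : open (U `*` [set: E]) by exact: setXT_open.
apply: IH gk => //; [exact: setXT_open|by move=> [x y] [/UV]|].
apply: Ck_pair => //; apply: (Ck_comp_linear _ oU _ (@cont_linear_fst E E)) => //.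
by move=> [x y] [].
Qed.

Lemma smooth_eq E F (U : set E) (f g : E -> F) : open U ->
  (forall x, U x -> f x = g x) -> smooth_on U f -> smooth_on U g.
Proof. by move=> oU fg fs k; exact: (Ck_eq oU fg). Qed.

Lemma smooth_local E F (U : set E) (f : E -> F) : open U ->
  (forall x, U x -> exists V, [/\ open V, V x & smooth_on V f]) ->
  smooth_on U f.
Proof.
move=> oU h k; apply: Ck_local => // x /h[V [oV Vx fV]]; exists V; split => //.
Qed.

Lemma smooth_subset E F (U V : set E) (f : E -> F) : open U -> open V ->
  V `<=` U -> smooth_on U f -> smooth_on V f.
Proof. by move=> oU oV VU fs k; exact: (Ck_subset oU). Qed.

Lemma smooth_comp E F H (U : set E) (V : set F) (f : E -> F) (g : F -> H) :
  open U -> open V -> (forall x, U x -> V (f x)) ->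
  smooth_on U f -> smooth_on V g -> smooth_on U (g \o f).
Proof. by move=> oU oV UV fs gs k; exact: (Ck_comp oU oV UV). Qed.

Lemma smooth_pair E F H (U : set E) (f : E -> F) (g : E -> H) : open U ->
  smooth_on U f -> smooth_on U g -> smooth_on U (fun x => (f x, g x)).
Proof. by move=> oU fs gs k; exact: Ck_pair. Qed.

Lemma smooth_linear E F (U : set E) (L : E -> F) : open U ->
  cont_linear L -> smooth_on U L.
Proof. by move=> oU cL k; apply: (Ck_subset openT oU _ (Ck_linear k cL)). Qed.

Lemma smooth_C1 E F (U : set E) (f : E -> F) : open U -> smooth_on U f ->
  C1_on U f (fun p => dir_deriv f p.1 p.2).
Proof. by move=> oU fs; exact: (Ck_C1 oU (fs 1%N)). Qed.

Lemma smooth_dir_deriv E F (U : set E) (f : E -> F) : open U -> smooth_on U f ->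
  smooth_on (U `*` setT) (fun p => dir_deriv f p.1 p.2).
Proof. by move=> oU fs k; have /(CkS _ _ oU)[] := fs k.+1. Qed.

End Ck_calculus.

(** * Charts, tangent charts and product charts *)

Section OpenSets.
Implicit Types S T : topologicalType.

Lemma continuous_on_openI S T (U : set S) (f : S -> T) (O : set T) :
  open U -> continuous_on U f -> open O -> open (U `&` f @^-1` O).
Proof.
move=> oU fU oO; rewrite openE => x [Ux Ofx].
apply: filterI; first exact: open_mem_nbhs.
exact: (fU x Ux _ (open_mem_nbhs oO Ofx)).
Qed.

Lemma continuous_on_openP S T (U : set S) (f : S -> T) :
  (forall O, open O -> open (U `&` f @^-1` O)) -> continuous_on U f.
Proof.
move=> h x Ux A; rewrite nbhsE => -[W [oW Wfx] WA].
have : nbhs x (U `&` f @^-1` W) by apply: open_mem_nbhs; [exact: h|].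
by apply: filterS => y [_ /WA].
Qed.

End OpenSets.

Section Pcharts.
Context {M E : topologicalType}.
Implicit Types (c : pchart M E) (W : set M).

Lemma pchart_cinv c y : is_pchart c -> ctarget c y ->
  cdom c (cinv c y) /\ c (cinv c y) = y.
Proof. by case=> _ _ cK _ _ [x cx <-]; rewrite cK. Qed.

Lemma pchart_imageE c W : is_pchart c ->
  c @` (cdom c `&` W) = ctarget c `&` cinv c @^-1` W.
Proof.
move=> pc; have [_ _ cK _ _] := pc; apply/seteqP; split=> y.
  by move=> [x [cx Wx] <-]; split; [exists x|rewrite /= cK].
move=> [ty Wy]; have [cy yK] := pchart_cinv pc ty.
by exists (cinv c y).
Qed.

Lemma pchart_continuous c : is_pchart c -> continuous_on (cdom c) c.
Proof. by move=> [oc _ _ + _]; rewrite within_continuous_open. Qed.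

Lemma pchart_cinv_continuous c : is_pchart c ->
  continuous_on (ctarget c) (cinv c).
Proof. by move=> [_ oc _ _]; rewrite within_continuous_open. Qed.

Lemma pchart_image_open c W : is_pchart c -> open W ->
  open (c @` (cdom c `&` W)).
Proof.
move=> pc oW; rewrite pchart_imageE//; have [_ ot _ _ _] := pc.
by apply: continuous_on_openI => //; exact: pchart_cinv_continuous.
Qed.

End Pcharts.

Section Manifold.
Context {R : realType} {E : lcsType R} {M : chartedType E}.
Hypothesis hM : is_manifold M.
Implicit Types (c d a : pchart M E).

Lemma atlas_charts c : atlas c -> charts M c.
Proof.
by have [_ h _ compat] := hM => ac; split=> [|d ad]; [exact: h|exact: compat].
Qed.

Lemma charts_cover (x : M) : exists2 c, charts M c & cdom c x.
Proof.
by have [_ _ cov _] := hM; have [c /atlas_charts ? ?] := cov x; exists c.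
Qed.

Lemma chart_at_charts (x : M) :
  charts M (chart_at x) /\ cdom (chart_at x) x.
Proof.
rewrite /chart_at; case: xgetP => [c _ //|h].
by have [c cc cx] := charts_cover x; case: (h c).
Qed.

(** Two charts of the maximal atlas are compared locally through a chart of the
    given atlas. *)
Lemma charts_smooth_transition c d : charts M c -> charts M d ->
  smooth_on (c @` (cdom c `&` cdom d)) (d \o cinv c).
Proof.
move=> [pc cc] [pd dd]; have [oc _ cK _ _] := pc; have [od _ dK _ _] := pd.
apply: smooth_local; first exact: pchart_image_open.
move=> _ [x [cx dx] <-].
have [_ hp cov _] := hM; have [a aa ax] := cov x.
have pa := hp _ aa; have [oa _ aK _ _] := pa.
have ca : compatible c a by exact: cc.
have da : compatible d a by exact: dd.
exists (c @` (cdom c `&` (cdom d `&` cdom a))); split.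
- by apply: pchart_image_open => //; exact: openI.
- by exists x.
have h : smooth_on (c @` (cdom c `&` (cdom d `&` cdom a)))
    ((d \o cinv a) \o (a \o cinv c)).
  apply: (@smooth_comp _ _ _ _ _ (a @` (cdom d `&` cdom a))).
  - by apply: pchart_image_open => //; exact: openI.
  - by rewrite setIC; exact: pchart_image_open.
  - by move=> _ [y [cy [dy ay]] <-]; exists y => //=; rewrite cK.
  - apply: smooth_subset ca.1; [exact: pchart_image_open| |].
      by apply: pchart_image_open => //; exact: openI.
    by move=> _ [y [cy [dy ay]] <-]; exists y.
  - exact: da.2.
apply: smooth_eq h; first by apply: pchart_image_open => //; exact: openI.
by move=> _ [y [cy [dy ay]] <-] /=; rewrite cK// aK.
Qed.

Lemma transition_C1 c d : charts M c -> charts M d ->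
  C1_on (c @` (cdom c `&` cdom d)) (d \o cinv c)
    (fun p => dir_deriv (d \o cinv c) p.1 p.2).
Proof.
move=> cc cd; apply: smooth_C1; last exact: charts_smooth_transition.
by apply: pchart_image_open; [exact: cc.1|have [[]] := cd].
Qed.

Lemma transition_deriv_comp c a d x v : charts M c -> charts M a ->
  charts M d -> cdom c x -> cdom a x -> cdom d x ->
  dir_deriv (d \o cinv a) (a x) (dir_deriv (a \o cinv c) (c x) v) =
  dir_deriv (d \o cinv c) (c x) v.
Proof.
move=> cc ca cd cx ax dx; apply/esym/dir_derivE.
have [oc _ cK _ _] := cc.1; have [oa _ aK _ _] := ca.1.
have [od _ _ _ _] := cd.1.
have h1 : has_dir_deriv (a \o cinv c) (c x) v (dir_deriv (a \o cinv c) (c x) v).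
  by apply: (transition_C1 cc ca).1; exists x.
have := chain_rule (pchart_image_open ca.1 od) _ (transition_C1 ca cd) h1.
rewrite /= cK// => /(_ _)/wrap[]; first by exists x.
apply: has_dir_deriv_near.
have : nbhs (c x) (c @` (cdom c `&` cdom a)).
  by apply: open_mem_nbhs; [exact: (pchart_image_open cc.1)|exists x].
by apply: filterS => _ [y [cy ay] <-] /=; rewrite cK// aK.
Qed.

Lemma transition_deriv_id c x v : charts M c -> cdom c x ->
  dir_deriv (c \o cinv c) (c x) v = v.
Proof.
move=> cc cx; apply: dir_derivE.
have [oc ot cK _ _] := cc.1.
have h : has_dir_deriv (id : E -> E) (c x) v v.
  rewrite /has_dir_deriv; have c0 : (fun=> v) @ (0 : R)^' --> v by exact: cvg_cst.
  apply: cvg_near_eq c0.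
  have n0 : \forall t \near (0 : R)^', t != 0.
    by apply: (@filterE _ (nbhs (0 : R))) => t.
  apply: filterS n0 => t t0.
  by rewrite addrC addKr scalerA mulVf// scale1r.
apply: has_dir_deriv_near h.
have tx : ctarget c (c x) by exists x.
by apply: filterS (open_mem_nbhs ot tx) => y /(pchart_cinv cc.1)[].
Qed.

(** ** Tangent charts *)

Lemma TVec_eq (x y : M) (v w : E) : x = y -> v = w ->
  (TVec x v : tangent_bundle M) = TVec y w.
Proof. by move=> -> ->. Qed.

Lemma dchart_TVec c x (w : E) :
  dchart c (TVec x w) =
  dir_deriv (c \o cinv (chart_at x)) (chart_at x x) w.
Proof. by []. Qed.

Lemma dchart_cinv c d p : charts M c -> charts M d -> ctarget c p.1 ->
  cdom d (cinv c p.1) ->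
  dchart d (cinv (tangent_chart c) p) = dir_deriv (d \o cinv c) p.1 p.2.
Proof.
move=> cc cd tp dp.
have [cp pK] := pchart_cinv cc.1 tp.
have [ca ap] := chart_at_charts (cinv c p.1).
by have := transition_deriv_comp p.2 cc ca cd cp ap dp; rewrite pK.
Qed.

Lemma tangent_bundle_openE (W : set (tangent_bundle M)) :
  open W = tangent_open W.
Proof. by []. Qed.

Lemma tangent_chart_dom c : charts M c -> open (cdom (tangent_chart c)).
Proof.
rewrite tangent_bundle_openE => cc d cd; have [oc _ _ _ _] := cc.1; have [od _ dK _ _] := cd.1.
rewrite (_ : mkset _ = (d @` (cdom d `&` cdom c)) `*` setT).
  by apply: setXT_open; apply: pchart_image_open => //; exact: cd.1.
rewrite pchart_imageE; last exact: cd.1.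
by apply/seteqP; split=> [p [? ?]|p [[? ?] _]].
Qed.

Lemma tangent_chartK c v : charts M c -> cdom (tangent_chart c) v ->
  cinv (tangent_chart c) (tangent_chart c v) = v.
Proof.
move=> cc; case: v => x w /= cx.
have [_ _ cK _ _] := cc.1.
apply: TVec_eq; first exact: cK.
have [ca ax] := chart_at_charts x.
by rewrite cK// dchart_TVec transition_deriv_comp// transition_deriv_id.
Qed.

Lemma tangent_chart_cinvK c p : charts M c -> ctarget c p.1 ->
  tangent_chart c (cinv (tangent_chart c) p) = p.
Proof.
move=> cc tp; have [cp pK] := pchart_cinv cc.1 tp.
rewrite [LHS]surjective_pairing [RHS]surjective_pairing; congr pair => //.
by rewrite [LHS]dchart_cinv//; have := transition_deriv_id p.2 cc cp; rewrite pK.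
Qed.

Lemma tangent_chart_target c : charts M c ->
  ctarget (tangent_chart c) = ctarget c `*` setT.
Proof.
move=> cc; apply/seteqP; split=> p.
  by move=> [v cv <-]; split => //; exists (tbase v).
move=> [tp _]; exists (cinv (tangent_chart c) p); last exact: tangent_chart_cinvK.
by have [] := pchart_cinv cc.1 tp.
Qed.

Lemma tangent_chart_is_pchart c : charts M c ->
  is_pchart (tangent_chart c).
Proof.
move=> cc; have odom := tangent_chart_dom cc.
have otar : open (ctarget (tangent_chart c)).
  by rewrite tangent_chart_target//; apply: setXT_open; have [[]] := cc.
split => //; first by move=> v; exact: tangent_chartK.
- rewrite within_continuous_open//; apply: continuous_on_openP => O oO.
  rewrite tangent_bundle_openE => d cd.
  have [oc _ _ _ _] := cc.1; have [od _ dK _ _] := cd.1.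
  pose f p := ((c \o cinv d) p.1, dir_deriv (c \o cinv d) p.1 p.2).
  rewrite (_ : mkset _ =
    ((d @` (cdom d `&` cdom c)) `*` setT) `&` f @^-1` O).
    have oU : open (d @` (cdom d `&` cdom c)).
      by apply: pchart_image_open => //; exact: cd.1.
    apply: continuous_on_openI => //; first exact: setXT_open.
    apply: continuous_on_pair; last exact: (transition_C1 cd cc).2.
    apply: (@continuous_on_comp _ _ _ _ (d @` (cdom d `&` cdom c))).
    - by move=> [? ?] [].
    - by move=> p _; exact: cvg_fst.
    - have h := charts_smooth_transition cd cc.
      exact: (Ck_continuous oU (h 0%N)).
  rewrite pchart_imageE; last exact: cd.1.
  apply/seteqP; split=> p.
    by move=> [tp [cp Op]]; split => //; move: Op; rewrite /f /= dchart_cinv.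
  move=> [[[tp cp] _] Op]; split=> //; split=> //.
  by move: Op; rewrite /f /= dchart_cinv.
- rewrite within_continuous_open//; apply: continuous_on_openP => O.
  rewrite tangent_bundle_openE => oO.
  rewrite tangent_chart_target//; have := oO c cc.
  congr open; apply/seteqP; split=> p [].
    by move=> ? ?; split.
  by move=> [? _] ?; split.
Qed.

(** The transition maps are [(x, y) |-> (g x, dg (x, y))] for transition maps
    [g] of [M]. *)
Lemma tangent_chart_charts c : charts M c ->
  charts (tangent_bundle M) (tangent_chart c).
Proof.
have smooth a d : charts M a -> charts M d -> smooth_on
    (tangent_chart a @` (cdom (tangent_chart a) `&` cdom (tangent_chart d)))
    (tangent_chart d \o cinv (tangent_chart a)).
  move=> ca cd.
  have oa : open (a @` (cdom a `&` cdom d)).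
    by apply: pchart_image_open; [exact: ca.1|have [[]] := cd].
  have -> : tangent_chart a @` (cdom (tangent_chart a) `&` cdom (tangent_chart d))
      = (a @` (cdom a `&` cdom d)) `*` setT.
    rewrite pchart_imageE; last exact: tangent_chart_is_pchart.
    rewrite tangent_chart_target// pchart_imageE; last exact: ca.1.
    by apply/seteqP; split=> p [] // [].
  have oaT : open ((a @` (cdom a `&` cdom d)) `*` [set: E]) by exact: setXT_open.
  have h : smooth_on ((a @` (cdom a `&` cdom d)) `*` [set: E])
      (fun p => ((d \o cinv a) p.1, dir_deriv (d \o cinv a) p.1 p.2)).
    apply: smooth_pair => //; last first.
      by apply: smooth_dir_deriv => //; exact: charts_smooth_transition.
    apply: (smooth_comp oaT oa) (charts_smooth_transition ca cd).
      by move=> [? ?] [].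
    by apply: smooth_linear => //; exact: cont_linear_fst.
  apply: smooth_eq h => // p [+ _]; rewrite pchart_imageE; last exact: ca.1.
  by move=> [tp dp] /=; rewrite dchart_cinv.
move=> cc; split; first exact: tangent_chart_is_pchart.
by move=> _ [d cd <-]; split; [|rewrite setIC]; exact: smooth.
Qed.

Lemma dchart_continuous c : charts M c ->
  continuous_on [set v : tangent_bundle M | cdom c (tbase v)] (dchart c).
Proof.
move=> cc v cv.
have h := pchart_continuous (tangent_chart_is_pchart cc) cv.
apply: (@cvg_comp _ _ _ (tangent_chart c) snd _ _ _ h); exact: cvg_snd.
Qed.

Lemma dchart_linear c x (a : R) (v w : E) : charts M c -> cdom c x ->
  dchart c (TVec x (a *: v + w)) =
  a *: dchart c (TVec x v) + dchart c (TVec x w).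
Proof.
move=> cc cx; rewrite !dchart_TVec.
have [ca ax] := chart_at_charts x.
have [oc _ _ _ _] := cc.1.
have := @C1_linear _ _ _ _ _ _ (chart_at x x) a v w
  (pchart_image_open ca.1 oc) _ (transition_C1 ca cc).
by apply; exists x.
Qed.

End Manifold.

Section ProductCharts.
Context {R : realType} {E F : lcsType R} {M : chartedType E}
  {N : chartedType F}.
Hypotheses (hM : is_manifold M) (hN : is_manifold N).

Lemma openX (S T : topologicalType) (U : set S) (V : set T) :
  open U -> open V -> open (U `*` V).
Proof.
move=> oU oV; rewrite openE => -[x y] [Ux Vy]; exists (U, V) => //.
by split; exact: open_mem_nbhs.
Qed.

Lemma prod_chart_imageE (c : pchart M E) (d : pchart N F) U V :
  prod_chart c d @` (U `*` V) = (c @` U) `*` (d @` V).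
Proof.
apply/seteqP; split=> [_ [[x y] [Ux Vy] <-]|[z1 z2] [/= [x Ux <-] [y Vy <-]]].
  by split; [exists x|exists y].
by exists (x, y).
Qed.

Lemma prod_chart_is_pchart (c : pchart M E) (d : pchart N F) :
  is_pchart c -> is_pchart d -> is_pchart (prod_chart c d).
Proof.
move=> pc pd; have [oc otc cK _ _] := pc; have [od otd dK _ _] := pd.
have otar : open (ctarget (prod_chart c d)).
  by rewrite /ctarget prod_chart_imageE; exact: openX.
have odom : open (cdom (prod_chart c d)) by exact: openX.
split => //.
- by move=> [x y] [/= cx dy]; rewrite /= cK// dK//.
- rewrite within_continuous_open//; apply: continuous_on_pair.
  + apply: (@continuous_on_comp _ _ _ _ (cdom c) fst) (pchart_continuous pc).
      by move=> [? ?] [].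
    by move=> p _; exact: cvg_fst.
  + apply: (@continuous_on_comp _ _ _ _ (cdom d) snd) (pchart_continuous pd).
      by move=> [? ?] [].
    by move=> p _; exact: cvg_snd.
- rewrite within_continuous_open// /ctarget prod_chart_imageE.
  apply: continuous_on_pair.
  + apply: (@continuous_on_comp _ _ _ _ (ctarget c) fst) (pchart_cinv_continuous pc).
      by move=> [? ?] [].
    by move=> p _; exact: cvg_fst.
  + apply: (@continuous_on_comp _ _ _ _ (ctarget d) snd) (pchart_cinv_continuous pd).
      by move=> [? ?] [].
    by move=> p _; exact: cvg_snd.
Qed.

Lemma prod_chart_charts (c : pchart M E) (d : pchart N F) :
  charts M c -> charts N d -> charts (M * N)%type (prod_chart c d).
Proof.
have smooth (c1 c2 : pchart M E) (d1 d2 : pchart N F) :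
    charts M c1 -> charts M c2 -> charts N d1 -> charts N d2 ->
    smooth_on (prod_chart c1 d1 @`
        (cdom (prod_chart c1 d1) `&` cdom (prod_chart c2 d2)))
      (prod_chart c2 d2 \o cinv (prod_chart c1 d1)).
  move=> cc1 cc2 cd1 cd2.
  have -> : cdom (prod_chart c1 d1) `&` cdom (prod_chart c2 d2) =
      (cdom c1 `&` cdom c2) `*` (cdom d1 `&` cdom d2).
    by apply/seteqP; split=> -[x y] [[? ?] [? ?]].
  rewrite prod_chart_imageE.
  have oc : open (c1 @` (cdom c1 `&` cdom c2)).
    by apply: pchart_image_open; [exact: cc1.1|have [[]] := cc2].
  have od : open (d1 @` (cdom d1 `&` cdom d2)).
    by apply: pchart_image_open; [exact: cd1.1|have [[]] := cd2].
  apply: smooth_pair; first exact: openX.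
  - apply: (smooth_comp (openX oc od) oc _ _ (charts_smooth_transition hM cc1 cc2)).
      by move=> [? ?] [].
    by apply: smooth_linear; [exact: openX|exact: cont_linear_fst].
  - apply: (smooth_comp (openX oc od) od _ _ (charts_smooth_transition hN cd1 cd2)).
      by move=> [? ?] [].
    by apply: smooth_linear; [exact: openX|exact: cont_linear_snd].
move=> cc cd; split; first by apply: prod_chart_is_pchart; [exact: cc.1|exact: cd.1].
move=> _ [c2 [d2 [cc2 cd2 ->]]]; split; first exact: smooth.
by rewrite setIC; exact: smooth.
Qed.

End ProductCharts.

(** * Countably based compact sets *)

Section CountableBase.

(** For a compact subset of a locally convex space this amounts to
    metrizability, and it passes to subsets and products without the choice of
    a metric. *)
Definition countably_based (T : topologicalType) (C : set T) :=
  exists V : nat -> set T, (forall n, open (V n)) /\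
    forall x W, C x -> nbhs x W -> exists n, V n x /\ V n `&` C `<=` W.

Lemma countably_basedS (T : topologicalType) (C D : set T) :
  D `<=` C -> countably_based C -> countably_based D.
Proof.
move=> DC [V [oV hV]]; exists V; split=> // x W /DC Cx xW.
have [n [Vx VW]] := hV _ _ Cx xW; exists n; split=> // y [Vy /DC Cy].
exact: VW.
Qed.

Lemma countably_based_prod (S T : topologicalType) (C : set S) (D : set T) :
  countably_based C -> countably_based D -> countably_based (C `*` D).
Proof.
move=> [V [oV hV]] [W [oW hW]].
pose U k : set (S * T) := match @unpickle (nat * nat)%type k with
  | Some (n, m) => V n `*` W m | None => set0 end.
exists U; split=> [k|[x y] N [/= Cx Dy] [[A B] /= [xA yB] ABN]].
  rewrite /U; case: unpickle => [[n m]|]; last exact: open0.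
  rewrite openE => -[x y] [Vx Wy]; exists (V n, W m); last by [].
  by split; apply: open_nbhs_nbhs; split => //=.
have [n [Vx VA]] := hV _ _ Cx xA; have [m [Wy WB]] := hW _ _ Dy yB.
exists (pickle (n, m)); rewrite /U pickleK; split=> // -[x' y'] [[Vx' Wy'] [Cx' Dy']].
by apply: ABN; split; [exact: VA|exact: WB].
Qed.

Lemma countably_based_real (R : realType) (C : set R) : countably_based C.
Proof.
apply: (countably_basedS (@subsetT _ C)).
pose U k : set R := match @unpickle (rat * rat)%type k with
  | Some (p, q) => `]ratr p, ratr q[%classic | None => set0 end.
exists U; split=> [k|x W _ /nbhs_ballP[e e0 eW]].
  by rewrite /U; case: unpickle => [[p q]|]; [exact: interval_open|exact: open0].
have e0' : 0 < e := e0.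
have [p /itvP hp] : exists p, ratr p \in `]x - e, x[.
  by apply: rat_in_itvoo; rewrite ltrBlDr ltrDl.
have [q /itvP hq] : exists q, ratr q \in `]x, x + e[.
  by apply: rat_in_itvoo; rewrite ltrDl.
exists (pickle (p, q)); rewrite /U pickleK; split.
  by rewrite /= in_itv/= hp hq.
move=> y [/=]; rewrite in_itv/= => /andP[py yq] _; apply: eW.
rewrite /ball/= ltr_distlC; apply/andP; split.
  by rewrite (le_lt_trans _ py)// ltW// hp.
by rewrite (lt_le_trans yq)// ltW// hq.
Qed.

Lemma inv_natS_lt (R : realType) (e : R) : 0 < e -> exists m, m.+1%:R^-1 < e.
Proof.
move=> e0; exists (Num.bound e^-1); rewrite invf_plt ?posrE//.
apply: lt_trans (archi_boundP _) _; first by rewrite invr_ge0 ltW.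
by rewrite ltr_nat.
Qed.

(** The near-covering form of compactness, applied to the filter of finite
    subsets of [C]. *)
Lemma compact_finite_cover (T : topologicalType) (C : set T) (B : T -> set T) :
  compact C -> (forall x, C x -> nbhs x (B x)) ->
  exists s : seq T, (forall x, x \in s -> C x) /\
    C `<=` \bigcup_(x in [set` s]) B x.
Proof.
move=> /compact_near_coveringP cC nB.
pose D := [set s : seq T | forall x, x \in s -> C x].
pose up (s0 : seq T) := [set s : seq T | forall x, x \in s0 -> x \in s].
pose F := filter_from D (fun s0 => D `&` up s0).
have FF : Filter F.
  apply: filter_from_filter; first by exists [::].
  move=> s1 s2 D1 D2; exists (s1 ++ s2).
    by move=> x; rewrite mem_cat => /orP[/D1|/D2].
  by move=> s [Ds s12]; split; split=> // x xs; apply: s12; rewrite mem_cat xs ?orbT.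
have [|s0 Ds0 h] := cC _ F (fun s x => exists2 y, y \in s & B y x) FF.
  move=> x Cx; exists (B x, D `&` up [:: x]).
    split; first exact: nB.
    by exists [:: x] => // y; rewrite inE => /eqP ->.
  by move=> [x' s] [/= Bx' [_ xs]]; exists x => //; apply: xs; rewrite inE.
exists s0; split=> // x Cx.
by have [|y ys By] := h s0 _ x Cx; [split|exists y].
Qed.

Lemma metrizable_countably_based (R : realType) (T : topologicalType) (C : set T) :
  compact C -> metrizable_set (R := R) C -> countably_based C.
Proof.
move=> cC [d [_ dsym dtri dnbhs]].
pose e n : R := n.+1%:R^-1.
have e0 n : 0 < e n by rewrite invr_gt0.
pose B n (x : T) : set T := [set y | C y -> d x y < e n]°.
have nB n x : C x -> nbhs x [set y | C y -> d x y < e n].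
  by move=> Cx; apply: (dnbhs x [set y | d x y < e n] Cx).2; exists (e n).
have fin n : exists s : seq T, (forall x, x \in s -> C x) /\
    C `<=` \bigcup_(x in [set` s]) B n x.
  by apply: compact_finite_cover => // x Cx; apply: nbhs_interior; exact: nB.
have [s hs] := choice fin.
pose U k : set T := match @unpickle (nat * nat)%type k with
  | Some (n, j) => match onth (s n) j with Some x => B n x | None => set0 end
  | None => set0 end.
exists U; split=> [k|x W Cx xW].
  rewrite /U; case: unpickle => [[n j]|]; last exact: open0.
  by case: onth => [x|]; [exact: open_interior|exact: open0].
have [r r0 hr] : exists2 r : R, 0 < r & forall y, C y -> d x y < r -> W y.
  by apply/(dnbhs x W Cx); apply: filterS xW => y ? _.
have [n hn] := inv_natS_lt (divr_gt0 r0 (@ltr0n R 2)).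
have [y ys Bx] := (hs n).2 x Cx.
have Cy := (hs n).1 y ys.
exists (pickle (n, index y (s n))); rewrite /U pickleK.
rewrite onthE (nth_map y) ?index_mem// nth_index//.
split=> // z [Bz Cz]; apply: hr => //.
have hx : d y x < e n := interior_subset Bx Cx.
have hz : d y z < e n := interior_subset Bz Cz.
have hr2 : e n < r / 2 := hn.
apply: le_lt_trans (dtri x y z Cx Cy Cz) _.
rewrite (dsym x y)//; lra.
Qed.

End CountableBase.

Section Metrizability.
Context {R : realType} {E : lcsType R}.

Lemma continuous_seminorm_cst0 : continuous_seminorm ((fun=> 0) : E -> R).
Proof.
split=> [x y|a x|x]; [by rewrite addr0|by rewrite mulr0|exact: cvg_cst].
Qed.

(** The distance is the supremum over [n] of the minimum of [n.+1%:R^-1] and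
    [q n (x - y)].  It is continuous because the caps tend to 0, and it induces
    the topology because a continuous distance on a compact set does. *)
Lemma seminorm_metrizable (C : set E) (q : nat -> E -> R) : compact C ->
  (forall n, continuous_seminorm (q n)) ->
  (forall x y, C x -> C y -> x <> y -> exists n, 0 < q n (x - y)) ->
  metrizable_set (R := R) C.
Proof.
move=> cC qs qsep.
(* The cap makes the terms of large index harmless for continuity. *)
pose m n x y : R := Num.min n.+1%:R^-1 (q n (x - y)).
have i0 n : 0 < n.+1%:R^-1 :> R by rewrite invr_gt0.
have m0 n x y : 0 <= m n x y by rewrite le_min ltW//= seminorm_ge0.
have mN n x y : m n x y <= n.+1%:R^-1 by rewrite ge_min lexx.
have m1 n x y : m n x y <= 1.
  by rewrite (le_trans (mN _ _ _))// invf_le1// ler1n.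
pose D x y := range (fun n => m n x y).
have hD x y : has_sup (D x y).
  by split; [exists (m 0%N x y), 0%N|exists 1 => _ [n _ <-]].
pose d x y := sup (D x y).
have md n x y : m n x y <= d x y by apply: (ub_le_sup (hD x y).2); exists n.
have dm x y r : (forall n, m n x y <= r) -> d x y <= r.
  by move=> h; apply: (ge_sup (hD x y).1) => _ [n _ <-].
have dxx x : d x x = 0.
  apply/eqP; rewrite eq_le (le_trans (m0 0%N x x) (md _ _ _)) andbT.
  by apply: dm => n; rewrite ge_min subrr seminorm0// lexx orbT.
have dsym x y : d x y = d y x.
  congr sup; apply/seteqP; split=> _ [n _ <-]; exists n => //;
    by rewrite /m -(seminormN _ (qs n)) opprB.
exists d; split=> //.
- move=> x y Cx Cy; split=> [dxy|->//]; apply: contrapT => /(qsep _ _ Cx Cy)[n qn].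
  have : 0 < m n x y by rewrite lt_min i0.
  by rewrite ltNge (le_trans (md n x y))// dxy.
- move=> x y z _ _ _; apply: dm => n.
  apply: (@le_trans _ _ (m n x y + m n y z)); last exact: lerD.
  have [qD _ _] := qs n.
  have h := qD (x - y) (y - z); rewrite addrA subrK in h.
  have a0 := seminorm_ge0 (x - y) (qs n); have b0 := seminorm_ge0 (y - z) (qs n).
  have c0 := ltW (i0 n); rewrite /m; set c := n.+1%:R^-1 in c0 *.
  by rewrite !minEle; do 3 case: ifP => //; move=> *; lra.
- move=> x A Cx; split=> [wA|[e e0 eA]].
  + have : \forall n \near \oo, C `<=`
        (fun y => C y -> d x y < n.+1%:R^-1 -> A y).
      apply: ((compact_near_coveringP _).1 cC _ _
        (fun n y => C y -> d x y < n.+1%:R^-1 -> A y)) => y Cy.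
      have [->|/eqP xy] := eqVneq y x.
        apply: (filterS _ (@filter_prod1 _ _ (nbhs x) \oo _ _ wA)).
        by move=> [z n] /= h Cz _; exact: h.
      have [n qn] := qsep _ _ Cx Cy (nesym xy).
      pose c := Num.min n.+1%:R^-1 (q n (x - y) / 2).
      have c0 : 0 < c by rewrite lt_min i0 divr_gt0.
      have q2 : 0 < q n (x - y) / 2 by rewrite divr_gt0.
      have yz : \forall z \near y, q n (z - y) < q n (x - y) / 2.
        exact: seminorm_lt_nbhs.
      have kc : \forall k \near \oo, k.+1%:R^-1 < c.
        exact: (near_infty_natSinv_lt (PosNum c0)).
      exists ([set z | q n (z - y) < q n (x - y) / 2], [set k | k.+1%:R^-1 < c]) => //.
      move=> [z k] [/= zy kc'] _ dk; exfalso.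
      have : c <= m n x z.
        have [qD _ _] := qs n; have h := qD (x - z) (z - y).
        rewrite addrA subrK in h.
        by rewrite /c /m le_min ge_min lexx /= ge_min; apply/orP; right; lra.
      by move=> /le_trans /(_ (md n x z)) /le_lt_trans /(_ dk); rewrite ltNge ltW.
    move=> /filter_ex[n hn]; exists n.+1%:R^-1 => // y Cy; exact: hn.
  + have e2 : 0 < e / 2 by rewrite divr_gt0.
    have [N hN] := inv_natS_lt e2.
    have near_q : \forall y \near x, forall n : 'I_N, q n (y - x) < e / 2.
      apply: filter_forall => n.
      exact: seminorm_lt_nbhs.
    apply: filterS near_q => y hy Cy; apply: eA => //.
    apply: (@le_lt_trans _ _ (e / 2)); last by lra.
    apply: dm => n; rewrite ge_min; have [nN|Nn] := ltnP n N.
      by rewrite -(seminormN _ (qs n)) opprB (ltW (hy (Ordinal nN))) orbT.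
    by rewrite (le_trans _ (ltW hN))// lef_pV2 ?posrE ?ltr0n// ler_nat.
Qed.

(** Each pair of basic open sets chooses one seminorm that separates their
    images, whenever there is one. *)
Lemma countable_separating_seminorms (X : topologicalType) (S : set X)
    (psi : X -> E) : countably_based S -> {within S, continuous psi} ->
  exists q : nat -> E -> R, (forall n, continuous_seminorm (q n)) /\
    forall x y, S x -> S y -> psi x <> psi y ->
      exists n, 0 < q n (psi x - psi y).
Proof.
move=> [V [oV hV]] /subspace_continuousP psic.
pose good i j (q : E -> R) := continuous_seminorm q /\
  forall x y, V i x -> S x -> V j y -> S y -> 0 < q (psi x - psi y).
pose q n : E -> R := match @unpickle (nat * nat)%type n with
  | Some (i, j) => xget (fun=> 0) (good i j) | None => fun=> 0 end.
exists q; split=> [n|x y Sx Sy /eqP].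
  rewrite /q; case: unpickle => [[i j]|]; last exact: continuous_seminorm_cst0.
  by case: xgetP => [r _ []//|_]; exact: continuous_seminorm_cst0.
rewrite -subr_eq0 => /seminorm_separated[r rs r0].
have [rD _ _] := rs.
have hnear z : S z -> nbhs z
    [set w | S w -> r (psi w - psi z) < r (psi x - psi y) / 2].
  move=> Sz; apply: (psic z Sz [set w | r (w - psi z) < r (psi x - psi y) / 2]).
  by apply: seminorm_lt_nbhs => //; rewrite divr_gt0.
have [i [Vx hi]] := hV _ _ Sx (hnear _ Sx).
have [j [Vy hj]] := hV _ _ Sy (hnear _ Sy).
exists (pickle (i, j)); rewrite /q pickleK.
case: xgetP => [s _ [_ h]|/(_ r) nogood]; first exact: h.
exfalso; apply: nogood; split=> // x' y' Vx' Sx' Vy' Sy'.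
have hx := hi _ (conj Vx' Sx') Sx'; have hy := hj _ (conj Vy' Sy') Sy'.
have h1 := rD (psi x - psi x') (psi x' - psi y).
have h2 := rD (psi x' - psi y') (psi y' - psi y).
rewrite addrA subrK in h1; rewrite addrA subrK in h2.
have h3 : r (psi x - psi x') = r (psi x' - psi x).
  by rewrite -(seminormN _ rs) opprB.
move: hx hy => /= hx hy; lra.
Qed.

End Metrizability.

Lemma subset_metrizable (R : realType) (X : topologicalType) (E : lcsType R)
    (S : set X) (psi : X -> E) (C : set E) :
  countably_based S -> {within S, continuous psi} ->
  compact C -> C `<=` psi @` S -> metrizable_set (R := R) C.
Proof.
move=> bS psic cC CS.
have [q [qs qsep]] := countable_separating_seminorms bS psic.
apply: (@seminorm_metrizable _ _ _ q) => // _ _ /CS[x Sx <-] /CS[y Sy <-].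
exact: qsep.
Qed.

Section Pieces.
Context {R : realType}.
Implicit Types E F : lcsType R.

(** What the Borel sets and the Lebesgue measurable sets of the line have in
    common for the arguments below. *)
Definition sigma_lattice (S : set (set R)) :=
  [/\ forall U, open U -> S U, forall A B, S A -> S B -> S (A `&` B) &
      forall F : nat -> set R, (forall n, S (F n)) -> S (\bigcup_n F n)].

(** A function in L^oo_rc has one piece for the Borel sets, a Lusin measurable
    function countably many up to a null set. *)
Definition piece (S : set (set R)) E (A : set R) (f : R -> E) (C : set E) :=
  [/\ compact C, countably_based C, f @` A `<=` C &
      forall W, open W -> S (A `&` f @^-1` W)].

Lemma piece_dom S E A (f : R -> E) C : piece S A f C -> S A.
Proof. by move=> [_ _ _ /(_ setT openT)]; rewrite preimage_setT setIT. Qed.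

Lemma pieceS S E A A' (f : R -> E) C : sigma_lattice S -> S A' -> A' `<=` A ->
  piece S A f C -> piece S A' f C.
Proof.
move=> [_ SI _] SA' A'A [cC bC fC Sf]; split => //.
  by move=> _ [t At <-]; apply: fC; exists t => //; exact: A'A.
by move=> W oW; rewrite -(setIidl A'A) -setIA; apply: SI => //; exact: Sf.
Qed.

(** The preimage of an open set is the union of the preimages of the countably
    many basic rectangles whose trace it contains. *)
Lemma piece_pair S E F A (f : R -> E) (g : R -> F) C D : sigma_lattice S ->
  piece S A f C -> piece S A g D ->
  piece S A (fun t => (f t, g t) : (E * F)%type) (C `*` D).
Proof.
move=> [So SI SU] [cC bC fC Sf] [cD bD gD Sg]; split.
- exact: compact_setX.
- exact: countably_based_prod.
- by move=> _ [t At <-]; split; [apply: fC; exists t|apply: gD; exists t].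
move=> W oW; have [V [oV hV]] := bC; have [U [oU hU]] := bD.
pose G k : set R := match @unpickle (nat * nat)%type k with
  | Some (i, j) => if `[< (V i `&` C) `*` (U j `&` D) `<=` W >] then
      (A `&` f @^-1` V i) `&` (A `&` g @^-1` U j) else set0
  | None => set0 end.
have S0 : S set0 by apply: So; exact: open0.
rewrite (_ : _ `&` _ = \bigcup_k G k).
  apply: SU => k; rewrite /G; case: unpickle => [[i j]|//].
  by case: ifP => // _; apply: SI; [exact: Sf|exact: Sg].
apply/seteqP; split=> [t [At Wt]|t [k _]]; last first.
  rewrite /G; case: unpickle => [[i j]|//]; case: ifP => // /asboolP VU.
  move=> [[At Vt] [_ Ut]]; split=> //; apply: VU; split; split => //=.
    by apply: fC; exists t.
  by apply: gD; exists t.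
have Cft : C (f t) by apply: fC; exists t.
have Dgt : D (g t) by apply: gD; exists t.
have : nbhs (f t, g t) W by apply: open_nbhs_nbhs.
move=> [[/= P Q] [fP gQ] PQ].
have [i [Vi hi]] := hV _ _ Cft fP; have [j [Uj hj]] := hU _ _ Dgt gQ.
exists (pickle (i, j)) => //; rewrite /G pickleK ifT//.
by apply/asboolP => -[x y] [/= /hi Px /hj Qy]; exact: PQ.
Qed.

(** The image [B @` (K `*` C)] is metrizable, as a compact image of a countably
    based set, even if [F] is not. *)
Lemma piece_comp S E F A K (f : R -> E) C (B : R * E -> F) : sigma_lattice S ->
  compact K -> A `<=` K -> {within K `*` [set: E], continuous B} ->
  piece S A f C -> piece S A (fun t => B (t, f t)) (B @` (K `*` C)).
Proof.
move=> [So SI SU] cK AK Bc [cC bC fC Sf].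
have Bc' : {within K `*` C, continuous B}.
  by apply: continuous_subspaceW Bc => -[x y] [].
have bKC : countably_based (K `*` C).
  by apply: countably_based_prod => //; exact: countably_based_real.
have cim : compact (B @` (K `*` C)).
  by apply: continuous_compact => //; exact: compact_setX.
split => //.
- exact: metrizable_countably_based cim (subset_metrizable bKC Bc' cim (@subset_refl _ _)).
- move=> _ [t At <-]; exists (t, f t) => //; split; first exact: AK.
  by apply: fC; exists t.
move=> W oW; have [V [oV hV]] := bC.
have [U [oU hU]] := @countably_based_real R A.
pose G k : set R := match @unpickle (nat * nat)%type k with
  | Some (i, j) => if `[< forall t v, U i t -> A t -> V j v -> C v ->
        W (B (t, v)) >] then (A `&` f @^-1` V j) `&` U i else set0
  | None => set0 end.
have S0 : S set0 by apply: So; exact: open0.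
rewrite (_ : _ `&` _ = \bigcup_k G k).
  apply: SU => k; rewrite /G; case: unpickle => [[i j]|//].
  by case: ifP => // _; apply: SI; [exact: Sf|exact: So].
apply/seteqP; split=> [t [At Wt]|t [k _]]; last first.
  rewrite /G; case: unpickle => [[i j]|//]; case: ifP => // /asboolP VU.
  move=> [[At Vt] Ut]; split=> //; apply: VU => //.
  by apply: fC; exists t.
have Cft : C (f t) by apply: fC; exists t.
move/subspace_continuousP : Bc' => /(_ (t, f t) (conj (AK _ At) Cft)) Bt.
have := Bt W (open_nbhs_nbhs (conj oW Wt)) => -[[/= P Q] [tP fQ] PQ].
have [i [Ui hi]] := hU _ _ At tP; have [j [Vj hj]] := hV _ _ Cft fQ.
exists (pickle (i, j)) => //; rewrite /G pickleK ifT//.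
apply/asboolP => s v Us As Vv Cv; apply: (PQ (s, v)).
  by split; [exact: hi|exact: hj].
by split=> //; exact: AK.
Qed.

End Pieces.

(** * Measurability of vector-valued functions *)

(** The line with its Lebesgue measurable sets. *)
Notation lebR R := (caratheodory_type (@wlength R idfun)^*%mu).

Section LebesgueMeasurableSets.
Context {R : realType}.

Definition lmeas (A : set R) : Prop := @measurable _ (lebR R) A.

Lemma lmeas_bigcup (F : nat -> set R) : (forall n, lmeas (F n)) -> lmeas (\bigcup_n F n).
Proof. by move=> h; apply: bigcupT_measurable. Qed.

Lemma lmeasI A B : lmeas A -> lmeas B -> lmeas (A `&` B).
Proof. exact: measurableI. Qed.

Lemma lmeasD A B : lmeas A -> lmeas B -> lmeas (A `\` B).
Proof. exact: measurableD. Qed.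

Lemma lmeasU A B : lmeas A -> lmeas B -> lmeas (A `|` B).
Proof. exact: measurableU. Qed.

Lemma borel_lmeas (A : set R) : @measurable _ (measurableTypeR R) A -> lmeas A.
Proof. exact: sub_caratheodory. Qed.

Lemma open_lmeas (A : set R) : open A -> lmeas A.
Proof. by move=> oA; apply: borel_lmeas; exact: open_measurable. Qed.

Lemma itv_lmeas (i : interval R) : lmeas [set` i].
Proof. by apply: borel_lmeas; exact: measurable_itv. Qed.

Lemma leb_le (A B : set R) : A `<=` B -> (leb A <= leb B)%E.
Proof. by move=> AB; exact: (@le_outer_measure R _ (@wlength R idfun)^*%mu). Qed.

Lemma leb_null_subset (A B : set R) : A `<=` B -> leb B = 0%E -> leb A = 0%E.
Proof.
move=> AB B0; apply/eqP; rewrite eq_le outer_measure_ge0 andbT -B0.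
exact: leb_le.
Qed.

Lemma null_lmeas (A : set R) : leb A = 0%E -> lmeas A.
Proof.
move=> A0; apply: le_caratheodory_measurable => /= X.
apply: (@le_trans _ _ (leb A + leb (X `&` ~` A))%E).
  by rewrite leeD2r// le_outer_measure//; exact: subIsetr.
by rewrite A0 add0e// le_outer_measure//; exact: subIsetl.
Qed.

Lemma leb_null_setU (A B : set R) : leb A = 0%E -> leb B = 0%E -> leb (A `|` B) = 0%E.
Proof.
move=> A0 B0; apply/eqP; rewrite eq_le outer_measure_ge0 andbT.
apply: (le_trans (outer_measureU2 (@wlength R idfun)^*%mu _ _)).
by rewrite [X in (X + _)%E]A0 [X in (_ + X)%E]B0 adde0.
Qed.

Lemma null_bigcup (F : nat -> set R) : (forall n, leb (F n) = 0%E) ->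
  leb (\bigcup_n F n) = 0%E.
Proof.
move=> F0; apply/eqP; rewrite eq_le outer_measure_ge0 andbT.
apply: (le_trans (outer_measure_sigma_subadditive (@wlength R idfun)^*%mu F)).
by rewrite eseries0// => i _ _; exact: F0.
Qed.

Lemma sigma_lattice_lmeas : sigma_lattice lmeas.
Proof.
by split=> [U|A B|F]; [exact: open_lmeas|exact: lmeasI|exact: lmeas_bigcup].
Qed.

Lemma sigma_lattice_borel : sigma_lattice (@measurable _ (measurableTypeR R)).
Proof.
by split=> [U|A B|F]; [exact: open_measurable|exact: measurableI|exact: bigcupT_measurable].
Qed.

Lemma lmeasurable_fun (A : set R) (f : R -> R) :
  (forall W : set R, open W -> lmeas (A `&` f @^-1` W)) ->
  measurable_fun (A : set (lebR R)) f.
Proof.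
move=> h; apply: (measurability _ (RGenOpens.measurableE R)).
by move=> _ [_ [x [y ->]] <-]; apply: h; exact: interval_open.
Qed.

Lemma leb_itv (a b : R) : a <= b -> leb `[a, b] = (b - a)%:E.
Proof.
move=> ab; have := @lebesgue_measure_itv R `[a, b]; rewrite /= lte_fin.
case: ltP => [_|ba] h; first by rewrite EFinB.
have -> : b - a = 0 by lra.
exact: h.
Qed.

End LebesgueMeasurableSets.

Section StronglyMeasurable.
Context {R : realType}.
Implicit Types E F : lcsType R.

(** Implied both by Lusin measurability and by the measurability required in
    L^oo_rc. *)
Definition strongly_measurable E (a b : R) (f : R -> E) :=
  exists (A : nat -> set R) (C : nat -> set E),
    (forall n, piece lmeas (A n) f (C n) /\ A n `<=` `[a, b]) /\
    leb (`[a, b] `\` \bigcup_n A n) = 0%E.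

Lemma strongly_measurable_comp_real E a b (f : R -> E) (phi : E -> R) :
  strongly_measurable a b f -> continuous phi ->
  measurable_fun (`[a, b] : set (lebR R)) (phi \o f).
Proof.
move=> [A [C [fA N0]]] phic; apply: lmeasurable_fun => W oW.
rewrite (_ : _ `&` _ = (\bigcup_n (A n `&` f @^-1` (phi @^-1` W))) `|`
    ((`[a, b] `\` \bigcup_n A n) `&` (phi \o f) @^-1` W)).
  apply: lmeasU.
    apply: lmeas_bigcup => n; have [[_ _ _ h] _] := fA n.
    by apply: h; apply: open_comp => // x _; exact: phic.
  by apply: null_lmeas; exact: leb_null_subset N0.
apply/seteqP; split=> t.
  move=> [abt Wt]; have [[n _ An]|nA] := pselect ((\bigcup_n A n) t).
    by left; exists n.
  by right.
by move=> [[n _ [An Wt]]|[[abt _] Wt]]; split => //; exact: (fA n).2.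
Qed.

Lemma Linfrc_piece E a b (f : R -> E) : Lfunctions Linfrc a b f <->
  exists C, piece (@measurable _ (measurableTypeR R)) `[a, b] f C.
Proof.
split=> [[mf cf Mf]|[C [cC bC fC mf]]].
  exists (closure (f @` `[a, b])); split=> //.
  - exact: metrizable_countably_based Mf.
  - exact: subset_closure.
  - by move=> W oW; apply: mf; exact: sub_sigma_algebra.
have clC : closure (f @` `[a, b]) `<=` C.
  rewrite [X in _ `<=` X](closure_id _).1; first exact: closure_subset.
  by apply: compact_closed => //; exact: lcs_hausdorff.
have cc : compact (closure (f @` `[a, b])).
  exact: subclosed_compact (@closed_closure _ _) cC clC.
split=> //.
- have mI : @measurable _ (measurableTypeR R) `[a, b] by exact: measurable_itv.
  apply: (@smallest_sub _ _ _
    [set B | @measurable _ (measurableTypeR R) (`[a, b] `&` f @^-1` B)]) => //.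
  split=> [|B mB|F mF] /=.
  + by rewrite preimage_set0 setI0; exact: measurable0.
  + rewrite (_ : _ `&` _ = `[a, b] `\` (`[a, b] `&` f @^-1` B)).
      exact: measurableD.
    apply/seteqP; split=> t; first by move=> [? [_ nB]]; split=> // -[].
    by move=> [abt nB]; split=> //; split=> // Bt; apply: nB.
  + by rewrite preimage_bigcup setI_bigcupr; exact: bigcupT_measurable.
- have bcl : countably_based (closure (f @` `[a, b])) by exact: countably_basedS bC.
  apply: (@subset_metrizable R _ _ _ id _ bcl _ cc); last by rewrite image_id.
  by apply: continuous_subspaceT => x; exact: cvg_id.
Qed.

(** A compact subset of the line is countably based, so its continuous images
    are metrizable. *)
Lemma lusin_strongly_measurable E a b (f : R -> E) :
  lusin_measurable a b f -> strongly_measurable a b f.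
Proof.
move=> /(_ _ (@segment_compact R a b) (@subset_refl _ _))[K [cK fK N0]].
exists K, (fun n => f @` K n); split=> // n; split; last exact: (cK n).2.
have bK : countably_based (K n) by exact: countably_based_real.
have cfK : compact (f @` K n) by apply: continuous_compact => //; exact: (cK n).1.
split=> //.
  exact: metrizable_countably_based cfK (subset_metrizable bK (fK n) cfK (@subset_refl _ _)).
move=> W oW; have /continuousP/(_ W oW)/open_subspaceP[V oV VK] := fK n.
rewrite setIC -VK; apply: lmeasI; first exact: open_lmeas.
apply: borel_lmeas; apply: compact_measurable; exact: (cK n).1.
Qed.

Lemma Lfunctions_strongly_measurable k E a b (f : R -> E) :
  Lfunctions k a b f -> strongly_measurable a b f.
Proof.
case: k => [p p1 [+ _]|/Linfrc_piece[C pC]]; first exact: lusin_strongly_measurable.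
exists (fun=> `[a, b]%classic), (fun=> C); split=> [n|].
  split=> //; have [? ? ? h] := pC; split=> // W oW.
  by apply: borel_lmeas; exact: h.
rewrite (_ : _ `\` _ = set0) ?outer_measure0//.
by rewrite -subset0 => x [Kx]; apply; exists 0%N.
Qed.

Lemma strongly_measurable_pair E F a b (f : R -> E) (g : R -> F) :
  strongly_measurable a b f -> strongly_measurable a b g ->
  strongly_measurable a b (fun t => (f t, g t) : (E * F)%type).
Proof.
move=> [A [C [fA NA]]] [B [D [gB NB]]].
pose AB k := match @unpickle (nat * nat)%type k with
  | Some (i, j) => A i `&` B j | None => set0 end.
pose CD k : set (E * F) := match @unpickle (nat * nat)%type k with
  | Some (i, j) => C i `*` D j | None => set0 end.
exists AB, CD; split=> [k|].
  rewrite /AB /CD; case: unpickle => [[i j]|]; last first.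
    split=> //; split; first exact: compact0.
    + by exists (fun=> set0); split=> [_|x W []]; exact: open0.
    + by rewrite image_set0.
    + by move=> W _; rewrite set0I; exact: open_lmeas open0.
  have [pA Aab] := fA i; have [pB Bab] := gB j.
  split; last by apply: subset_trans Aab; exact: subIsetl.
  have sl := @sigma_lattice_lmeas R.
  have mAB : lmeas (A i `&` B j).
    by apply: lmeasI; [exact: (piece_dom pA)|exact: (piece_dom pB)].
  apply: piece_pair => //.
    exact: (pieceS sl mAB (@subIsetl _ _ _) pA).
  exact: (pieceS sl mAB (@subIsetr _ _ _) pB).
have N0 : leb ((`[a, b] `\` \bigcup_n A n) `|` (`[a, b] `\` \bigcup_n B n)) = 0%E.
  exact: leb_null_setU.
apply: leb_null_subset N0 => t [abt nt].
have [[i _ At]|nA] := pselect ((\bigcup_n A n) t); last by left.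
right; split=> // -[j _ Bt]; apply: nt; exists (pickle (i, j)) => //.
by rewrite /AB pickleK.
Qed.

End StronglyMeasurable.

(** * Stability of the Lebesgue function spaces *)

Section LfunctionsClosure.
Context {R : realType}.
Implicit Types E F : lcsType R.

Lemma le_integrable_real (A : set R) (f g : R -> R) : lmeas A ->
  measurable_fun (A : set (lebR R)) f ->
  (forall t, A t -> `|f t| <= g t) ->
  leb.-integrable A (EFin \o g) -> leb.-integrable A (EFin \o f).
Proof.
move=> mA mf fg; apply: le_integrable => //; first exact/measurable_EFinP.
by move=> t At; rewrite /= lee_fin (le_trans (fg _ At))// ler_norm.
Qed.

Lemma leb_itv_lty (a b : R) : (leb `[a, b] < +oo)%E.
Proof.
have [ab|ba] := leP a b; first by rewrite leb_itv// ltry.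
by rewrite set_itv_ge ?measure0// bnd_simp -ltNge.
Qed.

Lemma bounded_integrable_itv (a b M : R) (f : R -> R) :
  measurable_fun (`[a, b] : set (lebR R)) f ->
  (forall t, t \in `[a, b] -> `|f t| <= M) ->
  leb.-integrable `[a, b] (EFin \o f).
Proof.
move=> mf fM; apply: measurable_bounded_integrable => //.
- exact: itv_lmeas.
- exact: leb_itv_lty.
- exists M; split; first exact: num_real.
  by move=> N MN t /= /fM /le_trans; apply; exact: ltW.
Qed.

Lemma integrable_cst_itv (a b c : R) : leb.-integrable `[a, b] (fun=> c%:E).
Proof.
apply: (@bounded_integrable_itv _ _ `|c| (fun=> c)) => //.
Qed.

Lemma measurable_powR_itv (A : set R) (p : R) (f : R -> R) :
  measurable_fun (A : set (lebR R)) f ->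
  measurable_fun (A : set (lebR R)) (fun t => f t `^ p).
Proof. by move=> mf; apply: (measurableT_comp (measurable_powR p)). Qed.

Lemma powR_le (p x y : R) : 0 <= p -> 0 <= x -> x <= y -> x `^ p <= y `^ p.
Proof.
by move=> p0 x0 xy; apply: ge0_ler_powR => //; rewrite nnegrE// (le_trans x0).
Qed.

Lemma powRD_le (p x y : R) : 0 <= p -> 0 <= x -> 0 <= y ->
  (x + y) `^ p <= 2 `^ p * (x `^ p + y `^ p).
Proof.
move=> p0 x0 y0; wlog xy : x y x0 y0 / x <= y.
  move=> h; have [xy|/ltW yx] := leP x y; first exact: h.
  by rewrite addrC [_ `^ p + _]addrC; exact: h.
apply: (@le_trans _ _ ((2 * y) `^ p)).
  by apply: powR_le => //; [exact: addr_ge0|lra].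
by rewrite powRM// ler_wpM2l ?powR_ge0// lerDr powR_ge0.
Qed.

Lemma le_1DpowR (p x : R) : 1 <= p -> 0 <= x -> x <= 1 + x `^ p.
Proof.
move=> p1 x0; have [x1|/ltW x1] := leP x 1.
  by rewrite (le_trans x1)// lerDl powR_ge0.
apply: (@le_trans _ _ (x `^ p)); last by rewrite lerDr.
by rewrite -{1}(powRr1 x0) ler_powR.
Qed.

Lemma seminorm_measurable E a b (f : R -> E) (q : E -> R) :
  strongly_measurable a b f -> continuous_seminorm q ->
  measurable_fun (`[a, b] : set (lebR R)) (q \o f).
Proof. by move=> mf [_ _ qc]; exact: strongly_measurable_comp_real. Qed.

Lemma Lfunctions_integrable_seminorm k E a b (f : R -> E) (q : E -> R) :
  Lfunctions k a b f -> continuous_seminorm q ->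
  leb.-integrable `[a, b] (EFin \o q \o f).
Proof.
move=> fk qs; have mf := Lfunctions_strongly_measurable fk.
have mq := seminorm_measurable mf qs.
have q0 t : 0 <= q (f t) by exact: seminorm_ge0.
case: k fk => [p p1 [_ /(_ q qs) h]|[_ cf _]].
  apply: (@le_integrable_real _ (q \o f) (fun t => 1 + q (f t) `^ p)) => //.
  - exact: itv_lmeas.
  - by move=> t _; rewrite /= ger0_norm// le_1DpowR.
  - have := integrableD (itv_lmeas _) (integrable_cst_itv a b 1) h.
    exact.
have qc : continuous q by case: qs.
have : compact (q @` closure (f @` `[a, b])).
  by apply: continuous_compact => //; exact: continuous_subspaceT.
move=> /compact_bounded[M [_ hM]].
apply: (@bounded_integrable_itv _ _ (M + 1)) => // t abt.
apply: hM; first by rewrite ltrDl.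
by exists (f t) => //; apply: subset_closure; exists t.
Qed.

Lemma Lfunctions_pair k E F a b (f : R -> E) (g : R -> F) :
  Lfunctions k a b f -> Lfunctions k a b g ->
  Lfunctions k a b (fun t => (f t, g t) : (E * F)%type).
Proof.
case: k => [p p1 [fl fi] [gl gi]|]; last first.
  move=> /Linfrc_piece[C pC] /Linfrc_piece[D pD]; apply/Linfrc_piece.
  by exists (C `*` D); apply: piece_pair => //; exact: sigma_lattice_borel.
have p0 : 0 <= p by rewrite (le_trans ler01).
have fgl : lusin_measurable a b (fun t => (f t, g t) : (E * F)%type).
  move=> K cK Kab; have [A [cA fA NA]] := fl K cK Kab.
  have [B [cB gB NB]] := gl K cK Kab.
  pose AB k := match @unpickle (nat * nat)%type k with
    | Some (i, j) => A i `&` B j | None => set0 end.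
  exists AB; split=> [k|k|].
  - rewrite /AB; case: unpickle => [[i j]|]; last by split=> //; exact: compact0.
    split; last by apply: subset_trans (cA i).2; exact: subIsetl.
    apply: compact_closedI; first exact: (cA i).1.
    by apply: compact_closed; [exact: Rhausdorff|exact: (cB j).1].
  - rewrite /AB; case: unpickle => [[i j]|]; last exact: continuous_subspace0.
    apply/subspace_continuousP => x [Ax Bx]; apply: cvg_pair.
    + have /subspace_continuousP/(_ x Ax) := fA i.
      by apply: cvg_trans; apply: cvg_app; apply: within_subset => y [].
    + have /subspace_continuousP/(_ x Bx) := gB j.
      by apply: cvg_trans; apply: cvg_app; apply: within_subset => y [].
  - have N0 : leb ((K `\` \bigcup_n A n) `|` (K `\` \bigcup_n B n)) = 0%E.
      apply/eqP; rewrite eq_le outer_measure_ge0 andbT.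
      apply: (le_trans (outer_measureU2 (@wlength R idfun)^*%mu _ _)).
      by rewrite [X in (X + _)%E]NA [X in (_ + X)%E]NB adde0.
    apply: leb_null_subset N0 => t [abt nt].
    have [[i _ At]|nA] := pselect ((\bigcup_n A n) t); last by left.
    right; split=> // -[j _ Bt]; apply: nt; exists (pickle (i, j)) => //.
    by rewrite /AB pickleK.
split=> // q qs; have [qD qZ qc] := qs.
have q1s : continuous_seminorm (fun x : E => q (x, 0)).
  split=> [x y|c x|x].
  - have -> : ((x + y, 0) : (E * F)%type) = (x, 0) + (y, 0).
      by congr pair; rewrite addr0.
    exact: qD.
  - have -> : ((c *: x, 0) : (E * F)%type) = c *: (x, 0).
      by congr pair; rewrite scaler0.
    exact: qZ.
  apply: (@cvg_comp _ _ _ (fun x : E => (x, 0 : F)) q); last exact: qc.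
  by apply: cvg_pair; [exact: cvg_id|exact: cvg_cst].
have q2s : continuous_seminorm (fun x : F => q (0, x)).
  split=> [x y|c x|x].
  - have -> : ((0, x + y) : (E * F)%type) = (0, x) + (0, y).
      by congr pair; rewrite addr0.
    exact: qD.
  - have -> : ((0, c *: x) : (E * F)%type) = c *: (0, x).
      by congr pair; rewrite scaler0.
    exact: qZ.
  apply: (@cvg_comp _ _ _ (fun x : F => (0 : E, x)) q); last exact: qc.
  by apply: cvg_pair; [exact: cvg_cst|exact: cvg_id].
pose h t := q (f t, 0) `^ p + q (0, g t) `^ p.
apply: (@le_integrable_real _ (fun t => q (f t, g t) `^ p) (fun t => 2 `^ p * h t)).
- exact: itv_lmeas.
- apply: measurable_powR_itv.
  exact: (seminorm_measurable (lusin_strongly_measurable fgl) qs).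
- move=> t _; rewrite ger0_norm ?powR_ge0//.
  apply: le_trans (powRD_le p0 _ _); [|exact: (seminorm_ge0 _ q1s)|exact: (seminorm_ge0 _ q2s)].
  apply: powR_le => //; first exact: seminorm_ge0.
  have {1}-> : ((f t, g t) : (E * F)%type) = (f t, 0) + (0, g t).
    by congr pair; rewrite ?addr0 ?add0r.
  exact: qD.
- have := integrableZl (itv_lmeas _) (2 `^ p) (integrableD (itv_lmeas _) (fi _ q1s) (gi _ q2s)).
  exact.
Qed.

Lemma lusin_comp E F a b (f : R -> E) (B : R * E -> F) :
  {within `[a, b] `*` [set: E], continuous B} ->
  lusin_measurable a b f -> lusin_measurable a b (fun t => B (t, f t)).
Proof.
move=> Bc fl K cK Kab; have [A [cA fA NA]] := fl K cK Kab.
exists A; split=> // n; apply/subspace_continuousP => t At.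
have /subspace_continuousP/(_ t At) ft := fA n.
have abt : `[a, b]%classic t by apply: Kab; exact: (cA n).2.
move/subspace_continuousP : Bc => /(_ (t, f t) (conj abt I)) Bt.
move=> W /Bt [[/= P Q] [tP fQ] PQ].
have h1 : \forall s \near t, A n s -> Q (f s) by exact: (ft _ fQ).
have : \forall s \near t, A n s -> W (B (s, f s)).
  apply: filterS2 tP h1 => s Ps h As; apply: (PQ (s, f s)).
    by split=> //; exact: h.
  by split=> //; apply: Kab; exact: (cA n).2.
exact.
Qed.

Lemma Lfunctions_comp k E F a b (f : R -> E) (B : R * E -> F) :
  {within `[a, b] `*` [set: E], continuous B} ->
  (forall q, continuous_seminorm q -> exists2 Q : E -> R, continuous_seminorm Q &
     forall t v, t \in `[a, b] -> q (B (t, v)) <= Q v) ->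
  Lfunctions k a b f -> Lfunctions k a b (fun t => B (t, f t)).
Proof.
move=> Bc Bq; case: k => [p p1 [fl fi]|]; last first.
  move=> /Linfrc_piece[C pC]; apply/Linfrc_piece; exists (B @` (`[a, b] `*` C)).
  by apply: piece_comp pC => //; [exact: sigma_lattice_borel|exact: segment_compact].
have p0 : 0 <= p by rewrite (le_trans ler01).
have hl := lusin_comp Bc fl; split=> // q qs.
have [Q Qs qQ] := Bq q qs.
apply: (@le_integrable_real _ (fun t => q (B (t, f t)) `^ p) (fun t => Q (f t) `^ p)).
- exact: itv_lmeas.
- apply: measurable_powR_itv.
  exact: (seminorm_measurable (lusin_strongly_measurable hl) qs).
- move=> t abt; rewrite ger0_norm ?powR_ge0//; apply: powR_le => //.
    exact: seminorm_ge0.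
  exact: qQ.
- exact: fi.
Qed.

Lemma strongly_measurable_comp E F a b (f : R -> E) (B : R * E -> F) :
  {within `[a, b] `*` [set: E], continuous B} ->
  strongly_measurable a b f -> strongly_measurable a b (fun t => B (t, f t)).
Proof.
move=> Bc [A [C [fA N0]]].
exists A, (fun n => B @` (`[a, b] `*` C n)); split=> // n.
have [pA Aab] := fA n; split=> //.
by apply: piece_comp pA => //; [exact: sigma_lattice_lmeas|exact: segment_compact].
Qed.

Lemma itv_subset (a b c d : R) : a <= c -> d <= b -> `[c, d] `<=` `[a, b].
Proof.
move=> ac db t /=; rewrite !in_itv/= => /andP[ct td].
by rewrite (le_trans ac)//= (le_trans td).
Qed.

Lemma Lfunctions_restrict k E a b c d (f : R -> E) : a <= c -> d <= b ->
  Lfunctions k a b f -> Lfunctions k c d f.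
Proof.
move=> ac db; have sub := itv_subset ac db; case: k => [p p1 [fl fi]|].
  split=> [K cK Kcd|q qs]; first by apply: fl => //; exact: subset_trans sub.
  by apply: integrableS (fi q qs) => //; exact: itv_lmeas.
move=> /Linfrc_piece[C pC]; apply/Linfrc_piece; exists C.
by apply: pieceS sub pC; [exact: sigma_lattice_borel|exact: measurable_itv].
Qed.

End LfunctionsClosure.

(** * Uniqueness of densities *)

Section ZeroPrimitive.
Context {R : realType}.
Variables (a b : R) (u : R -> R).
Hypothesis ui : leb.-integrable `[a, b] (EFin \o u).
Hypothesis u0 : forall t, t \in `[a, b] ->
  (\int[leb]_(s in `[a, t]) (u s)%:E = 0)%E.

Let g : lebR R -> \bar R := (EFin \o u) \_ `[a, b].

Let gi : leb.-integrable [set: lebR R] g.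
Proof. by apply/(integrable_mkcond _ (itv_lmeas _)). Qed.

Let nu (B : set R) : \bar R := induced_charge gi B.

Let nuE B : lmeas B -> nu B = (\int[leb]_(t in B `&` `[a, b]) (u t)%:E)%E.
Proof. by move=> mB; rewrite /nu /induced_charge/= -integral_mkcondr. Qed.

Let nuT : nu setT = 0%E.
Proof.
rewrite nuE; last exact: measurableT.
rewrite setTI; have [ab|ba] := leP a b.
  by apply: u0; rewrite in_itv/= ab lexx.
by rewrite set_itv_ge ?integral_set0// bnd_simp -ltNge.
Qed.

Let nuC B : lmeas B -> nu (~` B) = (- nu B)%E.
Proof.
move=> mB; have h := chargeD (induced_charge gi) measurableT mB.
rewrite setTI setTD in h.
by rewrite [LHS]h [X in (X - _)%E](_ : _ = 0%E) ?sub0e//; exact: nuT.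
Qed.

Let nu_ray x : nu `]x, +oo[ = 0%E.
Proof.
rewrite -setCitvl nuC; last exact: itv_lmeas.
rewrite nuE; last exact: itv_lmeas.
have [xa|ax] := ltP x a.
  rewrite (_ : _ `&` _ = set0) ?integral_set0 ?oppe0//.
  apply/seteqP; split=> // t [/=]; rewrite !in_itv/= => tx /andP[at_ _].
  by have := lt_le_trans xa at_; rewrite ltNge tx.
have [xb|bx] := leP x b.
  rewrite (_ : _ `&` _ = `[a, x]%classic) ?u0 ?oppe0 ?in_itv/= ?ax//.
  apply/seteqP; split=> t /=; rewrite !in_itv/=.
    by move=> [-> /andP[->]].
  by move=> /andP[-> tx]; rewrite tx (le_trans tx).
rewrite (_ : _ `&` _ = setT `&` `[a, b]%classic).
  by rewrite -nuE ?nuT ?oppe0//; exact: measurableT.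
apply/seteqP; split=> t /=; rewrite !in_itv/=.
  by move=> [].
by move=> [_ /andP[at_ tb]]; rewrite at_ tb (le_trans tb)//; exact: ltW.
Qed.

Let nu_borel B : @measurable _ (measurableTypeR R) B -> nu B = 0%E.
Proof.
pose H : set (set R) := [set B | lmeas B /\ nu B = 0%E].
suff h : (@measurable _ (measurableTypeR R)) `<=` H by move=> /h[].
have -> : (@measurable _ (measurableTypeR R)) = <<s @RGenOInfty.G R >>.
  exact: RGenOInfty.measurableE.
rewrite -setI_closed_g_dynkin_g_sigma_algebra; last first.
  move=> _ _ [x ->] [y ->]; exists (Num.max x y).
  apply/seteqP; split=> t /=; rewrite !in_itv/= !andbT gt_max.
    by move=> [-> ->].
  by move=> /andP[].
apply: smallest_sub; last first.
  by move=> _ [x ->]; split; [exact: itv_lmeas|exact: nu_ray].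
split.
- by split; [exact: measurableT|exact: nuT].
- move=> A [mA A0]; split; first exact: measurableC.
  by rewrite nuC// A0 oppe0.
- move=> F tF HF; split; first by apply: lmeas_bigcup => n; exact: (HF n).1.
  have mF n : lmeas (F n) by exact: (HF n).1.
  have := @charge_semi_sigma_additive _ _ _ (induced_charge gi) F mF tF
    (lmeas_bigcup mF).
  have -> : (fun n => (\sum_(0 <= i < n) induced_charge gi (F i))%E) = fun=> 0%E.
    by apply/funext => n; rewrite big1// => i _; exact: (HF i).2.
  by move=> h; apply/esym; apply: (cvg_unique _ _ h) => //; exact: cvg_cst.
Qed.

(** The set function sending [B] to the integral of [u] over [B] vanishes on
    rays, hence on Borel sets; the set where [u] is positive is Borel up to a
    null set. *)
Lemma zero_primitive_pos : leb [set t | t \in `[a, b] /\ 0 < u t] = 0%E.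
Proof.
have mu : measurable_fun (`[a, b] : set (lebR R)) u.
  by apply/measurable_EFinP; exact: (measurable_int _ ui).
set P := [set t | _].
have mP : lmeas P.
  have -> : P = `[a, b] `&` u @^-1` `]0, +oo[.
    apply/seteqP; split=> t /=; rewrite !in_itv/= andbT.
      by move=> [].
    by move=> [].
  by apply: mu => //; exact: itv_lmeas.
have : lmeas P by [].
rewrite /lmeas -(@completed_caratheodory_measurable R).
rewrite g_sigma_completed_algebra_genE => -[A mA [N [N' [mN' N0 NN']] PE]].
have lA : lmeas A by exact: borel_lmeas.
have AP : A `<=` P by rewrite -PE; exact: subsetUl.
have A0 : leb A = 0%E.
  have h := nu_borel mA; rewrite nuE// in h.
  rewrite (_ : A `&` _ = A) in h; last by apply/setIidl => t /AP[].
  have mu' : measurable_fun (A : set (lebR R)) (EFin \o u).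
    apply/measurable_EFinP; apply: measurable_funS mu; first exact: itv_lmeas.
    by move=> t /AP[].
  have : (\int[leb]_(t in A) `|(u t)%:E| = 0)%E.
    rewrite -h; apply: eq_integral => t /set_mem /AP[_ ut].
    by rewrite gee0_abs// lee_fin ltW.
  move/(ae_eq_integral_abs leb lA mu') => [M [mM M0 AM]].
  apply: leb_null_subset M0 => t At; apply: AM => /= /(_ At) [ut].
  by have [_] := AP _ At; rewrite ut ltxx.
apply/eqP; rewrite eq_le outer_measure_ge0 andbT -PE.
apply: (le_trans (outer_measureU2 (@wlength R idfun)^*%mu _ _)).
rewrite [X in (X + _)%E]A0 add0e -[leRHS]N0.
exact: (leb_le NN').
Qed.

End ZeroPrimitive.

Lemma zero_primitive_ae (R : realType) (a b : R) (u : R -> R) :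
  leb.-integrable `[a, b] (EFin \o u) ->
  (forall t, t \in `[a, b] -> (\int[leb]_(s in `[a, t]) (u s)%:E = 0)%E) ->
  leb [set t | t \in `[a, b] /\ u t != 0] = 0%E.
Proof.
move=> ui u0.
have uNi : leb.-integrable `[a, b] (EFin \o (fun t => - u t)).
  exact: (integrableN ui).
have uN0 t : t \in `[a, b] -> (\int[leb]_(s in `[a, t]) (- u s)%:E = 0)%E.
  move=> tab; have sub : `[a, t] `<=` `[a, b].
    by apply: itv_subset => //; move: tab; rewrite in_itv/= => /andP[].
  have uit : leb.-integrable `[a, t] (EFin \o u).
    by apply: integrableS ui => //; exact: itv_lmeas.
  have := integralZl (itv_lmeas _) uit (-1).
  rewrite u0// mule0 => <-; apply: eq_integral => s _.
  by rewrite /= -EFinM mulN1r.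
have h1 := zero_primitive_pos ui u0; have h2 := zero_primitive_pos uNi uN0.
have : leb ([set t | t \in `[a, b] /\ 0 < u t] `|`
    [set t | t \in `[a, b] /\ 0 < - u t]) = 0%E.
  exact: leb_null_setU.
apply: leb_null_subset => t [tab]; rewrite neq_lt => /orP[ut|ut].
  by right; split=> //; rewrite oppr_gt0.
by left.
Qed.

Section WeakIntegral.
Context {R : realType}.
Implicit Types E F : lcsType R.

Lemma eq_weak_integral E (a b : R) (f g : R -> E) v :
  (forall t, t \in `[a, b] -> f t = g t) ->
  is_weak_integral a b f v -> is_weak_integral a b g v.
Proof.
move=> fg h l lc; have [li lv] := h l lc; split.
  by apply: eq_integrable li => [|t /set_mem abt]; [exact: itv_lmeas|rewrite fg].
by rewrite lv; apply: eq_integral => t /set_mem abt; rewrite fg.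
Qed.

Lemma linear_abs_seminorm E (l : {linear E -> R^o}) : continuous (l : E -> R) ->
  continuous_seminorm (fun x => `|(l x : R)|).
Proof.
move=> lc; split=> [x y|c x|x].
- by rewrite linearD/= ler_normD.
- by rewrite linearZ/= normrM.
- apply: (@cvg_comp _ _ _ (l : E -> R) (fun y : R => `|y|)); first exact: lc.
  exact: norm_continuous.
Qed.

Lemma functional_integrable k E a b (f : R -> E) (l : {linear E -> R^o}) :
  Lfunctions k a b f -> continuous (l : E -> R) ->
  leb.-integrable `[a, b] (EFin \o (l : E -> R) \o f).
Proof.
move=> fk lc; have ls := linear_abs_seminorm lc.
apply: (@le_integrable_real _ _ ((l : E -> R) \o f) (fun t => `|l (f t) : R|)) => //.
- exact: itv_lmeas.
- apply: strongly_measurable_comp_real => //.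
  exact: Lfunctions_strongly_measurable fk.
- exact: (Lfunctions_integrable_seminorm fk ls).
Qed.

(** Countably many functionals detect all nonzero values: on each piece these
    values lie in a countably based set, and one functional serves a whole
    basic open set. *)
Lemma strongly_measurable_nonzero E a b (f : R -> E) : strongly_measurable a b f ->
  (forall l : {linear E -> R^o}, continuous (l : E -> R) ->
     leb [set t | t \in `[a, b] /\ (l (f t) : R) != 0] = 0%E) ->
  leb [set t | t \in `[a, b] /\ f t != 0] = 0%E.
Proof.
move=> [A [C [fA N0]]] hl.
have null_n n : leb [set t | A n t /\ f t != 0] = 0%E.
  have [[cC [V [oV hV]] fC _] Aab] := fA n.
  pose good j (l : {linear E -> R^o}) := continuous (l : E -> R) /\
    forall x, V j x -> C n x -> (l x : R) != 0.
  pose N j := if pselect (exists l, good j l) is left e then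
    [set t | t \in `[a, b] /\ (projT1 (cid e) (f t) : R) != 0] else set0.
  have NN j : leb (N j) = 0%E.
    rewrite /N; case: pselect => [e|_]; last exact: measure0.
    by case: cid => l [lc lV] /=; exact: hl.
  apply: leb_null_subset (null_bigcup NN) => t [At ft].
  have [l [lc l0]] := separating_functional ft.
  have nl : nbhs (f t) [set x | (l x : R) != 0].
    have n0 : nbhs (l (f t) : R) [set y | y != 0].
      by apply: open_nbhs_nbhs; split; [exact: (@open_neq R 0)|].
    exact: (lc (f t) _ n0).
  have Cft : C n (f t) by apply: fC; exists t.
  have [j [Vj hj]] := hV _ _ Cft nl.
  exists j => //; rewrite /N; case: pselect => [e|nex]; last first.
    by exfalso; apply: nex; exists l; split=> // x Vx Cx; exact: hj.
  case: cid => l' [lc' lV'] /=; split; last exact: lV'.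
  exact: Aab.
have := null_bigcup null_n => N1.
have : leb ((\bigcup_n [set t | A n t /\ f t != 0]) `|`
    (`[a, b] `\` \bigcup_n A n)) = 0%E.
  exact: leb_null_setU.
apply: leb_null_subset => t [abt ft].
have [[n _ An]|nA] := pselect ((\bigcup_n A n) t); last by right.
by left; exists n.
Qed.

Lemma density_unique k E a b (f g : R -> E) :
  Lfunctions k a b f -> Lfunctions k a b g ->
  (forall t, t \in `[a, b] -> exists2 v, is_weak_integral a t f v &
     is_weak_integral a t g v) ->
  leb [set t | t \in `[a, b] /\ f t != g t] = 0%E.
Proof.
move=> fk gk fg.
pose h (t : R) : E := f t - g t.
have mh : strongly_measurable a b h.
  apply: (strongly_measurable_comp (B := fun p : R * (E * E) => p.2.1 - p.2.2) _
    (strongly_measurable_pair (Lfunctions_strongly_measurable fk)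
       (Lfunctions_strongly_measurable gk))).
  apply: continuous_subspaceT => p; apply: tvs_cvgB.
    by apply: (@cvg_comp _ _ _ snd fst); [exact: cvg_snd|exact: cvg_fst].
  by apply: (@cvg_comp _ _ _ snd snd); exact: cvg_snd.
have : leb [set t | t \in `[a, b] /\ h t != 0] = 0%E.
  apply: (strongly_measurable_nonzero mh) => l lc.
  have fi := functional_integrable fk lc; have gi := functional_integrable gk lc.
  apply: (zero_primitive_ae (u := fun t => l (h t) : R)).
    have := integrableB (itv_lmeas _) fi gi.
    by apply: eq_integrable => [|t _]; [exact: itv_lmeas|rewrite /= /h linearB].
  move=> t tab; have [v fv gv] := fg t tab.
  have [fi' fv'] := fv l lc; have [gi' gv'] := gv l lc.
  have := integralB_EFin (itv_lmeas _) fi' gi'; rewrite -fv' -gv' subee// => <-.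
  by apply: eq_integral => s _; rewrite /h linearB.
by apply: leb_null_subset => t [tab ft]; split=> //; rewrite /h subr_eq0.
Qed.

End WeakIntegral.

(** * Seminorms of the Lebesgue spaces *)

Section AeEqual.
Context {R : realType}.
Implicit Types E F : lcsType R.

Definition ae_eq_on (T : eqType) (a b : R) (f g : R -> T) :=
  leb [set t | t \in `[a, b] /\ f t != g t] = 0%E.

Lemma ae_eq_onP (T : eqType) (a b : R) (f g : R -> T) :
  ae_eq_on a b f g <-> {ae leb, forall t, `[a, b]%classic t -> f t = g t}.
Proof.
rewrite /ae_eq_on; split=> [h|[N [mN N0 hN]]].
  exists [set t | t \in `[a, b] /\ f t != g t]; split => //.
    exact: null_lmeas.
  by move=> t /= /not_implyP[abt /eqP ?]; split.
apply: leb_null_subset N0 => t [abt /eqP ft]; apply: hN => /=.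
by apply/not_implyP.
Qed.

Lemma ae_eq_on_sym (T : eqType) (a b : R) (f g : R -> T) :
  ae_eq_on a b f g -> ae_eq_on a b g f.
Proof.
rewrite /ae_eq_on => h; apply: leb_null_subset h => t [tab]; rewrite eq_sym => gf.
by split.
Qed.

Lemma ae_eq_on_trans (T : eqType) (a b : R) (f g h : R -> T) :
  ae_eq_on a b f g -> ae_eq_on a b g h -> ae_eq_on a b f h.
Proof.
move=> fg gh; apply: leb_null_subset (leb_null_setU fg gh) => t [tab fh].
have [ft|ft] := eqVneq (f t) (g t); first by right; split=> //; rewrite -ft.
by left.
Qed.

Lemma Lrepr_pi k (a b : R) E (f : R -> E) (fk : Lfunctions k a b f) :
  ae_eq_on a b (Lrepr (\pi_(vLspace k a b E) (MkLfunction fk)))%qT f.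
Proof.
apply/ae_eq_onP.
have : (Lrepr (\pi_(vLspace k a b E) (MkLfunction fk)) =
    MkLfunction fk %[mod vLspace k a b E])%qT by rewrite /Lrepr reprK.
by move/eqmodP => /asboolP.
Qed.

Lemma Lrepr_Lfunctions k (a b : R) E (F : vLspace k a b E) : Lfunctions k a b F.
Proof. exact: LfunctionP. Qed.

Lemma ae_weak_integral k E a b t (f g : R -> E) v : t \in `[a, b] ->
  Lfunctions k a b f -> Lfunctions k a b g -> ae_eq_on a b f g ->
  is_weak_integral a t f v -> is_weak_integral a t g v.
Proof.
move=> tab fk gk fg fv l lc; have [fi ->] := fv l lc.
have tb : t <= b by move: tab; rewrite in_itv/= => /andP[].
have gi : leb.-integrable `[a, t] (EFin \o (l : E -> R) \o g).
  exact: functional_integrable (Lfunctions_restrict (lexx a) tb gk) lc.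
split; first exact: gi.
apply: ae_eq_integral.
- exact: itv_lmeas.
- exact: (measurable_int _ fi).
- exact: (measurable_int _ gi).
- move/ae_eq_onP : fg => [N [mN N0 hN]]; exists N; split=> // s ns.
  apply: hN => fgs; apply: ns => /= ast; rewrite fgs//.
  exact: (itv_subset (lexx a) tb).
Qed.

(** [AC_deriv] is obtained by choice; uniqueness of densities identifies it with
    any density at hand. *)
Lemma weak_integral_density k E a b (f : R -> E) (h : R -> E) :
  a <= b -> Lfunctions k a b f ->
  (forall t, t \in `[a, b] -> exists2 v, is_weak_integral a t f v & h t = h a + v) ->
  AC_vec k a b h /\ ae_eq_on a b (AC_deriv k a b h) f.
Proof.
move=> ab fk fh; set F := (\pi_(vLspace k a b E) (MkLfunction fk))%qT.
have Fk := Lrepr_Lfunctions F.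
have Ff : ae_eq_on a b (Lrepr F) f := Lrepr_pi fk.
have Fh : is_primitive h F.
  move=> t tab; have [v fv hv] := fh t tab; exists v => //.
  exact: (ae_weak_integral tab fk Fk (ae_eq_on_sym Ff) fv).
split; first by exists F.
rewrite /AC_deriv; case: xgetP => [G _ Gh|/(_ F)//].
apply: ae_eq_on_trans Ff; apply: density_unique => [||t tab].
- exact: (Lrepr_Lfunctions G).
- exact: Fk.
have [v Gv hv] := Gh t tab; have [w Fw hw] := Fh t tab.
exists v => //; suff -> : v = w by [].
by apply: (addrI (h a)); rewrite -hv -hw.
Qed.

End AeEqual.

Section Lnorms.
Context {R : realType}.
Implicit Types (k : Lkind R) (a b : R) (w : R -> R) (E : lcsType R).

(** [Lseminorm k a b q f] is [Lreal k a b (q \o f)] by definition. *)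
Definition Lreal k a b w : \bar R := Lnorm leb (Lexponent k) ((EFin \o w) \_ `[a, b]).

Lemma Lreal_restrictE a b w :
  (EFin \o w) \_ `[a, b] = EFin \o (w \_ `[a, b]).
Proof. by apply/funext => t; rewrite /= !patchE; case: ifP. Qed.

Lemma Lreal_ge0 k a b w : (0 <= Lreal k a b w)%E.
Proof. exact: Lnorm_ge0. Qed.

Lemma Lnorm_le k (f g : lebR R -> R) :
  measurable_fun [set: lebR R] f -> measurable_fun [set: lebR R] g ->
  (forall t, 0 <= f t) -> (forall t, 0 <= g t) ->
  leb [set t : R | ~~ (f t <= g t)] = 0%E ->
  (Lnorm leb (Lexponent k) (EFin \o f) <= Lnorm leb (Lexponent k) (EFin \o g))%E.
Proof.
move=> mf mg f0 g0 fg0.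
have aefg : {ae leb, forall t : lebR R, (`|(f t)%:E| <= `|(g t)%:E|)%E}.
  exists [set t : R | ~~ (f t <= g t)]; split=> //; first exact: null_lmeas.
  by move=> t /=; rewrite lee_fin !ger0_norm// => /negP.
rewrite unlock /Lnorm; case: k => [p p1|] /=; last first.
  by case: ifP => // _; exact: le_ess_sup.
have p0 : 0 < p by rewrite (lt_le_trans ltr01).
have m (h : lebR R -> R) : (forall t, 0 <= h t) ->
    (fun t => (`|h t| `^ p)%:E) = (EFin \o (fun t => h t `^ p)).
  by move=> h0; apply/funext => t; rewrite /= ger0_norm.
apply: gt0_ler_poweR.
- by rewrite invr_ge0 ltW.
- by rewrite in_itv/= leey andbT; apply: integral_ge0 => t _; rewrite lee_fin powR_ge0.
- by rewrite in_itv/= leey andbT; apply: integral_ge0 => t _; rewrite lee_fin powR_ge0.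
rewrite !m//; apply: ae_ge0_le_integral.
- exact: measurableT.
- by move=> t _; rewrite lee_fin powR_ge0.
- by apply/measurable_EFinP; exact: measurable_powR_itv.
- by move=> t _; rewrite lee_fin powR_ge0.
- by apply/measurable_EFinP; exact: measurable_powR_itv.
- case: aefg => N [mN N0 hN]; exists N; split=> // t nt; apply: hN => /= h.
  apply: nt => _ /=; rewrite lee_fin; apply: powR_le => //; first exact: ltW.
  by move: h; rewrite /= lee_fin !ger0_norm.
Qed.

Lemma restrict_measurable a b w :
  measurable_fun (`[a, b] : set (lebR R)) w ->
  measurable_fun [set: lebR R] (w \_ `[a, b]).
Proof.
by move=> mw; apply/(measurable_restrictT _ (itv_lmeas _)).
Qed.

Lemma Lreal_le k a b c d w1 w2 : a <= c -> d <= b ->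
  measurable_fun (`[c, d] : set (lebR R)) w1 ->
  measurable_fun (`[a, b] : set (lebR R)) w2 ->
  (forall t, t \in `[c, d] -> 0 <= w1 t) ->
  (forall t, t \in `[a, b] -> 0 <= w2 t) ->
  leb [set t | t \in `[c, d] /\ ~~ (w1 t <= w2 t)] = 0%E ->
  (Lreal k c d w1 <= Lreal k a b w2)%E.
Proof.
move=> ac db m1 m2 w10 w20 h; rewrite /Lreal !Lreal_restrictE.
apply: Lnorm_le.
- exact: restrict_measurable.
- exact: restrict_measurable.
- by move=> t; rewrite patchE; case: ifP => // /set_mem; exact: w10.
- by move=> t; rewrite patchE; case: ifP => // /set_mem; exact: w20.
- apply: leb_null_subset h => t /=; rewrite !patchE; case: ifP => [/set_mem cdt|_].
    by rewrite mem_set//; exact: (itv_subset ac db).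
  by case: ifP => [/set_mem abt|_]; rewrite ?w20// lexx.
Qed.

Lemma Lreal_triangle k a b w1 w2 :
  measurable_fun (`[a, b] : set (lebR R)) w1 ->
  measurable_fun (`[a, b] : set (lebR R)) w2 ->
  (Lreal k a b (fun t => w1 t + w2 t)%R <= Lreal k a b w1 + Lreal k a b w2)%E.
Proof.
move=> m1 m2; rewrite /Lreal !Lreal_restrictE.
have -> : ((fun t => w1 t + w2 t) : R -> R) \_ `[a, b] =
    (w1 \_ `[a, b] \+ w2 \_ `[a, b])%R.
  by apply/funext => t; rewrite /= !patchE; case: ifP => //; rewrite addr0.
apply: eminkowski; [exact: restrict_measurable|exact: restrict_measurable|].
by case: k => [p p1|] /=; rewrite ?lee_fin// leey.
Qed.

Lemma LrealE (p : R) (p1 : 1 <= p) a b w :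
  (forall t, t \in `[a, b] -> 0 <= w t) ->
  Lreal (Lp p1) a b w = poweR (\int[leb]_(t in `[a, b]) (w t `^ p)%:E) p^-1.
Proof.
move=> w0; rewrite /Lreal unlock /Lnorm /=; congr poweR.
rewrite [RHS]integral_mkcond; apply: eq_integral => t _.
rewrite !patchE; case: ifP => [/set_mem abt|_].
  by rewrite /= ger0_norm// w0.
by rewrite abse0 poweR0r// gt_eqF// (lt_le_trans ltr01 p1).
Qed.

Lemma Lreal_Lp_le (p : R) (p1 : 1 <= p) a b w (e : R) : 0 <= e ->
  (forall t, t \in `[a, b] -> 0 <= w t) ->
  (\int[leb]_(t in `[a, b]) (w t `^ p)%:E <= (e `^ p)%:E)%E ->
  (Lreal (Lp p1) a b w <= e%:E)%E.
Proof.
move=> e0 w0 h; rewrite LrealE//.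
have p0 : 0 < p by rewrite (lt_le_trans ltr01).
have -> : e%:E = poweR (e `^ p)%:E p^-1.
  by rewrite poweR_EFin -powRrM mulfV ?gt_eqF// powRr1.
apply: gt0_ler_poweR => //.
- by rewrite invr_ge0 ltW.
- by rewrite in_itv/= leey andbT; apply: integral_ge0 => t _; rewrite lee_fin powR_ge0.
- by rewrite in_itv/= leey andbT lee_fin powR_ge0.
Qed.

Lemma Lreal_Linfrc_le a b w (e : R) : 0 <= e ->
  (forall t, t \in `[a, b] -> 0 <= w t) ->
  (forall t, t \in `[a, b] -> w t <= e) ->
  (Lreal Linfrc a b w <= e%:E)%E.
Proof.
move=> e0 w0 we; rewrite /Lreal unlock /Lnorm /=; case: ifP => [_|_]; last by rewrite lee_fin.
apply/ess_supP; apply: aeW => t /=; rewrite patchE; case: ifP => [/set_mem abt|_].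
  by rewrite /= lee_fin ger0_norm ?w0 ?we.
by rewrite /= normr0 lee_fin.
Qed.

End Lnorms.

Section LspaceTopology.
Context {R : realType}.
Implicit Types (k : Lkind R) (a b : R) (E : lcsType R).

Lemma strongly_measurableB E a b (f g : R -> E) :
  strongly_measurable a b f -> strongly_measurable a b g ->
  strongly_measurable a b (fun t => f t - g t).
Proof.
move=> mf mg.
apply: (strongly_measurable_comp (B := fun p : R * (E * E) => p.2.1 - p.2.2) _
    (strongly_measurable_pair mf mg)).
apply: continuous_subspaceT => p; apply: tvs_cvgB.
  by apply: (@cvg_comp _ _ _ snd fst); [exact: cvg_snd|exact: cvg_fst].
by apply: (@cvg_comp _ _ _ snd snd); exact: cvg_snd.
Qed.

(** By the triangle inequality, the ball is open in the sense of
    [vLspace_open]. *)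
Lemma Lseminorm_ball_nbhs k a b E (f0 : vLspace k a b E) (q : E -> R) (e : R) :
  continuous_seminorm q -> 0 < e ->
  \forall f \near f0, (Lseminorm k a b q (fun t => (f : vLspace k a b E) t - f0 t)%R < e%:E)%E.
Proof.
move=> qs e0.
have m (f g : vLspace k a b E) :
    measurable_fun (`[a, b] : set (lebR R)) (fun t => q (f t - g t)).
  apply: (seminorm_measurable _ qs); apply: strongly_measurableB;
    exact: Lfunctions_strongly_measurable (Lrepr_Lfunctions _).
pose W := [set f : vLspace k a b E |
  (Lseminorm k a b q (fun t => f t - f0 t)%R < e%:E)%E].
have oW : open W.
  move=> f Wf; have d0 := Lreal_ge0 k a b (fun t => q (f t - f0 t)).
  have df : Lseminorm k a b q (fun t => f t - f0 t) \is a fin_num.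
    by rewrite ge0_fin_numE//; exact: lt_trans Wf (ltry _).
  exists 1%N, (fun=> q), (e - fine (Lseminorm k a b q (fun t => f t - f0 t))).
  split=> [//||g hg]; first by rewrite subr_gt0 -lte_fin fineK.
  rewrite /W /=; apply: (@le_lt_trans _ _
      (Lreal k a b (fun t => q (g t - f t)%R) + Lreal k a b (fun t => q (f t - f0 t)%R))%E).
    apply: le_trans (Lreal_triangle _ (m _ _) (m _ _)).
    apply: Lreal_le.
    + exact: lexx.
    + exact: lexx.
    + exact: m.
    + by apply: measurable_funD; exact: m.
    + by move=> t _; exact: seminorm_ge0.
    + by move=> t _; apply: addr_ge0; exact: seminorm_ge0.
    + rewrite (_ : mkset _ = set0) ?measure0//; apply/seteqP; split=> // t [_ /negP]; apply.
      by have [qD _ _] := qs; rewrite (le_trans _ (qD _ _))// addrA subrK.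
  by have := hg ord0; rewrite EFinB fineK// lteBrDr.
apply: open_nbhs_nbhs; split=> //; rewrite /W /=.
rewrite (_ : (fun t => f0 t - f0 t) = fun=> 0); last by apply/funext => t; rewrite subrr.
apply: (@le_lt_trans _ _ 0%E); last by rewrite lte_fin.
case: k {f0 m W oW} => [p p1|].
  apply: (Lreal_Lp_le p1) => //.
    by move=> t _; rewrite seminorm0.
  rewrite integral0_eq ?lee_fin ?powR_ge0// => t _.
  by rewrite seminorm0// powR0// gt_eqF// (lt_le_trans ltr01 p1).
by apply: Lreal_Linfrc_le => // t _; rewrite seminorm0.
Qed.

Lemma vLspace_cvg k a b E (T : Type) (F : set_system T) (u : T -> vLspace k a b E)
    (l : vLspace k a b E) : Filter F ->
  (forall q : E -> R, continuous_seminorm q -> forall e, 0 < e ->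
    \forall t \near F, (Lseminorm k a b q (fun s => u t s - l s)%R < e%:E)%E) ->
  u @ F --> l.
Proof.
move=> FF h A; rewrite nbhsE => -[W [oW Wl] WA].
have [n [q [e [qs e0 qW]]]] := oW l Wl.
have : \forall t \near F, forall i : 'I_n,
    (Lseminorm k a b (q i) (fun s => u t s - l s)%R < e%:E)%E.
  by apply: filter_forall => i; exact: h.
by apply: filterS => t ht; apply: WA; apply: qW.
Qed.

End LspaceTopology.

(** * Superposition operators depending on a parameter *)

Section UniformEstimates.
Context {R : realType} {T L : topologicalType} {E F : lcsType R}.
Variables (K : set T) (f0 : L) (B : T -> L -> E -> F).

(** Only the points with parameter [f0] matter: all superpositions are compared
    with the one for [f0]. *)
Definition jointly_continuous :=
  forall x v, K x ->
    (fun z : T * (L * E) => B z.1 z.2.1 z.2.2) @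
      within [set z | K z.1] (nbhs (x, (f0, v))) --> B x f0 v.

Hypotheses (cK : compact K) (Bc : jointly_continuous).

(** At [v = 0], joint continuity and compactness of [K] give a neighbourhood of
    0 on which [q (B x f v) < 1] for all [x] in [K] and all [f] near [f0];
    homogeneity then allows [Q] to be its gauge. *)
Lemma uniform_seminorm_bound (q : F -> R) :
  (\forall f \near f0, forall x, K x -> forall (c : R) v,
     B x f (c *: v) = c *: B x f v) ->
  continuous_seminorm q ->
  exists2 Q : E -> R, continuous_seminorm Q &
    \forall f \near f0, forall x, K x -> forall v, q (B x f v) <= Q v.
Proof.
move=> homB qs; have [qD qZ qc] := qs.
have B0 x : K x -> B x f0 0 = 0.
  by move=> Kx; have := nbhs_singleton homB x Kx 0 0; rewrite !scale0r.
have : \forall i \near (f0, (0 : E)), K `<=` (fun x => K x -> q (B x i.1 i.2) < 1).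
  apply: ((compact_near_coveringP _).1 cK (L * E)%type (nbhs (f0, (0 : E)))
    (fun i x => K x -> q (B x i.1 i.2) < 1) _) => x Kx.
  have h1 : \forall y \near B x f0 0, q y < 1.
    rewrite B0//; have := @seminorm_lt_nbhs _ _ q 0 1 qs ltr01.
    by apply: filterS => y; rewrite subr0.
  exact: (Bc Kx h1).
move=> [[/= D V] [f0D V0] DV].
have [Q Qs QV] := nbhs0_seminorm V0.
exists Q => //; apply: filterS2 f0D homB => f Df homf x Kx v.
rewrite leNgt; apply/negP => lt.
have Q0 := seminorm_ge0 v Qs.
(* If [Q v < q (B x f v)], any [s] strictly between them contradicts the choice
   of the neighbourhood at [s^-1 *: v]. *)
pose s := (Q v + q (B x f v)) / 2.
have s0 : 0 < s by rewrite /s; lra.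
have Qs1 : Q (s^-1 *: v) < 1.
  have [_ QZ _] := Qs.
  by rewrite QZ gtr0_norm ?invr_gt0// ltr_pdivrMl// mulr1 /s; lra.
have := DV (f, s^-1 *: v) (conj Df (QV _ Qs1)) x Kx Kx.
rewrite /= homf// qZ gtr0_norm ?invr_gt0// ltr_pdivrMl// mulr1 /s; lra.
Qed.

Lemma uniform_small (C : set E) (q : F -> R) (e : R) : compact C ->
  continuous_seminorm q -> 0 < e ->
  \forall f \near f0, forall x v, K x -> C v -> q (B x f v - B x f0 v) < e.
Proof.
move=> cC qs e0; have [qD qZ qc] := qs.
have e2 : 0 < e / 2 by rewrite divr_gt0.
have : \forall f \near f0, K `*` C `<=`
    (fun p => q (B p.1 f p.2 - B p.1 f0 p.2) < e).
  have /compact_near_coveringP/near_covering_withinP := compact_setX cK cC.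
  apply => -[x v] [/= Kx Cv].
  have := Bc Kx (seminorm_lt_nbhs (B x f0 v) qs e2).
  move=> [[/= A DV] [xA [[/= D V] [f0D vV] DVs]] ADV].
  exists (A `*` V, D); first by split => //; exists (A, V).
  move=> [[x' v'] f] [/= [Ax' Vv'] Df] [/= Kx' Cv'].
  have h1 : q (B x' f v' - B x f0 v) < e / 2.
    by apply: (ADV (x', (f, v'))) => //; split=> //; exact: (DVs (f, v')).
  have h2 : q (B x' f0 v' - B x f0 v) < e / 2.
    apply: (ADV (x', (f0, v'))) => //; split=> //; apply: (DVs (f0, v')).
    by split=> //; exact: nbhs_singleton.
  have := qD (B x' f v' - B x f0 v) (- (B x' f0 v' - B x f0 v)).
  by rewrite seminormN// opprB addrA subrK; lra.
by apply: filterS => f h x v Kx Cv; exact: (h (x, v)).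
Qed.

End UniformEstimates.

Section Tightness.
Context {R : realType}.
Implicit Types E F : lcsType R.

(** Finite unions of pieces exhaust the interval up to a null set, and [f] maps
    each of them into a compact set. *)
Lemma strongly_measurable_tight E a b (f : R -> E) (g : R -> R) (e : R) :
  strongly_measurable a b f ->
  leb.-integrable `[a, b] (EFin \o g) -> (forall t, t \in `[a, b] -> 0 <= g t) ->
  0 < e ->
  exists A C, [/\ lmeas A, A `<=` `[a, b], compact C, f @` A `<=` C &
    (\int[leb]_(t in `[a, b] `\` A) (g t)%:E <= e%:E)%E].
Proof.
move=> [A [C [fA N0]]] gi g0 e0.
pose U n := \big[setU/set0]_(i < n) A i.
pose D n := \big[setU/set0]_(i < n) C i.
have mA i : lmeas (A i) by have [pA _] := fA i; exact: piece_dom pA.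
have mU n : lmeas (U n).
  by apply: bigsetU_measurable => i _; exact: mA.
have Uab n : U n `<=` `[a, b].
  by rewrite /U -bigcup_mkord => t [i _ At]; exact: (fA i).2.
have cD n : compact (D n).
  rewrite /D; elim: n => [|n IH]; first by rewrite big_ord0; exact: compact0.
  by rewrite big_ord_recr/=; apply: compactU => //; have [[]] := fA n.
have fU n : f @` U n `<=` D n.
  rewrite /U /D -!bigcup_mkord => _ [t [i ni At] <-]; exists i => //.
  by have [[_ _ h _] _] := fA i; apply: h; exists t.
have mg : measurable_fun (`[a, b] : set (lebR R)) (EFin \o g).
  exact: measurable_int gi.
have cvgU : (\int[leb]_(t in U n) (g t)%:E)%E @[n --> \oo] -->
    (\int[leb]_(t in \bigcup_n U n) (g t)%:E)%E.
  apply: ge0_nondecreasing_set_cvg_integral.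
  - move=> n m nm; apply/subsetPset; exact: subset_bigsetU.
  - exact: mU.
  - by move=> n; apply: measurable_funS mg; [exact: itv_lmeas|exact: Uab].
  - by move=> n t Ut; rewrite lee_fin g0//; exact: (Uab n).
have UE : \bigcup_n U n = \bigcup_n A n.
  apply/seteqP; split=> t [n _].
    by rewrite /U -bigcup_mkord => -[i _ At]; exists i.
  by move=> At; exists n.+1 => //; rewrite /U -bigcup_mkord; exists n => /=.
have IE : (\int[leb]_(t in \bigcup_n U n) (g t)%:E =
    \int[leb]_(t in `[a, b]) (g t)%:E)%E.
  rewrite UE [RHS](negligible_integral (null_lmeas N0) (itv_lmeas _) gi N0).
  congr (integral _ _ _); apply/seteqP; split=> t.
    move=> [n _ An]; split; first exact: (fA n).2.
    by move=> [_ nt]; apply: nt; exists n.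
  move=> [abt h]; apply: contrapT => nt; apply: h; split=> //.
have Ifin : (\int[leb]_(t in `[a, b]) (g t)%:E)%E \is a fin_num.
  by apply: integrable_fin_num => //; exact: itv_lmeas.
have split_int n : (\int[leb]_(t in `[a, b]) (g t)%:E =
    \int[leb]_(t in U n) (g t)%:E + \int[leb]_(t in `[a, b] `\` U n) (g t)%:E)%E.
  have UD : U n `|` (`[a, b] `\` U n) = `[a, b]%classic by rewrite setDUK//; exact: Uab.
  rewrite -{1}UD ge0_integral_setU.
  - exact: erefl.
  - exact: mU.
  - by apply: measurableD; [exact: itv_lmeas|exact: mU].
  - by rewrite UD.
  - by rewrite UD => t abt; rewrite lee_fin g0.
  - by apply/disj_setPS => t [Ut [_ nUt]].
rewrite IE in cvgU.
set I := (\int[leb]_(t in `[a, b]) (g t)%:E)%E in IE Ifin split_int cvgU.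
have : \forall n \near \oo, (I - e%:E < \int[leb]_(t in U n) (g t)%:E)%E.
  have hIe : (I - e%:E < I)%E.
    by rewrite -[in ltRHS](fineK Ifin) -(fineK Ifin) -EFinB lte_fin ltrBlDr ltrDl.
  have hI : nbhs I [set x | (I - e%:E < x)%E].
    by apply: open_nbhs_nbhs; split => //; exact: open_ereal_gt_ereal.
  exact: (cvgU _ hI).
move=> /filter_ex[n hn]; exists (U n), (D n); split=> //.
have Un_fin : (\int[leb]_(t in U n) (g t)%:E)%E \is a fin_num.
  apply: integrable_fin_num; first exact: mU.
  by apply: integrableS gi; [exact: itv_lmeas|exact: mU|exact: Uab].
have Dn_fin : (\int[leb]_(t in `[a, b] `\` U n) (g t)%:E)%E \is a fin_num.
  apply: integrable_fin_num; first by apply: measurableD; [exact: itv_lmeas|exact: mU].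
  apply: integrableS gi; [exact: itv_lmeas| |by move=> t []].
  by apply: measurableD; [exact: itv_lmeas|exact: mU].
have IU : I = (fine (\int[leb]_(t in U n) (g t)%:E) +
    fine (\int[leb]_(t in `[a, b] `\` U n) (g t)%:E))%:E.
  by rewrite EFinD !fineK.
move: hn; rewrite IU -(fineK Un_fin) -(fineK Dn_fin) -EFinB lte_fin lee_fin /=.
lra.
Qed.

End Tightness.

Section NormEstimate.
Context {R : realType} {L : topologicalType} {E F : lcsType R}.
Variables (k : Lkind R) (a b : R) (f0 : L) (B : R -> L -> E -> F)
  (gamma : R -> E) (q : F -> R).
Hypotheses (Bc : jointly_continuous `[a, b] f0 B)
  (homB : \forall f \near f0, forall x, x \in `[a, b] -> forall (c : R) v,
     B x f (c *: v) = c *: B x f v)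
  (gk : Lfunctions k a b gamma) (qs : continuous_seminorm q).

Let w f t := q (B t f (gamma t) - B t f0 (gamma t)).

Hypothesis mw : \forall f \near f0, measurable_fun (`[a, b] : set (lebR R)) (w f).

(** Dominated convergence in a form that needs no countability of the
    neighbourhood filter of [f0]: [gamma] is bounded by an integrable function
    off a set on which it has relatively compact range. *)
Lemma Lreal_small (e : R) : 0 < e ->
  \forall f \near f0, (Lreal k a b (w f) <= e%:E)%E.
Proof.
move=> e0; have cab : compact `[a, b]%classic := @segment_compact R a b.
have [qD qZ qc] := qs.
have w0 f t : 0 <= w f t by exact: seminorm_ge0.
case: k gk => [p p1|] gk'; last first.
  have [_ cC _] := gk'.
  have := uniform_small cab Bc cC qs e0.
  apply: filterS => f h; apply: Lreal_Linfrc_le => //; first exact: ltW.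
  by move=> t abt; apply/ltW/h => //; apply: subset_closure; exists t.
have p0 : 0 < p by rewrite (lt_le_trans ltr01).
have [Q Qs qQ] := uniform_seminorm_bound cab Bc homB qs.
have mg := Lfunctions_strongly_measurable gk'.
have Q0 v : 0 <= Q v by exact: seminorm_ge0.
have QQs : continuous_seminorm (fun v => 2 * Q v).
  have [QD QZ Qc] := Qs; split=> [x y|c x|x].
  - by rewrite -mulrDr ler_pM2l// QD.
  - by rewrite QZ mulrCA.
  - by apply: cvgM; [exact: cvg_cst|exact: Qc].
pose g t := (2 * Q (gamma t)) `^ p.
have gi : leb.-integrable `[a, b] (EFin \o g) by exact: (gk'.2 _ QQs).
have ep : 0 < e `^ p / 2 by rewrite divr_gt0// powR_gt0.
have [A [C [mA Aab cC gC IA]]] :=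
  strongly_measurable_tight mg gi (fun t _ => powR_ge0 _ _) ep.
(* Chosen so that the integral of [d `^ p] over the interval is at most
   [e `^ p / 2]. *)
pose d := (e `^ p / 2 / (`|b - a| + 1)) `^ p^-1.
have ba0 : 0 < `|b - a| + 1 by rewrite ltr_wpDl.
have d0 : 0 < d by rewrite powR_gt0// divr_gt0.
have dp : d `^ p = e `^ p / 2 / (`|b - a| + 1).
  by rewrite -powRrM mulVf ?gt_eqF// powRr1// ltW// divr_gt0.
have small := uniform_small cab Bc cC qs d0.
have qQ0 := nbhs_singleton qQ.
near=> f.
have mwf : measurable_fun (`[a, b] : set (lebR R)) (w f) by near: f.
have qQf : forall x, x \in `[a, b] -> forall v, q (B x f v) <= Q v by near: f.
have smallf : forall x v, x \in `[a, b] -> C v -> q (B x f v - B x f0 v) < d.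
  by near: f.
apply: (Lreal_Lp_le p1) => //; first exact: ltW.
have mwp : measurable_fun (`[a, b] : set (lebR R)) (fun t => (w f t `^ p)%:E).
  by apply/measurable_EFinP; exact: measurable_powR_itv.
have AU : A `|` (`[a, b] `\` A) = `[a, b]%classic by rewrite setDUK.
rewrite -AU ge0_integral_setU; last 5 first.
- exact: mA.
- by apply: measurableD; [exact: itv_lmeas|exact: mA].
- by rewrite AU.
- by move=> t _; rewrite lee_fin powR_ge0.
- by apply/disj_setPS => t [At [_ nAt]].
have -> : (e `^ p)%:E = ((e `^ p / 2)%:E + (e `^ p / 2)%:E)%E.
  by rewrite -EFinD -splitr.
apply: leeD.
  apply: (@le_trans _ _ (\int[leb]_(t in A) (d `^ p)%:E)%E).
    apply: ge0_le_integral.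
    - exact: mA.
    - by move=> t _; rewrite lee_fin powR_ge0.
    - by apply: measurable_funS mwp; [exact: itv_lmeas|exact: Aab].
    - exact: measurable_cst.
    - move=> t At; rewrite lee_fin; apply: powR_le => //; first exact: ltW.
      by apply/ltW/smallf; [exact: Aab|apply: gC; exists t].
  rewrite integral_cst// dp.
  apply: (@le_trans _ _ ((e `^ p / 2 / (`|b - a| + 1))%:E * (`|b - a|)%:E)%E).
    apply: lee_wpmul2l; first by rewrite lee_fin divr_ge0// ltW.
    apply: (le_trans (leb_le Aab)).
    have [ab|ba] := leP a b; first by rewrite leb_itv// lee_fin ler_norm.
    by rewrite set_itv_ge ?measure0 ?lee_fin// bnd_simp -ltNge.
  rewrite -EFinM lee_fin; move: ep; set c := e `^ p / 2 => c0.
  rewrite mulrAC ler_pdivrMr// ler_pM2l//.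
  by rewrite lerDl.
apply: le_trans IA; apply: ge0_le_integral.
- by apply: measurableD; [exact: itv_lmeas|exact: mA].
- by move=> t _; rewrite lee_fin powR_ge0.
- by apply: measurable_funS mwp; [exact: itv_lmeas|move=> t []].
- apply: measurable_funS (measurable_int _ gi); [exact: itv_lmeas|by move=> t []].
- move=> t [abt _]; rewrite lee_fin; apply: powR_le => //; first exact: ltW.
  apply: (le_trans (qD _ _)); rewrite seminormN// mulr_natl mulr2n.
  by apply: lerD; [exact: qQf|exact: qQ0].
Unshelve. all: by end_near. Qed.

End NormEstimate.

(** * The chain rule for weak integrals *)

Section Clamp.
Context {R : realType}.

Lemma clampE (a b t : R) : t \in `[a, b] -> clamp a b t = t.
Proof.
by rewrite in_itv/= => /andP[at_ tb]; rewrite /clamp (min_idPr tb) (max_idPr at_).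
Qed.

Lemma clamp_itv (a b t : R) : a <= b -> clamp a b t \in `[a, b].
Proof.
by move=> ab; rewrite in_itv/= /clamp le_max lexx/= ge_max ab ge_min lexx.
Qed.

Lemma clamp_continuous (a b : R) : continuous (clamp a b).
Proof.
move=> t; apply: (@continuous_max _ _ (fun=> a) (fun t => Num.min b t)).
  exact: cvg_cst.
by apply: (@continuous_min _ _ (fun=> b) (fun t => t)); [exact: cvg_cst|exact: cvg_id].
Qed.

Lemma comp_clamp_continuous (T : topologicalType) (a b : R) (h : R -> T) :
  a <= b -> {within `[a, b], continuous h} -> continuous (h \o clamp a b).
Proof.
move=> ab /subspace_continuousP hc t A hA.
have hcl : \forall s \near clamp a b t, `[a, b]%classic s -> A (h s).
  exact: (hc _ (clamp_itv t ab) A hA).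
have : \forall s \near t, `[a, b]%classic (clamp a b s) -> A (h (clamp a b s)).
  exact: (@clamp_continuous a b t _ hcl).
by apply: filterS => s; apply; exact: clamp_itv.
Qed.

End Clamp.

Section IntegralSplit.
Context {R : realType}.

Lemma itv_integral_split (a s t : R) (g : R -> R) : a <= s -> s <= t ->
  leb.-integrable `[a, t] (EFin \o g) ->
  (\int[leb]_(r in `[a, t]) (g r)%:E =
   \int[leb]_(r in `[a, s]) (g r)%:E + \int[leb]_(r in `[s, t]) (g r)%:E)%E.
Proof.
move=> as_ st gi.
have mg : measurable_fun (`[a, t] : set (lebR R)) (EFin \o g) := measurable_int _ gi.
have gst : leb.-integrable `[s, t] (EFin \o g).
  by apply: integrableS gi; [exact: itv_lmeas|exact: itv_lmeas|exact: itv_subset].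
have s0 : leb [set s] = 0%E.
  by have := @leb_itv R s s (lexx s); rewrite set_itv1 subrr.
have -> : (\int[leb]_(r in `[s, t]) (g r)%:E = \int[leb]_(r in `]s, t]) (g r)%:E)%E.
  rewrite (negligible_integral (null_lmeas s0) (itv_lmeas _) gst s0).
  congr (integral _ _ _); apply/seteqP; split=> r /=; rewrite !in_itv/=.
    by move=> [/andP[sr ->] /eqP rs]; rewrite lt_neqAle eq_sym rs sr.
  by move=> /andP[sr ->]; rewrite (ltW sr); split=> //; apply/eqP; rewrite gt_eqF.
have E1 : `[a, s] `|` `]s, t] = `[a, t]%classic.
  apply/seteqP; split=> r /=; rewrite !in_itv/=.
    by case=> /andP[]; [move=> -> /le_trans -> //|move=> /ltW /(le_trans as_) -> ->].
  by move=> /andP[-> rt]; case: (leP r s) => [|sr]; [left|right; rewrite rt].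
rewrite -{1}E1 integral_setU.
- exact: erefl.
- exact: itv_lmeas.
- exact: itv_lmeas.
- by rewrite E1.
- apply/disj_setPS => r [/=]; rewrite !in_itv/= => /andP[_ rs] /andP[sr _].
  by move: rs; rewrite leNgt sr.
Qed.

End IntegralSplit.

Section LinearSuperposition.
Context {R : realType}.
Implicit Types E F : lcsType R.

Lemma within_seminorm_bound E F (a b : R) (B : R * E -> F) (q : F -> R) :
  {within `[a, b] `*` [set: E], continuous B} ->
  (forall t, t \in `[a, b] -> forall (c : R) v, B (t, c *: v) = c *: B (t, v)) ->
  continuous_seminorm q ->
  exists2 Q : E -> R, continuous_seminorm Q &
    forall t v, t \in `[a, b] -> q (B (t, v)) <= Q v.
Proof.
move=> Bc Bh qs.
have jc : jointly_continuous `[a, b] (0 : R) (fun t _ v => B (t, v)).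
  move=> t v tab A BA.
  move/subspace_continuousP : Bc => /(_ (t, v) (conj tab I) A BA).
  move=> [[/= P Q] [tP vQ] PQ].
  exists (P, [set z : R * E | Q z.2]) => /=.
    by split=> //; exists (setT, Q) => //=; [split=> //; exact: filterT|move=> [? ?] []].
  by move=> [s [f w]] [/= Ps Qw] sab; apply: (PQ (s, w)).
have hom : \forall f \near (0 : R), forall x, `[a, b]%classic x ->
    forall (c : R) v, B (x, c *: v) = c *: B (x, v).
  by apply: (@filterE _ (nbhs (0 : R))) => _; exact: Bh.
have [Q Qs qQ] := uniform_seminorm_bound (@segment_compact R a b) jc hom qs.
by exists Q => // t v tab; exact: (nbhs_singleton qQ).
Qed.

Lemma Lfunctions_comp_linear k E F a b (f : R -> E) (B : R * E -> F) :
  {within `[a, b] `*` [set: E], continuous B} ->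
  (forall t, t \in `[a, b] -> forall (c : R) v, B (t, c *: v) = c *: B (t, v)) ->
  Lfunctions k a b f -> Lfunctions k a b (fun t => B (t, f t)).
Proof.
move=> Bc Bh; apply: Lfunctions_comp => // q qs.
exact: (within_seminorm_bound Bc Bh qs).
Qed.

End LinearSuperposition.

Section ChainRule.
Context {R : realType} {E F : lcsType R}.
Variables (k : Lkind R) (a b : R) (U : set E) (Phi : E -> F) (dPhi : E * E -> F)
  (h gamma : R -> E).
Hypotheses (ab : a <= b) (oU : open U) (PhiC : C1_on U Phi dPhi)
  (hc : {within `[a, b], continuous h})
  (hU : forall t, t \in `[a, b] -> U (h t))
  (gk : Lfunctions k a b gamma)
  (hg : forall t, t \in `[a, b] ->
     exists2 v, is_weak_integral a t gamma v & h t = h a + v).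

Let Gamma t := dPhi (h t, gamma t).

Lemma chain_rule_Lfunctions : Lfunctions k a b Gamma.
Proof.
apply: (Lfunctions_comp_linear (B := fun p => dPhi (h p.1, p.2))) gk.
  apply/subspace_continuousP => -[t v] [/= tab _].
  have := PhiC.2 (h t, v) (conj (hU tab) I).
  apply: cvg_comp.
  apply: cvg_pair; last by apply: cvg_within_filter; exact: cvg_snd.
  move/subspace_continuousP : hc => /(_ t tab) ht A /ht hA.
  exists ([set s | `[a, b]%classic s -> A (h s)], setT).
    by split => //; exact: filterT.
  by move=> [s w] [/= As _] [sab _]; exact: As.
by move=> t tab c v /=; apply: (C1_scale _ _ (hU tab) PhiC).
Qed.

Lemma Rintegral_itv_split (r s t : R) (g : R -> R) : r <= s -> s <= t ->
  leb.-integrable `[r, t] (EFin \o g) ->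
  Rintegral leb `[r, t] g = Rintegral leb `[r, s] g + Rintegral leb `[s, t] g.
Proof.
move=> rs st gi; rewrite /Rintegral (itv_integral_split rs st gi) fineD//.
  apply: integrable_fin_num; first exact: itv_lmeas.
  by apply: integrableS gi; [exact: itv_lmeas|exact: itv_lmeas|exact: itv_subset].
apply: integrable_fin_num; first exact: itv_lmeas.
by apply: integrableS gi; [exact: itv_lmeas|exact: itv_lmeas|exact: itv_subset].
Qed.

Lemma primitive_functional (l : {linear E -> R^o}) s t : continuous (l : E -> R) ->
  a <= s -> s <= t -> t <= b ->
  (l (h t - h s) : R) = Rintegral leb `[s, t] (fun r => l (gamma r)).
Proof.
move=> lc as_ st tb.
have li : leb.-integrable `[a, t] (EFin \o (fun r => l (gamma r) : R)).
  exact: (functional_integrable (Lfunctions_restrict (lexx a) tb gk) lc).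
have tab : t \in `[a, b] by rewrite in_itv/= (le_trans as_ st).
have sab : s \in `[a, b] by rewrite in_itv/= as_ (le_trans st).
have [v /(_ l lc)[_ lv] hv] := hg tab; have [w /(_ l lc)[_ lw] hw] := hg sab.
have -> : h t - h s = v - w by rewrite hv hw opprD addrACA subrr add0r.
have := Rintegral_itv_split as_ st li.
by rewrite /Rintegral -lv -lw /= linearB => ->; rewrite addrC addKr.
Qed.

Let hh := h \o clamp a b.

Let hhc : continuous hh. Proof. exact: comp_clamp_continuous. Qed.

(* The point of parameter [x.2] on the segment from [h (x.1 + f.1)] to
   [h (x.1 + f.2)].  For [x.1 = r], [f.1 = s - r] and [f.2 = t - r] this is the
   segment from [h s] to [h t], so that the parameter [f] tends to 0 with
   [t - s] and the uniform estimates at [f = 0] apply. *)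
Let xi (x f : R * R) : E := hh (x.1 + f.1) + x.2 *: (hh (x.1 + f.2) - hh (x.1 + f.1)).

Let xi_continuous (p : (R * R) * (R * R)) :
  (fun z : (R * R) * (R * R) => xi z.1 z.2) @ p --> xi p.1 p.2.
Proof.
have c1 : (fun z : (R * R) * (R * R) => z.1.1) @ p --> p.1.1.
  by apply: (@cvg_comp _ _ _ fst fst); exact: cvg_fst.
have c2 : (fun z : (R * R) * (R * R) => z.1.2) @ p --> p.1.2.
  by apply: (@cvg_comp _ _ _ fst snd); [exact: cvg_fst|exact: cvg_snd].
have c3 : (fun z : (R * R) * (R * R) => z.2.1) @ p --> p.2.1.
  by apply: (@cvg_comp _ _ _ snd fst); [exact: cvg_snd|exact: cvg_fst].
have c4 : (fun z : (R * R) * (R * R) => z.2.2) @ p --> p.2.2.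
  by apply: (@cvg_comp _ _ _ snd snd); exact: cvg_snd.
have h1 : (fun z : (R * R) * (R * R) => hh (z.1.1 + z.2.1)) @ p --> hh (p.1.1 + p.2.1).
  by apply: cvg_comp; [exact: (cvgD c1 c3)|exact: hhc].
have h2 : (fun z : (R * R) * (R * R) => hh (z.1.1 + z.2.2)) @ p --> hh (p.1.1 + p.2.2).
  by apply: cvg_comp; [exact: (cvgD c1 c4)|exact: hhc].
by apply: tvs_cvgD => //; apply: tvs_cvgZ => //; exact: tvs_cvgB.
Qed.

Let K : set (R * R) := `[a, b] `*` `[0, 1].

Let cK : compact K. Proof. by apply: compact_setX; exact: segment_compact. Qed.

Let xi0 x : K x -> xi x (0, 0) = h x.1.
Proof. by move=> [xab _]; rewrite /xi /= !addr0 subrr scaler0 addr0 /hh /= clampE. Qed.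

Let xiU : \forall f \near ((0, 0) : R * R), K `<=` (fun x => U (xi x f)).
Proof.
apply: ((compact_near_coveringP _).1 cK (R * R)%type (nbhs ((0, 0) : R * R))
  (fun f x => U (xi x f)) _) => x Kx.
have nU : nbhs (xi x (0, 0)) U.
  by apply: open_mem_nbhs => //; rewrite xi0//; exact: (hU Kx.1).
exact: (@xi_continuous (x, (0, 0)) _ nU).
Qed.

Let jc : jointly_continuous K ((0, 0) : R * R) (fun x f v => dPhi (xi x f, v)).
Proof.
move=> x v Kx; apply: cvg_within_filter.
have Ux : (U `*` [set: E]) (xi x (0, 0), v).
  by split => //=; rewrite xi0//; exact: (hU Kx.1).
have c0 : (fun z : (R * R) * ((R * R) * E) => (z.1, z.2.1)) @
    (x, (((0, 0) : R * R), v)) --> (x, ((0, 0) : R * R)).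
  move=> A [[/= P Q] [Px Q0] PQ]; exists (P, [set z : (R * R) * E | Q z.1]) => /=.
    split=> //; exists (Q, setT); first by split => //; exact: filterT.
    by move=> [? ?] [].
  by move=> [y [f w]] [/= Py Qf]; exact: (PQ (y, f)).
have c1 : (fun z : (R * R) * ((R * R) * E) => (xi z.1 z.2.1, z.2.2)) @
    (x, (((0, 0) : R * R), v)) --> (xi x (0, 0), v).
  have c2 : (fun z : (R * R) * ((R * R) * E) => xi z.1 z.2.1) @
      (x, (((0, 0) : R * R), v)) --> xi x (0, 0).
    by move=> A hA; exact: (c0 _ (@xi_continuous (x, (0, 0)) A hA)).
  apply: cvg_pair; first exact: c2.
  by apply: (@cvg_comp _ _ _ snd snd); exact: cvg_snd.
by move=> A hA; exact: (c1 _ (PhiC.2 _ Ux A hA)).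
Qed.

Variables (l : {linear F -> R^o}).
Hypothesis lc : continuous (l : F -> R).

Let GammaL : leb.-integrable `[a, b] (EFin \o (fun r => l (Gamma r) : R)).
Proof. exact: (functional_integrable chain_rule_Lfunctions lc). Qed.

(** By the mean value theorem, the increment of [l \o Phi \o h] from [s] to [t]
    is [M (h t - h s)] with [M v = l (dPhi (y, v))] for some [y] on the segment
    from [h s] to [h t], hence the integral of [M \o gamma].  When [t - s] is
    small, [M (gamma r)] differs from [l (dPhi (h r, gamma r))] by at most [e1]
    if [gamma r] lies in the compact set [C], and by at most [2 * Q (gamma r)]
    otherwise; [C] is such that the integral of the latter bound is small. *)
Lemma chain_rule_local (e : R) : 0 < e -> exists (w : R -> R) (d : R),
  [/\ leb.-integrable `[a, b] (EFin \o w), (forall t, 0 <= w t),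
      Rintegral leb `[a, b] w <= e, 0 < d &
      forall s t, a <= s -> s <= t -> t <= b -> t - s < d ->
        `|(l (Phi (h t) - Phi (h s)) : R) -
            Rintegral leb `[s, t] (fun r => l (Gamma r))| <=
        Rintegral leb `[s, t] w].
Proof.
move=> e0; have ls := linear_abs_seminorm lc.
have hom : \forall f \near ((0, 0) : R * R), forall x, K x -> forall (c : R) v,
    dPhi (xi x f, c *: v) = c *: dPhi (xi x f, v).
  apply: filterS xiU => f Uf x Kx c v.
  by apply: (C1_scale _ _ _ PhiC); exact: Uf.
have [Q Qs qQ] := uniform_seminorm_bound cK jc hom ls.
pose g r := 2 * Q (gamma r).
have Q0 v : 0 <= Q v by exact: seminorm_ge0.
have g0 r : 0 <= g r by rewrite mulr_ge0.
have gi : leb.-integrable `[a, b] (EFin \o g).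
  have := integrableZl (itv_lmeas _) 2 (Lfunctions_integrable_seminorm gk Qs).
  exact.
have e2 : 0 < e / 2 by rewrite divr_gt0.
have [A [C [mA Aab cC gC IA]]] := strongly_measurable_tight
  (Lfunctions_strongly_measurable gk) gi (fun t _ => g0 t) e2.
(* The constant [e1] contributes at most [e / 2] to the integral of [w]; the
   denominator is positive even if [a = b]. *)
pose e1 := e / 2 / (b - a + 1).
have ba0 : 0 < b - a + 1 by rewrite ltr_wpDl// subr_ge0.
have e10 : 0 < e1 by rewrite divr_gt0.
have sm := uniform_small cK jc cC ls e10.
have [d d0 hd] : exists2 d : R, 0 < d & forall u u' : R, `|u| < d -> `|u'| < d ->
    [/\ forall x, K x -> U (xi x (u, u')),
      forall x, K x -> forall v, `|(l (dPhi (xi x (u, u'), v)) : R)| <= Q v &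
      forall x v, K x -> C v ->
        `|(l (dPhi (xi x (u, u'), v) - dPhi (xi x (0, 0), v)) : R)| < e1].
  have := filterI xiU (filterI qQ sm).
  move=> [[/= P P'] [/nbhs_ballP[r r0 rP] /nbhs_ballP[r' r0' rP']] PP].
  exists (Num.min r r'); first by rewrite lt_min r0.
  move=> u u' ur ur'; have [|? [? ?]] := PP (u, u'); last by split.
  split; [apply: rP|apply: rP']; rewrite /ball/= sub0r normrN.
    by rewrite (lt_le_trans ur)// ge_min lexx.
  by rewrite (lt_le_trans ur')// ge_min lexx orbT.
pose D := `[a, b] `\` A.
have mD : lmeas D by apply: lmeasD => //; exact: itv_lmeas.
have mgD : measurable_fun (`[a, b] : set (lebR R)) (g \_ D).
  apply: ((measurable_restrict (g : lebR R -> R) mD (itv_lmeas `[a, b])).1).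
  apply: measurable_funS (itv_lmeas _) (@subIsetl _ _ _) _.
  by apply/measurable_EFinP; exact: (measurable_int _ gi).
have gD0 t : 0 <= (g \_ D) t by rewrite patchE; case: ifP.
have gDi : leb.-integrable `[a, b] (EFin \o (g \_ D)).
  apply: (le_integrable_real (itv_lmeas _) mgD _ gi) => t _.
  by rewrite ger0_norm// patchE; case: ifP.
pose w t := e1 + (g \_ D) t.
have wi : leb.-integrable `[a, b] (EFin \o w).
  exact: (integrableD (itv_lmeas _) (integrable_cst_itv a b e1) gDi).
have w0 t : 0 <= w t by rewrite addr_ge0// ltW.
exists w, d; split=> //.
  rewrite /w RintegralD//; last 2 first.
  - exact: itv_lmeas.
  - exact: integrable_cst_itv.
  rewrite Rintegral_cst; last exact: itv_lmeas.
  rewrite [X in _ * fine X]leb_itv//= -Rintegral_mkcondr.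
  rewrite (_ : `[a, b] `&` D = D); last by apply/setIidr => t [].
  have h1 : e1 * (b - a) <= e / 2.
    by rewrite /e1 mulrAC ler_pdivrMr// ler_pM2l// lerDl.
  have h2 : Rintegral leb D g <= e / 2.
    have gDfin : (\int[leb]_(t in D) (g t)%:E)%E \is a fin_num.
      apply: integrable_fin_num => //.
      by apply: integrableS gi; [exact: itv_lmeas|exact: mD|move=> t []].
    by move: IA; rewrite -(fineK gDfin) lee_fin.
  by rewrite [leRHS]splitr; exact: lerD.
move=> s t as_ st tb std.
have sab : s \in `[a, b] by rewrite in_itv/= as_ (le_trans st).
have tab : t \in `[a, b] by rewrite in_itv/= tb (le_trans as_).
have sub : `[s, t] `<=` `[a, b] by exact: itv_subset.
have sti (f : R -> R) : leb.-integrable `[a, b] (EFin \o f) ->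
    leb.-integrable `[s, t] (EFin \o f).
  by move=> fi; apply: integrableS fi; [exact: itv_lmeas|exact: itv_lmeas|].
have xiE r th : r \in `[s, t] -> xi (r, th) (s - r, t - r) = h s + th *: (h t - h s).
  move=> _; rewrite /xi /hh /=.
  have -> : r + (s - r) = s by rewrite addrC subrK.
  have -> : r + (t - r) = t by rewrite addrC subrK.
  by rewrite !clampE.
have near_d r : r \in `[s, t] -> `|s - r| < d /\ `|t - r| < d.
  rewrite in_itv/= => /andP[sr rt]; split.
    by rewrite ler0_norm ?subr_le0// opprB (le_lt_trans _ std)// lerD2r.
  by rewrite ger0_norm ?subr_ge0// (le_lt_trans _ std)// lerD2l lerN2.
have sst : s \in `[s, t] by rewrite in_itv/= lexx.
have Useg th : 0 <= th <= 1 -> U (h s + th *: (h t - h s)).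
  move=> th01; have [d1 d2] := near_d s sst.
  have [HU _ _] := hd _ _ d1 d2; rewrite -(xiE s th sst); apply: HU.
  by split => //=; rewrite in_itv.
have [th th01] := mean_value_functional lc
  (fun th hth => PhiC.1 _ (h t - h s) (Useg th hth)).
have -> : h s + (h t - h s) = h t by rewrite addrC subrK.
move=> ->.
set y := h s + th *: (h t - h s).
have Uy : U y by exact: Useg.
pose m (v : E) : R^o := l (dPhi (y, v)).
have mlin : linear m.
  by move=> c v v'; rewrite /m (C1_linear _ _ _ oU Uy PhiC) linearP.
pose isL := GRing.isLinear.Build R E R^o *:%R m mlin.
pose M : {linear E -> R^o} := HB.pack m isL.
have Mc : continuous (M : E -> R).
  move=> v; rewrite /M /= /m.
  have c1 : (fun v => (y, v)) @ v --> (y, v) by apply: cvg_pair; [exact: cvg_cst|exact: cvg_id].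
  apply: (@cvg_comp _ _ _ (fun v => dPhi (y, v)) (l : F -> R) _ (nbhs (dPhi (y, v)))).
    by move=> A' hA'; exact: (c1 _ (PhiC.2 (y, v) (conj Uy I) _ hA')).
  exact: lc.
have -> : (l (dPhi (y, h t - h s)) : R) = M (h t - h s) by [].
rewrite (primitive_functional Mc as_ st tb).
have Mi : leb.-integrable `[s, t] (EFin \o (fun r => M (gamma r) : R)).
  by apply: sti; exact: (functional_integrable gk Mc).
have Gi := sti _ GammaL.
rewrite -RintegralB//; last exact: itv_lmeas.
have Di : leb.-integrable `[s, t]
    (EFin \o (fun r => (M (gamma r) : R) - l (Gamma r))).
  exact: (integrableB (itv_lmeas _) Mi Gi).
apply: (le_trans (le_normr_Rintegral (itv_lmeas _) Di)).
apply: le_Rintegral.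
- exact: itv_lmeas.
- by have := integrable_abse Di; apply.
- exact: sti.
move=> r rst; have [d1 d2] := near_d r rst.
have [_ Hq Hs] := hd _ _ d1 d2.
have Kr : K (r, th) by split; [exact: sub|rewrite /= in_itv].
have rab : r \in `[a, b] by exact: sub.
have yE : xi (r, th) (s - r, t - r) = y by rewrite xiE.
have hE : xi (r, th) (0, 0) = h r by rewrite xi0.
rewrite /w patchE; case: ifPn => [_|/negP rD].
  have := Hq _ Kr (gamma r); rewrite yE => h1.
  have dd0 : `|0 : R| < d by rewrite normr0.
  have [_ Hq0 _] := hd _ _ dd0 dd0.
  have := Hq0 _ Kr (gamma r); rewrite hE => h2.
  apply: (le_trans (ler_normB _ _)).
  apply: (@le_trans _ _ (Q (gamma r) + Q (gamma r))); first exact: lerD.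
  by rewrite /g mulrDl mul1r lerDr ltW.
have rA : A r.
  by apply: contrapT => nA; apply: rD; rewrite inE; split.
have := Hs _ (gamma r) Kr (gC _ (ex_intro2 _ _ r rA erefl)).
by rewrite yE hE linearB addr0 => /ltW.
Qed.

(** The local estimates are added up over steps of length [d / 2]. *)
Lemma chain_rule_functional t : t \in `[a, b] ->
  (l (Phi (h t) - Phi (h a)) : R) = Rintegral leb `[a, t] (fun r => l (Gamma r)).
Proof.
move=> tab; apply/eqP; rewrite -subr_eq0 -normr_le0; apply/ler_addgt0Pr => e e0.
rewrite add0r; have [w [d [wi w0 we d0 hw]]] := chain_rule_local e0.
have tb : t <= b by move: tab; rewrite in_itv/= => /andP[].
have at_ : a <= t by move: tab; rewrite in_itv/= => /andP[].
pose D s := (l (Phi (h s) - Phi (h a)) : R) -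
  Rintegral leb `[a, s] (fun r => l (Gamma r)).
have step n : forall s, a <= s -> s <= b -> s <= a + n%:R * (d / 2) ->
    `|D s| <= Rintegral leb `[a, s] w.
  elim: n => [|n IH] s as_ sb sn.
    have -> : s = a by apply/eqP; rewrite eq_le as_ andbT; move: sn; rewrite mul0r addr0.
    have gi : leb.-integrable `[a, a] (EFin \o (fun r => l (Gamma r) : R)).
      by apply: integrableS GammaL; [exact: itv_lmeas|exact: itv_lmeas|exact: itv_subset].
    have := Rintegral_itv_split (lexx a) (lexx a) gi.
    rewrite -[LHS]addr0 => /addrI z.
    by rewrite /D subrr linear0 -z subr0 normr0 Rintegral_ge0.
  pose r := Num.max a (s - d / 2).
  have ar : a <= r by rewrite /r le_max lexx.
  have d2 : 0 < d / 2 by rewrite divr_gt0.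
  have rs : r <= s by rewrite /r ge_max as_/= lerBlDr lerDl ltW.
  have rb : r <= b by rewrite (le_trans rs).
  have rn : r <= a + n%:R * (d / 2).
    rewrite /r ge_max; apply/andP; split.
      by rewrite lerDl mulr_ge0// ltW// divr_gt0.
    by move: sn; rewrite -natr1 mulrDl mul1r lerBlDr addrA.
  have rd : s - r < d.
    rewrite ltrBlDr -ltrBlDl (@lt_le_trans _ _ (s - d / 2))//.
      by rewrite ltrD2l ltrN2 gtr_pMr// invf_lt1// ltr1n.
    by rewrite /r le_max lexx orbT.
  have h1 := IH r ar rb rn.
  have h2 := hw r s ar rs sb rd.
  have gi : leb.-integrable `[a, s] (EFin \o (fun r => l (Gamma r) : R)).
    by apply: integrableS GammaL; [exact: itv_lmeas|exact: itv_lmeas|exact: itv_subset].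
  have wi' : leb.-integrable `[a, s] (EFin \o w).
    by apply: integrableS wi; [exact: itv_lmeas|exact: itv_lmeas|exact: itv_subset].
  rewrite (Rintegral_itv_split ar rs wi').
  have -> : D s = D r + ((l (Phi (h s) - Phi (h r)) : R) -
      Rintegral leb `[r, s] (fun r => l (Gamma r))).
    rewrite /D (Rintegral_itv_split ar rs gi) !linearB/=; ring.
  by apply: (le_trans (ler_normD _ _)); exact: lerD.
have [n hn] : exists n, t <= a + n%:R * (d / 2).
  exists (Num.bound ((t - a) / (d / 2))).
  rewrite -lerBlDl -ler_pdivrMr ?divr_gt0//; apply/ltW/archi_boundP.
  by rewrite divr_ge0// ?subr_ge0// ltW// divr_gt0.
apply: (le_trans (step n t at_ tb hn)); apply: le_trans we.
rewrite (Rintegral_itv_split at_ tb wi) lerDl.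
by apply: Rintegral_ge0.
Qed.

End ChainRule.

(** Here [h] has a density only in the weak sense, so that [Phi \o h] cannot be
    differentiated pointwise; increments are estimated instead. *)
Lemma chain_rule_weak_integral (R : realType) (E F : lcsType R) (k : Lkind R)
    (a b : R) (U : set E) (Phi : E -> F) (dPhi : E * E -> F) (h gamma : R -> E) :
  a <= b -> open U -> C1_on U Phi dPhi -> {within `[a, b], continuous h} ->
  (forall t, t \in `[a, b] -> U (h t)) -> Lfunctions k a b gamma ->
  (forall t, t \in `[a, b] ->
     exists2 v, is_weak_integral a t gamma v & h t = h a + v) ->
  forall t, t \in `[a, b] ->
  exists2 v, is_weak_integral a t (fun t => dPhi (h t, gamma t)) v &
    Phi (h t) = Phi (h a) + v.
Proof.
move=> ab oU PhiC hc hU gk hg t tab.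
exists (Phi (h t) - Phi (h a)); last by rewrite addrC subrK.
move=> l lc; have Gk := chain_rule_Lfunctions PhiC hc hU gk.
have tb : t <= b by move: tab; rewrite in_itv/= => /andP[].
have li := functional_integrable (Lfunctions_restrict (lexx a) tb Gk) lc.
split; first exact: li.
rewrite (chain_rule_functional ab oU PhiC hc hU gk hg lc tab) /Rintegral fineK//.
by apply: integrable_fin_num => //; exact: itv_lmeas.
Qed.

(** * Superposition along integral curves *)

Section WeakIntegralPair.
Context {R : realType}.
Implicit Types E F : lcsType R.

Lemma weak_integral_pair E F (a b : R) (f : R -> E) (g : R -> F) v w :
  is_weak_integral a b f v -> is_weak_integral a b g w ->
  is_weak_integral a b (fun t => (f t, g t) : (E * F)%type) (v, w).
Proof.
move=> fv gw l lc.
pose l1 (y : E) : R^o := l (y, 0).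
pose l2 (y : F) : R^o := l (0, y).
have l1lin : linear l1.
  by move=> r y z; rewrite /l1 -linearP; congr (l _); congr pair => /=; rewrite scaler0 addr0.
have l2lin : linear l2.
  by move=> r y z; rewrite /l2 -linearP; congr (l _); congr pair => /=; rewrite scaler0 addr0.
pose is1 := GRing.isLinear.Build R E R^o *:%R l1 l1lin.
pose is2 := GRing.isLinear.Build R F R^o *:%R l2 l2lin.
pose L1 : {linear E -> R^o} := HB.pack l1 is1.
pose L2 : {linear F -> R^o} := HB.pack l2 is2.
have L1c : continuous (L1 : E -> R).
  move=> y; apply: (@cvg_comp _ _ _ (fun y => (y, 0 : F)) (l : _ -> R) _ (nbhs (y, 0 : F))).
    by apply: cvg_pair; [exact: cvg_id|exact: cvg_cst].
  exact: lc.
have L2c : continuous (L2 : F -> R).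
  move=> y; apply: (@cvg_comp _ _ _ (fun y => (0 : E, y)) (l : _ -> R) _ (nbhs (0 : E, y))).
    by apply: cvg_pair; [exact: cvg_cst|exact: cvg_id].
  exact: lc.
have lE y z : (l (y, z) : R) = L1 y + L2 z.
  rewrite /L1 /L2 /= /l1 /l2 -linearD; congr (l _).
  by congr pair => /=; rewrite ?addr0 ?add0r.
have [i1 e1] := fv L1 L1c; have [i2 e2] := gw L2 L2c.
have fgE : (fun t => (l (f t, g t) : R)%:E) =
    ((fun t => (L1 (f t) : R)%:E) \+ (fun t => (L2 (g t) : R)%:E))%E.
  by apply/funext => t; rewrite lE EFinD.
rewrite fgE; split; first exact: (integrableD (itv_lmeas _) i1 i2).
by rewrite (integralD (itv_lmeas _) i1 i2) -e1 -e2 lE EFinD.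
Qed.

End WeakIntegralPair.

Section Superposition.
Context {R : realType} {X E F : lcsType R} {k : Lkind R} {a b : R}.
Variables (c d : R) (f0 : vLspace k a b X) (V : set E) (Hm : E * X -> E)
  (x : vLspace k a b X -> R -> E) (U : set (E * E)) (Phi : E * E -> F)
  (dPhi : (E * E) * (E * E) -> F).
Hypotheses (ac : a <= c) (cd : c <= d) (db : d <= b)
  (Hc : continuous_on (V `*` [set: X]) Hm)
  (Hlin : forall y, V y -> forall (r : R) v w,
     Hm (y, r *: v + w) = r *: Hm (y, v) + Hm (y, w))
  (oU : open U) (Phic : continuous_on U Phi) (PhiC : C1_on U Phi dPhi).

(** [x f] is the coordinate of the solution for the control [f], and [Hm] the
    coordinate of the vector fields driving it; [U] is the domain in which the
    pair with the reference curve [x f0] has to stay. *)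
Definition flows_along (f : vLspace k a b X) :=
  [/\ {within `[c, d], continuous (x f)},
      forall t, t \in `[c, d] -> U (x f0 t, x f t),
      forall t, t \in `[c, d] -> V (x f t) &
      forall t, t \in `[c, d] ->
        exists2 v, is_weak_integral c t (fun s => Hm (x f s, f s)) v &
          x f t = x f c + v].

Hypotheses (g0 : flows_along f0) (gf : \forall f \near f0, flows_along f)
  (xc : forall t, t \in `[c, d] ->
     (fun z : R * vLspace k a b X => x z.2 z.1) @
        within [set z | z.1 \in `[c, d]] (nbhs (t, f0)) --> x f0 t).

(** [velocity t f (f0 t, f t)] is the density of [Phi (x f0 t, x f t)]. *)
Definition velocity t f (v : X * X) : F :=
  dPhi ((x f0 t, x f t), (Hm (x f0 t, v.1), Hm (x f t, v.2))).

Lemma velocity_linear f t : flows_along f -> t \in `[c, d] ->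
  forall (r : R) v w, velocity t f (r *: v + w) = r *: velocity t f v + velocity t f w.
Proof.
move=> [_ fU fV _] tcd r v w; have [_ _ f0V _] := g0.
rewrite /velocity /= !Hlin; [|exact: fV|exact: f0V].
by rewrite -(C1_linear r _ _ oU (fU _ tcd) PhiC).
Qed.

Lemma velocity_scale f t : flows_along f -> t \in `[c, d] ->
  forall (r : R) v, velocity t f (r *: v) = r *: velocity t f v.
Proof.
move=> hf tcd r v.
have h0 : velocity t f 0 = 0.
  have := velocity_linear hf tcd 1 0 0; rewrite !scale1r addr0 => /eqP.
  by rewrite -subr_eq subrr eq_sym => /eqP.
by have := velocity_linear hf tcd r v 0; rewrite !addr0 h0 addr0.
Qed.

Lemma velocity_cvg (T : Type) (G : set_system T) (y0 y : T -> E) (v w : T -> X) t f v0 :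
  Filter G -> U (x f0 t, x f t) -> V (x f0 t) -> V (x f t) ->
  y0 @ G --> x f0 t -> y @ G --> x f t -> v @ G --> v0.1 -> w @ G --> v0.2 ->
  (fun z => dPhi ((y0 z, y z), (Hm (y0 z, v z), Hm (y z, w z)))) @ G --> velocity t f v0.
Proof.
move=> GF Ut V0 Vt cy0 cy cv cw.
have H1 : (fun z => Hm (y0 z, v z)) @ G --> Hm (x f0 t, v0.1).
  apply: (@cvg_comp _ _ _ (fun z => (y0 z, v z)) Hm _ (nbhs (x f0 t, v0.1))).
    exact: cvg_pair.
  exact: (Hc (conj V0 I : (V `*` [set: X]) (x f0 t, v0.1))).
have H2 : (fun z => Hm (y z, w z)) @ G --> Hm (x f t, v0.2).
  apply: (@cvg_comp _ _ _ (fun z => (y z, w z)) Hm _ (nbhs (x f t, v0.2))).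
    exact: cvg_pair.
  exact: (Hc (conj Vt I : (V `*` [set: X]) (x f t, v0.2))).
apply: (@cvg_comp _ _ _ (fun z => ((y0 z, y z), (Hm (y0 z, v z), Hm (y z, w z)))) dPhi _
  (nbhs ((x f0 t, x f t), (Hm (x f0 t, v0.1), Hm (x f t, v0.2))))).
  exact: (cvg_pair (cvg_pair cy0 cy) (cvg_pair H1 H2)).
exact: (PhiC.2 ((x f0 t, x f t), _) (conj Ut I)).
Qed.

Lemma velocity_continuous f : flows_along f ->
  {within `[c, d] `*` [set: (X * X)%type],
     continuous (fun p : R * (X * X) => velocity p.1 f p.2)}.
Proof.
move=> [fc fU fV _]; have [f0c _ f0V _] := g0.
apply/subspace_continuousP => -[t v0] [/= tcd _].
have hx g : {within `[c, d], continuous (x g)} ->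
    (fun z : R * (X * X) => x g z.1) @
      within (`[c, d] `*` setT) (nbhs (t, v0)) --> x g t.
  move=> /subspace_continuousP /(_ t tcd) gt A /gt hA.
  exists ([set s | `[c, d]%classic s -> A (x g s)], setT).
    by split => //; exact: filterT.
  by move=> [s w] [/= As _] [sab _]; exact: As.
apply: velocity_cvg; [exact: fU|exact: f0V|exact: fV|exact: hx|exact: hx| |].
- by apply: cvg_within_filter; apply: (@cvg_comp _ _ _ snd fst); [exact: cvg_snd|exact: cvg_fst].
- by apply: cvg_within_filter; apply: (@cvg_comp _ _ _ snd snd); exact: cvg_snd.
Qed.

Lemma velocity_jointly_continuous : jointly_continuous `[c, d] f0 velocity.
Proof.
move=> t v0 tcd; have [f0c f0U f0V _] := g0.
apply: velocity_cvg; [exact: f0U|exact: f0V|exact: f0V| | | |].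
- move/subspace_continuousP : f0c => /(_ t tcd) gt A /gt hA.
  exists ([set s | `[c, d]%classic s -> A (x f0 s)], setT).
    by split => //; exact: filterT.
  by move=> [s w] [/= As _] sab; exact: As.
- move=> A /(xc tcd)[[/= P Q] [tP fQ] PQ].
  exists (P, [set z : vLspace k a b X * (X * X) | Q z.1]).
    by split=> //=; exists (Q, setT) => [|[? ?] []//]; split => //; exact: filterT.
  by move=> [s [f w]] [/= Ps Qf] scd; exact: (PQ (s, f)).
- apply: cvg_within_filter; apply: (@cvg_comp _ _ _ snd (fun z => z.2.1)).
    exact: cvg_snd.
  by apply: (@cvg_comp _ _ _ snd fst); [exact: cvg_snd|exact: cvg_fst].
- apply: cvg_within_filter; apply: (@cvg_comp _ _ _ snd (fun z => z.2.2)).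
    exact: cvg_snd.
  by apply: (@cvg_comp _ _ _ snd snd); exact: cvg_snd.
Qed.

Lemma restricted_Lfunctions (f : vLspace k a b X) : Lfunctions k c d f.
Proof. exact: (Lfunctions_restrict ac db (Lrepr_Lfunctions f)). Qed.

Lemma velocity_Lfunctions f : flows_along f ->
  Lfunctions k c d (fun t => velocity t f (f0 t, f t)).
Proof.
move=> hf; apply: (Lfunctions_comp_linear (velocity_continuous hf)).
  by move=> t tcd r v; exact: velocity_scale.
by apply: Lfunctions_pair; exact: restricted_Lfunctions.
Qed.

Lemma flow_velocity_Lfunctions f : flows_along f ->
  Lfunctions k c d (fun s => Hm (x f s, f s)).
Proof.
move=> [fc _ fV _].
apply: (Lfunctions_comp_linear (B := fun p => Hm (x f p.1, p.2))).
- apply/subspace_continuousP => -[t v0] [/= tcd _].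
  apply: (@cvg_comp _ _ _ (fun z : R * X => (x f z.1, z.2)) Hm _ (nbhs (x f t, v0))).
    apply: cvg_pair; last by apply: cvg_within_filter; exact: cvg_snd.
    move/subspace_continuousP : fc => /(_ t tcd) gt A /gt hA.
    exists ([set s | `[c, d]%classic s -> A (x f s)], setT).
      by split => //; exact: filterT.
    by move=> [s w] [/= As _] [sab _]; exact: As.
  exact: (Hc (conj (fV _ tcd) I : (V `*` [set: X]) (x f t, v0))).
- move=> t tcd r v /=; have := Hlin (fV _ tcd) r v 0.
  have h0 : Hm (x f t, 0) = 0.
    have := Hlin (fV _ tcd) 1 0 0; rewrite !scale1r addr0 => /eqP.
    by rewrite -subr_eq subrr eq_sym => /eqP.
  by rewrite addr0 h0 addr0.
- exact: restricted_Lfunctions.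
Qed.

Lemma superposition_AC f : flows_along f ->
  AC_vec k c d (fun t => Phi (x f0 t, x f t)) /\
  ae_eq_on c d (AC_deriv k c d (fun t => Phi (x f0 t, x f t)))
    (fun t => velocity t f (f0 t, f t)).
Proof.
move=> hf; apply: weak_integral_density => //; first exact: velocity_Lfunctions.
have [f0c _ _ f0i] := g0; have [fc fU _ fi] := hf.
apply: (@chain_rule_weak_integral R (E * E)%type F k c d U Phi dPhi
  (fun t => (x f0 t, x f t)) (fun s => (Hm (x f0 s, f0 s), Hm (x f s, f s)))) => //.
- move/subspace_continuousP : f0c => f0c; move/subspace_continuousP : fc => fc.
  by apply/subspace_continuousP => t tcd; apply: cvg_pair; [exact: f0c|exact: fc].
- by apply: Lfunctions_pair; exact: flow_velocity_Lfunctions.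
- move=> t tcd; have [v hv ev] := f0i t tcd; have [w hw ew] := fi t tcd.
  by exists (v, w); [exact: weak_integral_pair|rewrite ev ew].
Qed.

Lemma seminorm_snd (Y Z : lcsType R) (Q : Y * Z -> R) : continuous_seminorm Q ->
  continuous_seminorm (fun w : Z => Q (0, w)).
Proof.
move=> [QD QZ Qc]; split.
- move=> y z; have := QD (0, y) (0, z).
  by rewrite (_ : (0, y) + (0, z) = (0 + 0, y + z))// addr0.
- move=> r y; have := QZ r (0, y).
  by rewrite (_ : r *: (0, y) = (r *: 0, r *: y))// scaler0.
- move=> y; apply: (@cvg_comp _ _ _ (fun w => (0 : Y, w)) Q _ (nbhs (0 : Y, y))).
    by apply: cvg_pair; [exact: cvg_cst|exact: cvg_id].
  exact: Qc.
Qed.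

(** The velocities for [f] and [f0] differ by [velocity t f (0, f t - f0 t)],
    which a seminorm of [f t - f0 t] independent of [f] bounds, and by the
    change of the operator [velocity t] on the fixed pair [(f0, f0)], which is
    small by [Lreal_small]. *)
Lemma superposition_cvg :
  (fun f => AC_coord k c d (fun t => Phi (x f0 t, x f t))) @ f0 -->
  AC_coord k c d (fun t => Phi (x f0 t, x f0 t)).
Proof.
have ccd : c \in `[c, d] by rewrite in_itv/= lexx.
have [f0c f0U f0V _] := g0.
have c1 : (fun f => Phi (x f0 c, x f c)) @ f0 --> Phi (x f0 c, x f0 c).
  have xcc : x ^~ c @ f0 --> x f0 c.
    move=> A /(xc ccd)[[/= P Q] [tP fQ] PQ]; apply: filterS fQ => f Qf.
    by apply: (PQ (c, f)) => //; split => //; exact: nbhs_singleton.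
  apply: (@cvg_comp _ _ _ (fun f => (x f0 c, x f c)) Phi _ (nbhs (x f0 c, x f0 c))).
    exact: (cvg_pair (cvg_cst _) xcc).
  exact: (Phic (f0U _ ccd)).
suff c2 : (fun f => AC_deriv k c d (fun t => Phi (x f0 t, x f t))) @ f0 -->
    AC_deriv k c d (fun t => Phi (x f0 t, x f0 t)) by exact: (cvg_pair c1 c2).
apply: vLspace_cvg; first exact: (@nbhs_filter (vLspace k a b X)).
move=> q qs e e0.
have hom : \forall f \near f0, forall t, t \in `[c, d] -> forall (r : R) v,
    velocity t f (r *: v) = r *: velocity t f v.
  by apply: filterS gf => f hf t tcd r v; exact: velocity_scale.
have [Q Qs qQ] := uniform_seminorm_bound (@segment_compact R c d)
  velocity_jointly_continuous hom qs.
pose Q' := fun w : X => Q (0, w).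
have Qs' : continuous_seminorm Q' by exact: seminorm_snd.
have e3 : 0 < e / 3 by rewrite divr_gt0.
have f00 : Lfunctions k c d (fun t => (f0 t, f0 t) : (X * X)%type).
  by apply: Lfunctions_pair; exact: restricted_Lfunctions.
have sm (f : vLspace k a b X) (v : R -> X * X) : flows_along f -> strongly_measurable c d v ->
    strongly_measurable c d (fun t => velocity t f (v t)).
  by move=> hf; exact: (strongly_measurable_comp (velocity_continuous hf)).
have mw : \forall f \near f0, measurable_fun (`[c, d] : set (lebR R))
    (fun t => q (velocity t f (f0 t, f0 t) - velocity t f0 (f0 t, f0 t))).
  apply: filterS gf => f hf.
  apply: (seminorm_measurable (f := fun t => velocity t f (f0 t, f0 t) -
     velocity t f0 (f0 t, f0 t)) _ qs).
  by apply: strongly_measurableB; apply: sm => //;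
    exact: Lfunctions_strongly_measurable f00.
have small := Lreal_small velocity_jointly_continuous hom f00 qs mw e3.
have ball := Lseminorm_ball_nbhs f0 Qs' e3.
apply: filterS (filterI (filterI gf qQ) (filterI mw (filterI small ball))).
move=> f [[hf qf] [mf [sf bf]]].
have [_ df] := superposition_AC hf; have [_ df0] := superposition_AC g0.
pose w f t := q (velocity t f (f0 t, f0 t) - velocity t f0 (f0 t, f0 t)).
have mq : measurable_fun (`[a, b] : set (lebR R)) (fun t => Q' (f t - f0 t)).
  apply: (seminorm_measurable (f := fun t => f t - f0 t) _ Qs').
  by apply: strongly_measurableB; apply: Lfunctions_strongly_measurable;
    exact: Lrepr_Lfunctions.
have mqc : measurable_fun (`[c, d] : set (lebR R)) (fun t => Q' (f t - f0 t)).
  apply: measurable_funS (itv_lmeas _) _ mq; exact: itv_subset.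
have q0 v : 0 <= q v by exact: seminorm_ge0.
have Q0 v : 0 <= Q' v by exact: seminorm_ge0.
apply: (@le_lt_trans _ _ (Lreal k c d (fun t => Q' (f t - f0 t) + w f t))).
  apply: Lreal_le.
  - exact: lexx.
  - exact: lexx.
  - apply: (seminorm_measurable (f := fun t =>
      AC_deriv k c d (fun t => Phi (x f0 t, x f t)) t -
      AC_deriv k c d (fun t => Phi (x f0 t, x f0 t)) t) _ qs).
    by apply: strongly_measurableB; apply: Lfunctions_strongly_measurable;
      exact: Lrepr_Lfunctions.
  - exact: measurable_funD.
  - by move=> t _; exact: q0.
  - by move=> t _; apply: addr_ge0; [exact: Q0|exact: q0].
  move: df df0; rewrite /ae_eq_on => df df0.
  have nd := leb_null_setU df df0.
  apply: leb_null_subset nd => t /= [tcd nle].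
  apply: contrapT => /not_orP[n1 n2]; case/negP: nle.
  have -> : AC_deriv k c d (fun t => Phi (x f0 t, x f t)) t = velocity t f (f0 t, f t).
    by apply/eqP; apply: contrapT => /negP h; apply: n1.
  have -> : AC_deriv k c d (fun t => Phi (x f0 t, x f0 t)) t = velocity t f0 (f0 t, f0 t).
    by apply/eqP; apply: contrapT => /negP h; apply: n2.
  have -> : velocity t f (f0 t, f t) =
      velocity t f (0, f t - f0 t) + velocity t f (f0 t, f0 t).
    have := velocity_linear hf tcd 1 (0, f t - f0 t) (f0 t, f0 t).
    rewrite !scale1r => <-; congr (velocity t f _).
    by congr pair => /=; rewrite ?add0r ?subrK.
  case: (qs) => qD _ _; rewrite -addrA; apply: (le_trans (qD _ _)).
  by apply: lerD; [exact: (qf t tcd (0, f t - f0 t))|rewrite /w].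
apply: (@le_lt_trans _ _ (Lreal k a b (fun t => Q' (f t - f0 t)%R) + (e / 3)%:E)%E).
  apply: (le_trans (Lreal_triangle _ mqc mf)); apply: leeD => //.
  apply: Lreal_le => [//|//|||t _|t _|]; [exact: mqc|exact: mq|exact: Q0|exact: Q0|].
  rewrite [X in leb X](_ : _ = set0) ?measure0// -subset0 => t /= [_].
  by rewrite lexx.
apply: (@lt_trans _ _ ((e / 3)%:E + (e / 3)%:E)%E); first by rewrite lteD2rE.
by rewrite -EFinD lte_fin; lra.
Qed.

End Superposition.

(** * Joint continuity in time and control *)

Section InitialTopologies.

Lemma cvg_initial (S : choiceType) (T : topologicalType) (f : S -> T) (I : Type)
    (F : set_system I) (u : I -> S) (s : S) : Filter F ->
  f \o u @ F --> f s -> u @ F --> (s : initial_topology f).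
Proof.
move=> FF fu A [_ [[V oV <-] Vs VA]].
have FV := fu V (open_mem_nbhs oV Vs).
by apply: (@filterS _ F FF _ _ _ FV) => z Vz; exact: VA.
Qed.

Lemma cvg_prod_topology (J : Type) (T : J -> topologicalType) (I : Type)
    (F : set_system I) (u : I -> prod_topology T) (l : prod_topology T) : Filter F ->
  (forall j, (fun z => u z j) @ F --> l j) -> u @ F --> l.
Proof.
move=> FF ul; apply/cvg_sup => j.
exact: (@cvg_initial _ _ (fun f : (forall i, T i) => f j) _ F u l FF (ul j)).
Qed.

End InitialTopologies.

Section JointContinuity.
Context {R : realType} {E : lcsType R} {G : chartedGroupType E} {k : Lkind R}.
Variable sr : semiregular G k.

Definition evol (f : vLspace k 0 1 (lie_alg G)) : ACmap k 0 1 G :=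
  projT1 (cid (sr f).2).

Lemma evol_solution f : is_solution_on f `[0, 1] (evol f).
Proof. by rewrite /evol; case: cid => y []. Qed.

(** Through this retraction, compact subsets of the line yield compact subsets
    of the unit interval as a type of its own. *)
Definition clamp01 (r : R) : set_type (`[0, 1]%classic : set R) :=
  exist (fun x => x \in (`[0, 1]%classic : set R)) (clamp 0 1 r)
    (mem_set (clamp_itv r ler01)).

Lemma clamp01_continuous : continuous clamp01.
Proof.
move=> r; apply: (@cvg_initial _ _ (set_val : set_type (`[0, 1]%classic : set R) -> R)).
exact: clamp_continuous.
Qed.

Lemma AC_fun_continuous (y : ACmap k 0 1 G) : continuous y.
Proof.
have -> : (y : R -> G) = y \o clamp 0 1 by apply/funext => t /=; rewrite AC_clamp.
have H := comp_clamp_continuous ler01 (@AC_continuous R k 0 1 E G y).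
exact: H.
Qed.

Hypothesis evol_cvg : continuous (EvolC sr).

(** Continuity into the compact-open topology controls [evol f] on the compact
    neighbourhood [`[t - e, t + e]] of [t]; the values outside the unit interval
    are those of [clamp01]. *)
Lemma evol_jointly_continuous f0 (t : R) :
  (fun z : R * vLspace k 0 1 (lie_alg G) => evol z.2 z.1) @ (t, f0) --> evol f0 t.
Proof.
move=> A; rewrite nbhsE => -[V [oV Vt] VA].
have [e e0 he] : exists2 e : R, 0 < e & forall s, `|t - s| <= e -> V (evol f0 s).
  have /nbhs_ballP[e e0 he] := @AC_fun_continuous (evol f0) t _ (open_mem_nbhs oV Vt).
  exists (e / 2); first by rewrite divr_gt0.
  move=> s ts; apply: he; rewrite /ball/= (le_lt_trans ts)//.
  by rewrite gtr_pMr// invf_lt1// ltr1n.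
pose K := clamp01 @` `[t - e, t + e].
have cK : compact K.
  apply: continuous_compact (@segment_compact _ _ _).
  by apply: continuous_subspaceT; exact: clamp01_continuous.
have K0 : [set EvolC sr f0 x | x in K] `<=` V.
  move=> _ [_ [s sK <-] <-]; rewrite /EvolC -/(evol f0) /= AC_clamp; apply: he.
  by move: sK; rewrite /= in_itv/= ler_norml => /andP[]; lra.
have hn := @evol_cvg f0 _ (open_mem_nbhs (compact_open_open cK oV) K0).
exists ([set s | `|t - s| < e], [set f | [set EvolC sr f x | x in K] `<=` V]).
  by split=> //=; apply/nbhs_ballP; exists e.
move=> [s f] [/= ts Kf]; apply: VA.
have -> : evol f s = EvolC sr f (clamp01 s) by rewrite /EvolC -/(evol f) /= AC_clamp.
apply: Kf.
exists (clamp01 s) => //; exists s => //.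
by rewrite /= in_itv/=; move: ts; rewrite ltr_norml => /andP[]; lra.
Qed.

End JointContinuity.

Lemma uniformly_near (R : realType) (L Y : topologicalType) (y : L -> R -> Y)
    (f0 : L) (c d : R) (P : R -> Y -> Prop) :
  (forall t, (fun z : R * L => y z.2 z.1) @ (t, f0) --> y f0 t) ->
  (forall t, t \in `[c, d] -> \forall z \near (t, y f0 t), P z.1 z.2) ->
  \forall f \near f0, forall t, t \in `[c, d] -> P t (y f t).
Proof.
move=> yc hP.
apply: ((compact_near_coveringP `[c, d]).1 (@segment_compact R c d)
  L (nbhs f0) (fun f t => P t (y f t)) _) => t tcd.
have hz : (fun z : R * L => (z.1, y z.2 z.1)) @ (t, f0) --> (t, y f0 t).
  exact: (cvg_pair cvg_fst (yc t)).
exact: (hz _ (hP t tcd)).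
Qed.

(** * Right invariant fields and local additions in charts *)

Section RightAction.
Context {R : realType} {E : lcsType R} {G : chartedGroupType E}.
Hypothesis hG : right_half_lie G.
Hypothesis tau_continuous :
  continuous (fun vg : lie_alg G * G => raction vg.1 vg.2).

Let hM : is_manifold G. Proof. by case: hG. Qed.

Lemma tbase_raction (v : lie_alg G) (g : G) : tbase (raction v g) = g.
Proof. by rewrite /raction /tangent_map /= mul1g. Qed.

(** The right invariant vector fields read in the chart [c]. *)
Definition right_field (c : pchart G E) (p : E * lie_alg G) : E :=
  dchart c (raction p.2 (cinv c p.1)).

Lemma right_field_continuous c : charts G c ->
  continuous_on (ctarget c `*` [set: lie_alg G]) (right_field c).
Proof.
move=> cc [y v] [/= cy _]; have [pc _] := cc.
have c1 : cinv c @ y --> cinv c y := pchart_cinv_continuous pc cy.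
have c2 : (fun p : E * lie_alg G => (p.2, cinv c p.1)) @ (y, v) --> (v, cinv c y).
  apply: cvg_pair; first exact: cvg_snd.
  by apply: (@cvg_comp _ _ _ fst (cinv c) _ (nbhs y)) => //; exact: cvg_fst.
have dom : cdom c (tbase (raction v (cinv c y))).
  by rewrite tbase_raction; have [] := pchart_cinv pc cy.
apply: (@cvg_comp _ _ _ (fun p : E * lie_alg G => raction p.2 (cinv c p.1))
  (dchart c) _ (nbhs (raction v (cinv c y)))).
  apply: (@cvg_comp _ _ _ (fun p : E * lie_alg G => (p.2, cinv c p.1))
    (fun vg : lie_alg G * G => raction vg.1 vg.2) _ (nbhs (v, cinv c y))) => //.
  exact: (@tau_continuous (v, cinv c y)).
exact: (dchart_continuous hM cc dom).
Qed.

(** [raction v g] is the derivative at 1 of the right translation by [g] in the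
    direction [v], and right translations are smooth. *)
Lemma right_field_linear c y : charts G c -> ctarget c y ->
  forall (r : R) v w, right_field c (y, r *: v + w) =
    r *: right_field c (y, v) + right_field c (y, w).
Proof.
move=> cc cy r v w; have [pc _] := cc; have [cg _] := pchart_cinv pc cy.
rewrite /right_field /= /raction /tangent_map /=.
set g := cinv c y; have [_ _ _ /(_ g)[sc sm]] := hG.
set d0 := chart_at (1%g : G); set d1 := chart_at (1 * g : G)%g.
have [c0 d0x] : charts G d0 /\ cdom d0 1%g := chart_at_charts hM _.
have [c1 d1x] : charts G d1 /\ cdom d1 (1 * g)%g := chart_at_charts hM _.
have [p0 _] := c0; have [[d1o _ _ _ _] _] := c1.
pose W : set G := setT `&` (fun x : G => (x * g)%g) @^-1` cdom d1.
have oW : open W.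
  by apply: continuous_on_openI (openT) _ d1o; apply/within_continuous_open => //; exact: openT.
have oU : open (d0 @` (cdom d0 `&` W)) by exact: pchart_image_open.
have smo : smooth_on (d0 @` (cdom d0 `&` W)) (d1 \o (fun x : G => (x * g)%g) \o cinv d0).
  by rewrite /W setIA; exact: sm.
have Ux : (d0 @` (cdom d0 `&` W)) (d0 1%g) by exists 1%g.
rewrite (C1_linear r v w oU Ux (smooth_C1 oU smo)) /=.
by apply: (dchart_linear hM) => //; rewrite mul1g.
Qed.

End RightAction.

Section LocalAdditionInverse.
Context {R : realType} {E : lcsType R} {G : chartedType E}.
Hypothesis hM : is_manifold G.
Variable S : local_addition G.

(** The inverse of the diffeomorphism (pi, S) attached to the local addition. *)
Definition la_inv : G * G -> tangent_bundle G :=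
  projT1 (cid (la_diffeo S).2.2).

Lemma la_inv_smooth : smooth_map_on (la_img S) la_inv.
Proof. exact: (projT2 (cid (la_diffeo S).2.2)).1. Qed.

Lemma la_invK v : la_dom S v -> la_inv (tbase v, S v) = v.
Proof. exact: (projT2 (cid (la_diffeo S).2.2)).2. Qed.

Lemma la_inv_img x y : la_img S (x, y) ->
  [/\ la_dom S (la_inv (x, y)), tbase (la_inv (x, y)) = x & S (la_inv (x, y)) = y].
Proof. by move=> [v dv [<- <-]]; rewrite la_invK. Qed.

Lemma la_img_diag x : la_img S (x, x).
Proof. by exists (zero_vec x); [exact: la_dom_zero|rewrite la_map_zero]. Qed.

Definition chart_la_dom (c : pchart G E) : set (E * E) :=
  prod_chart c c @` (cdom (prod_chart c c) `&` la_img S).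

(** [la_inv] read in the charts induced by [c]. *)
Definition chart_la (c : pchart G E) : E * E -> E * E :=
  tangent_chart c \o la_inv \o cinv (prod_chart c c).

Lemma chart_la_dom_open c : charts G c -> open (chart_la_dom c).
Proof.
move=> cc; apply: pchart_image_open; last exact: la_img_open.
by apply: prod_chart_is_pchart; case: cc.
Qed.

Lemma chart_la_smooth c : charts G c -> smooth_on (chart_la_dom c) (chart_la c).
Proof.
move=> cc; have [_ sm] := la_inv_smooth.
have := sm _ _ (prod_chart_charts hM hM cc cc) (tangent_chart_charts hM cc).
rewrite (_ : _ `&` _ `&` _ = cdom (prod_chart c c) `&` la_img S)//.
apply/seteqP; split=> [[x y] []//|[x y] [[/= cx cy] xy]]; split => //=.
by have [_ -> _] := la_inv_img xy.
Qed.

Lemma chart_la_domP c x y : cdom c x -> cdom c y -> la_img S (x, y) ->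
  chart_la_dom c (c x, c y).
Proof. by move=> cx cy xy; exists (x, y). Qed.

Lemma chart_laE c x y : charts G c -> cdom c x -> cdom c y ->
  chart_la c (c x, c y) = tangent_chart c (la_inv (x, y)).
Proof.
by move=> [[_ _ cK _ _] _] cx cy; rewrite /chart_la /= !cK.
Qed.

Lemma la_inv_continuous : continuous_on (la_img S) la_inv.
Proof.
by have [sc _] := la_inv_smooth; apply/within_continuous_open => //; exact: la_img_open.
Qed.

End LocalAdditionInverse.

(** * Continuity of the evolution map *)

Section EqualOnInterval.
Context {R : realType} {E : lcsType R}.

Lemma eq_is_primitive k (a b : R) (g h : R -> E) (f : vLspace k a b E) : a <= b ->
  (forall t, t \in `[a, b] -> g t = h t) -> is_primitive g f -> is_primitive h f.
Proof.
move=> ab gh pg t tab; have [v vi gv] := pg t tab; exists v => //.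
by rewrite -!gh// in_itv/= lexx.
Qed.

Lemma eq_AC_vec k (a b : R) (g h : R -> E) : a <= b ->
  (forall t, t \in `[a, b] -> g t = h t) -> AC_vec k a b g -> AC_vec k a b h.
Proof. by move=> ab gh [f pf]; exists f; exact: eq_is_primitive pf. Qed.

Lemma eq_AC_coord k (a b : R) (g h : R -> E) : a <= b ->
  (forall t, t \in `[a, b] -> g t = h t) -> AC_coord k a b g = AC_coord k a b h.
Proof.
move=> ab gh; rewrite /AC_coord gh ?in_itv/= ?lexx//; congr pair.
rewrite /AC_deriv; congr xget; apply/seteqP; split=> f.
  exact: eq_is_primitive.
by apply: eq_is_primitive => // t tab; rewrite gh.
Qed.

End EqualOnInterval.

Lemma adapted_mono (R : realType) (E : lcsType R) (N : chartedType E) k (a b : R)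
    (h : R -> N) (D : AC_data N) : adapted k a b h D ->
  forall i j, (i <= j <= ac_size D)%N -> ac_pt D i <= ac_pt D j.
Proof.
move=> [_ _ hD] i j /andP[ij jn]; elim: j ij jn => [|j IH] ij jn.
  by rewrite (_ : i = 0%N)//; apply/eqP; rewrite -leqn0.
move: ij; rewrite leq_eqVlt => /orP[/eqP -> //|ij].
by apply: (le_trans (IH ij (ltnW jn))); have [/ltW] := hD _ jn.
Qed.

Lemma adapted_bounds (R : realType) (E : lcsType R) (N : chartedType E) k (a b : R)
    (h : R -> N) (D : AC_data N) : adapted k a b h D ->
  forall i, (i < ac_size D)%N -> a <= ac_pt D i /\ ac_pt D i.+1 <= b.
Proof.
move=> hD i iD; have [<- <- _] := hD.
by split; apply: (adapted_mono hD); [exact: ltnW|rewrite iD leqnn].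
Qed.

Section SolutionFamily.
Context {R : realType} {E : lcsType R} {G : chartedGroupType E} {k : Lkind R}.
Variables (S : local_addition G) (y : vLspace k 0 1 (lie_alg G) -> ACmap k 0 1 G).
Hypotheses (hG : right_half_lie G)
  (y_solution : forall f, is_solution_on f `[0, 1] (y f))
  (tau_continuous : continuous (fun vg : lie_alg G * G => raction vg.1 vg.2)).

Let hM : is_manifold G. Proof. by case: hG. Qed.

Variable f0 : vLspace k 0 1 (lie_alg G).
Hypothesis y_cvg : forall t,
  (fun z : R * vLspace k 0 1 (lie_alg G) => y z.2 z.1) @ (t, f0) --> y f0 t.

Definition chart_close c d (phi : pchart G E) (f : vLspace k 0 1 (lie_alg G)) :=
  forall t, t \in `[c, d] ->
    cdom phi (y f t) /\ la_img S (y f0 t, y f t).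

Lemma chart_close_near c d phi : charts G phi ->
  y f0 @` `[c, d] `<=` cdom phi -> \forall f \near f0, chart_close c d phi f.
Proof.
move=> cphi hphi; have [[od _ _ _ _] _] := cphi.
apply: (@uniformly_near R _ _ (fun f => y f : R -> G) f0 c d
  (fun t z => cdom phi z /\ la_img S (y f0 t, z)) y_cvg) => t tcd.
have c1 : \forall z \near (t, y f0 t), cdom phi z.2.
  apply: (@cvg_snd _ _ (nbhs t) (nbhs (y f0 t)) _ (cdom phi)).
  by apply: open_mem_nbhs od _; apply: hphi; exists t.
have c2 : (fun z : R * G => (y f0 z.1, z.2)) @ (t, y f0 t) -->
    (y f0 t, y f0 t).
  apply: cvg_pair; last exact: cvg_snd.
  apply: (@cvg_comp _ _ _ fst (y f0) _ (nbhs t)); first exact: cvg_fst.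
  exact: AC_fun_continuous.
have c3 := c2 _ (open_mem_nbhs (@la_img_open R E G S) (la_img_diag S (y f0 t))).
exact: filterI c1 c3.
Qed.

Section OneInterval.
Variables (c d : R) (phi : pchart G E).
Hypotheses (c0 : 0 <= c) (cd : c < d) (d1 : d <= 1) (cphi : charts G phi)
  (hphi : y f0 @` `[c, d] `<=` cdom phi).

Let x f t := phi (y f t).

Lemma chart_close_flows f : chart_close c d phi f ->
  flows_along c d f0 (ctarget phi) (right_field phi) x (chart_la_dom S phi) f.
Proof.
move=> hf; have [pp _] := cphi; have [_ _ pK _ _] := pp.
have hdom t : t \in `[c, d] -> cdom phi (y f t) by move=> /hf[].
have h0dom t : t \in `[c, d] -> cdom phi (y f0 t).
  by move=> tcd; apply: hphi; exists t.
split.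
- apply/subspace_continuousP => t tcd; apply: cvg_within_filter.
  apply: (@cvg_comp _ _ _ (y f) phi _ (nbhs (y f t))).
    exact: AC_fun_continuous.
  exact: (pchart_continuous pp (hdom t tcd)).
- move=> t tcd; apply: chart_la_domP; [exact: h0dom|exact: hdom|].
  by have [] := hf t tcd.
- by move=> t tcd; exists (y f t) => //; exact: hdom.
move=> t tcd; have [_ /(_ c d phi cd)] := y_solution f.
have sub : `[c, d] `<=` (`[0, 1]%classic : set R) by exact: itv_subset.
have im : y f @` `[c, d] `<=` cdom phi by move=> _ [s scd <-]; exact: hdom.
move=> /(_ sub cphi im) [_ /(_ t tcd)[v hv ev]].
exists v; last exact: ev.
apply: eq_weak_integral hv => s sct.
rewrite /right_field /x /= pK//; apply: hdom.
move: sct tcd; rewrite !in_itv/= => /andP[-> st] /andP[_ td].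
exact: le_trans td.
Qed.

Let xc t : t \in `[c, d] ->
  (fun z : R * vLspace k 0 1 (lie_alg G) => x z.2 z.1) @
    within [set z | z.1 \in `[c, d]] (nbhs (t, f0)) --> x f0 t.
Proof.
move=> tcd; apply: cvg_within_filter.
apply: (@cvg_comp _ _ _ (fun z : R * vLspace k 0 1 (lie_alg G) => y z.2 z.1)
  phi _ (nbhs (y f0 t))); first exact: y_cvg.
have [pp _] := cphi; apply: (pchart_continuous pp).
by apply: hphi; exists t.
Qed.

Lemma chart_close_self : chart_close c d phi f0.
Proof.
by move=> t tcd; split; [apply: hphi; exists t|exact: la_img_diag].
Qed.

Definition lift f t := la_inv S (y f0 t, y f t).

Lemma lift_chart f t : chart_close c d phi f -> t \in `[c, d] ->
  chart_la S phi (x f0 t, x f t) = tangent_chart phi (lift f t).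
Proof.
move=> hf tcd; rewrite chart_laE//; first by apply: hphi; exists t.
by have [] := hf t tcd.
Qed.

Lemma lift_AC f : chart_close c d phi f ->
  AC_vec k c d (tangent_chart phi \o lift f).
Proof.
move=> hf; have oU := chart_la_dom_open (S := S) cphi.
have sm := chart_la_smooth hM S cphi.
have [ac _] := superposition_AC c0 (ltW cd) d1
  (right_field_continuous hG tau_continuous cphi)
  (fun z cz => right_field_linear hG cphi cz) oU (smooth_C1 oU sm)
  (chart_close_flows chart_close_self) (chart_close_flows hf).
by apply: eq_AC_vec ac => [|t tcd]; [exact: ltW|exact: lift_chart].
Qed.

Lemma lift_cvg :
  (fun f => AC_coord k c d (dchart phi \o lift f)) @ f0 -->
  AC_coord k c d (dchart phi \o lift f0).
Proof.
have oU := chart_la_dom_open (S := S) cphi.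
have sm : smooth_on (chart_la_dom S phi) (snd \o chart_la S phi).
  apply: (smooth_comp oU openT _ (chart_la_smooth hM S cphi)) => //.
  by apply: smooth_linear; [exact: openT|exact: cont_linear_snd].
have nf := chart_close_near cphi hphi.
have E1 f : chart_close c d phi f ->
    AC_coord k c d (fun t => (snd \o chart_la S phi) (x f0 t, x f t)) =
    AC_coord k c d (dchart phi \o lift f).
  move=> hf; apply: eq_AC_coord => [|t tcd]; first exact: ltW.
  exact: (congr1 snd (lift_chart hf tcd)).
suff key z : AC_coord k c d (fun t => (snd \o chart_la S phi) (x f0 t, x f0 t)) = z ->
    (fun f => AC_coord k c d (dchart phi \o lift f)) @ f0 --> z.
  exact: key (E1 f0 chart_close_self).
move=> <-; apply: (cvg_near_eq _ (filterS E1 nf)).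
apply: (superposition_cvg c0 (ltW cd) d1
  (right_field_continuous hG tau_continuous cphi)
  (fun z cz => right_field_linear hG cphi cz) oU _ (smooth_C1 oU sm)
  (chart_close_flows chart_close_self) _ xc).
  by apply/Ck0 => //; exact: sm.
by apply: filterS nf => f; exact: chart_close_flows.
Qed.

End OneInterval.

Let h := y f0.
Let D := AC_choice h.

Let hD : adapted k 0 1 h D. Proof. exact: projT2 (cid (AC_adapted h)). Qed.

Definition liftable f := forall i : 'I_(ac_size D),
  chart_close (ac_pt D i) (ac_pt D i.+1) (ac_chart D i) f.

Lemma liftable_near : \forall f \near f0, liftable f.
Proof.
apply: (@filter_forall _ 'I_(ac_size D) (fun i f =>
  chart_close (ac_pt D i) (ac_pt D i.+1) (ac_chart D i) f) (nbhs f0)) => i.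
have [_ _ /(_ i (ltn_ord i))[_ ci hi _]] := hD.
exact: chart_close_near.
Qed.

Lemma partition_cover t : t \in `[0, 1] ->
  exists i : 'I_(ac_size D), t \in `[ac_pt D i, ac_pt D i.+1].
Proof.
have [D0 D1 _] := hD; rewrite in_itv/= => /andP[t0 t1].
have : exists n, (n <= ac_size D)%N && (t <= ac_pt D n).
  by exists (ac_size D); rewrite leqnn D1.
move=> /ex_minnP[[|n] /andP[nD tn] hmin].
  have s0 : (0 < ac_size D)%N.
    rewrite lt0n; apply/eqP => s0; move: D1; rewrite s0 D0 => /eqP.
    by rewrite eq_sym oner_eq0.
  exists (Ordinal s0); rewrite in_itv/= D0 t0/=.
  apply: (le_trans tn); apply: (adapted_mono hD); exact: s0.
exists (Ordinal nD); rewrite in_itv/= tn andbT leNgt; apply/negP => lt.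
by have := hmin n; rewrite (ltnW nD) (ltW lt) ltnn => /(_ isT).
Qed.

Lemma liftable_img f t : liftable f -> la_img S (y f0 t, y f t).
Proof.
move=> hf; rewrite -(AC_clamp (y f0)) -(AC_clamp (y f)).
have [i ti] := partition_cover (clamp_itv t ler01).
by have [] := hf i _ ti.
Qed.

Lemma lift_section f : liftable f -> exists s : Gamma h, (s : R -> _) = lift f.
Proof.
move=> hf.
have sc : {within `[0, 1], continuous (lift f)}.
  apply/subspace_continuousP => t _; apply: cvg_within_filter.
  apply: (@cvg_comp _ _ _ (fun t => (y f0 t, y f t)) (la_inv S) _
    (nbhs (y f0 t, y f t))).
    by apply: cvg_pair; exact: AC_fun_continuous.
  exact: (la_inv_continuous (liftable_img t hf)).
have sa : exists D' : AC_data (tangent_bundle G), adapted k 0 1 (lift f) D'.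
  exists (ACData (ac_size D) (ac_pt D) (fun i => tangent_chart (ac_chart D i))).
  have [D0 D1 hi] := hD; split=> //= i iD.
  have [lt ci him _] := hi i iD; have [b0 b1] := adapted_bounds hD iD.
  split => //; first exact: tangent_chart_charts.
    move=> _ [t tD <-] /=; have [_ -> _] := la_inv_img (liftable_img t hf).
    by apply: him; exists t.
  by apply: lift_AC => //; exact: (hf (Ordinal iD)).
have scl t : lift f (clamp 0 1 t) = lift f t by rewrite /lift !AC_clamp.
pose s := MkACmap sc sa scl.
have so t : t \in `[0, 1] -> tbase (s t) = h t.
  by move=> _; have [_ -> _] := la_inv_img (liftable_img t hf).
by exists (MkGamma so).
Qed.

(** Near [y f0], an open set of the manifold of curves corresponds to an open
    set of sections along [y f0], and [lift f] is the section representing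
    [y f]. *)
Theorem solutions_continuous_at :
  (y : _ -> ACmfd k 0 1 S) @ f0 --> (y f0 : ACmfd k 0 1 S).
Proof.
have lf0 : liftable f0.
  move=> i; have [_ _ /(_ i (ltn_ord i))[_ _ hi _]] := hD.
  exact: chart_close_self.
have [s0 s0E] := lift_section lf0.
(* A section is available only for [f] near [f0]; [s0] is a default value. *)
pose u f := xget s0 [set s : Gamma h | (s : R -> _) = lift f].
have uE f : liftable f -> (u f : R -> _) = lift f.
  by move=> /lift_section[s sE]; rewrite /u; case: xgetP => [? -> //|/(_ s)].
have u_cvg : u @ f0 --> u f0.
  have F0 : Filter (nbhs f0) := @nbhs_filter (vLspace k 0 1 (lie_alg G)) f0.
  apply: (@cvg_initial _ _ (@Gamma_coord R k 0 1 E G h) _ (nbhs f0)).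
  apply: cvg_prod_topology => i.
  have [_ _ /(_ i (ltn_ord i))[lt ci hi _]] := hD.
  have [b0 b1] := adapted_bounds hD (ltn_ord i).
  have := lift_cvg b0 lt b1 ci hi.
  rewrite /= /Gamma_coord -/D (uE _ lf0); apply: cvg_near_eq.
  by apply: filterS liftable_near => f lf; rewrite (uE _ lf).
have rel f : liftable f -> forall t, t \in `[0, 1] ->
    la_dom S (u f t) /\ y f t = S (u f t).
  move=> lf t _; rewrite (uE _ lf).
  by have [? _ ->] := la_inv_img (liftable_img t lf).
move=> A; rewrite nbhsE => -[W [oW W0] WA].
have [V oV VW] := (oW : ACmfd_open W) h.
have V0 : V (u f0) by apply/(VW _ _ (rel _ lf0)).
apply: filterS (filterI liftable_near (u_cvg _ (open_mem_nbhs oV V0))).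
by move=> f [lf Vf]; apply: WA; apply/(VW _ _ (rel _ lf)).
Qed.

End SolutionFamily.

Theorem theorem1p9 (R : realType) (E : lcsType R) (G : chartedGroupType E)
    (Sigma : local_addition G) :
  right_half_lie G ->
  (forall (p : R) (p1 : 1 <= p) (sr : semiregular G (Lp p1)),
     sequentially_complete E ->
     continuous (EvolC sr) ->
     continuous (fun vg : lie_alg G * G => raction vg.1 vg.2) ->
     continuous (Evol sr Sigma))
  /\
  (forall sr : semiregular G Linfrc,
     integral_complete E ->
     continuous (EvolC sr) ->
     continuous (fun vg : lie_alg G * G => raction vg.1 vg.2) ->
     continuous (Evol sr Sigma)).
Proof.
move=> hG; split=> [p p1 sr _ ec tc f|sr _ ec tc f].
  have yc := @evol_jointly_continuous _ _ _ _ _ ec f.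
  have H := @solutions_continuous_at _ _ _ _ Sigma _ hG (evol_solution sr) tc f yc.
  exact: H.
have yc := @evol_jointly_continuous _ _ _ _ _ ec f.
exact: (@solutions_continuous_at _ _ _ _ Sigma _ hG (evol_solution sr) tc f yc).
Qed.
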